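(* Let $n\ge 3$ and let $(\bar M^n,g)$ be a compact connected Riemannian manifold with non-empty smooth boundary. Then there exists $u\in C^\infty(\bar M)$ such that the conformal metric $g_u=e^{2u}g$ has positive Einstein tensor on $\bar M$, that is, the symmetric $(0,2)$-tensor $G_{g_u}=\mathrm{Ric}_{g_u}-\frac{R_{g_u}}{2}\, g_u$ is positive definite at every point of $\bar M$.
   Context: $\bar M=M\cup\partial M$ is the manifold including its boundary $\partial M$, with interior $M$; $C^\infty(\bar M)$ denotes real-valued functions smooth up to the boundary. $\mathrm{Ric}_h$ and $R_h$ denote the Ricci curvature tensor and the scalar curvature of a Riemannian metric $h$. *)

(* Defs.v *)
(* Mathematical Components + MathComp-Analysis *)
From HB Require Import structures.
From mathcomp Require Import all_boot all_order all_algebra.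
From mathcomp Require Import all_classical all_reals all_analysis.
Set Implicit Arguments.
Unset Strict Implicit.
Unset Printing Implicit Defensive.
Import Order.TTheory GRing.Theory Num.Theory.
Import numFieldNormedType.Exports.
Local Open Scope classical_set_scope.
Local Open Scope ring_scope.

(* Manifolds with boundary are modelled on {x : x_0 >= 0}, and tensor fields
   are given by their components in the charts of an atlas (classical tensor
   calculus).  A function of the local coordinates is a total function on
   'rV[R]_n that is only meaningful on the image of the chart. *)

Definition halfspace (R : realType) (n : nat) : set 'rV[R]_n :=
  [set x | forall k : 'I_n, k = 0%N :> nat -> 0 <= x 0 k].
Arguments halfspace : clear implicits.

Definition halfspace_boundary (R : realType) (n : nat) : set 'rV[R]_n :=
  [set x | exists k : 'I_n, k = 0%N :> nat /\ x 0 k = 0].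

(* F is of class C^k on V; meant for open V. *)
Fixpoint Ck (R : realType) (n k : nat) (V : set 'rV[R]_n) (F : 'rV[R]_n -> R)
    : Prop :=
  (forall x, V x -> {for x, continuous F}) /\
  match k with
  | 0%N => True
  | k'.+1 => forall i : 'I_n,
      (forall x, V x -> derivable F x 'e_i) /\ Ck k' V ('D_'e_i F)
  end.

(* Smoothness on a subset A of R^n that need not be open: local existence of
   smooth extensions.  For A relatively open in the half-space this is
   smoothness up to the boundary. *)
Definition smooth_on (R : realType) (n : nat) (A : set 'rV[R]_n)
    (f : 'rV[R]_n -> R) : Prop :=
  forall x, A x -> exists (V : set 'rV[R]_n) (F : 'rV[R]_n -> R),
    [/\ open V, V x, forall k, Ck k V F & forall y, V y -> A y -> F y = f y].

(* The i-th partial derivative relative to the half-space: only increments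
   staying in the half-space are used, so that it is one-sided in the normal
   direction at a boundary point, and the usual partial derivative otherwise. *)
Definition hpartial (R : realType) (n : nat) (i : 'I_n) (f : 'rV[R]_n -> R)
    (x : 'rV[R]_n) : R :=
  lim (t^-1 * (f (x + t *: 'e_i) - f x)
       @[t --> within [set t : R | halfspace R n (x + t *: 'e_i)] 0^']).

(* Hence on smooth functions hpartial is the partial derivative of any smooth
   extension. *)
Lemma hpartial_extension (R : realType) (n : nat) (i : 'I_n)
    (f F : 'rV[R]_n -> R) (V : set 'rV[R]_n) (x : 'rV[R]_n) :
  open V -> V x -> halfspace R n x -> derivable F x 'e_i ->
  (forall y, V y -> halfspace R n y -> F y = f y) ->
  hpartial i f x = 'D_'e_i F x.
Proof.
move=> Vo Vx Hx dF Ff.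
set S := [set t : R | halfspace R n (x + t *: 'e_i)].
have PF : ProperFilter (within S 0^').
  apply: Build_ProperFilter_ex => P; rewrite /within /= => -[e /= e0 eP].
  exists (e / 2); apply: eP => /=.
  - by rewrite sub0r normrN ger0_norm ?ltr_pdivrMr ?mulr1 ?divr_ge0 ?ltW // ltr_pMr ?ltr1n.
  - by rewrite mulf_neq0 ?gt_eqF ?invr_gt0.
  move=> k k0; rewrite !mxE addr_ge0 ?Hx // mulr_ge0 ?ler0n //; first (by apply: ltW; apply: divr_gt0; rewrite ?ltr0n); by apply: ler0n.
rewrite /hpartial; apply: (@cvg_lim R (@Rhausdorff R) _ _ PF).
have : (h^-1 *: ((F \o shift x) (h *: 'e_i) - F x) @[h --> within S 0^']) --> 'D_'e_i F x.
  apply: cvg_trans dF; apply: cvg_app; exact: cvg_within.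
apply: cvg_trans; apply: near_eq_cvg.
have cV : (x + t *: 'e_i) @[t --> (0:R)^'] --> x.
  rewrite -[X in _ --> X]addr0; apply: cvgD; first exact: cvg_cst.
  rewrite -(scale0r ('e_i : 'rV[R]_n)); apply: cvgZr_tmp; exact: cvg_within.
have nV : \forall t \near (0:R)^', V (x + t *: 'e_i).
  by apply: cV; exact: open_nbhs_nbhs.
move: nV; apply: filterS => t Vt St.
have -> : (F \o shift x) (t *: (delta_mx 0 i : 'rV[R]_n)) =
    f (x + t *: (delta_mx 0 i : 'rV[R]_n)) by rewrite /= addrC (Ff _ Vt St).
by rewrite (Ff _ Vx Hx).
Qed.

(* Row convention: the differential is v |-> v *m hjacobian phi x. *)
Definition hjacobian (R : realType) (n : nat) (phi : 'rV[R]_n -> 'rV[R]_n)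
    (x : 'rV[R]_n) : 'M[R]_n :=
  \matrix_(i, j) hpartial i (fun y => phi y 0 j) x.

Record chart (R : realType) (n : nat) (M : topologicalType) := Chart {
  chart_dom : set M;
  chart_coord : M -> 'rV[R]_n;
  chart_param : 'rV[R]_n -> M;
  chart_dom_open : open chart_dom;
  chart_coord_open : exists2 W : set 'rV[R]_n,
    open W & chart_coord @` chart_dom = W `&` halfspace R n;
  chart_coordK : forall p, chart_dom p -> chart_param (chart_coord p) = p;
  chart_coord_continuous : {within chart_dom, continuous chart_coord};
  chart_param_continuous : {within chart_coord @` chart_dom, continuous chart_param} }.

Record manifold (R : realType) (n : nat) := Manifold {
  points :> topologicalType;
  points_hausdorff : hausdorff_space points;
  points_second_countable : @second_countable points;
  chart_index : Type;
  atlas : chart_index -> chart R n points;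
  atlas_cover : forall p, exists a, chart_dom (atlas a) p;
  atlas_compatible : forall (a b : chart_index) (k : 'I_n),
    smooth_on (chart_coord (atlas a) @` (chart_dom (atlas a) `&` chart_dom (atlas b)))
      (fun x => chart_coord (atlas b) (chart_param (atlas a) x) 0 k) }.

Definition boundary_points (R : realType) (n : nat) (M : manifold R n) : set M :=
  [set p | exists a : chart_index M,
     chart_dom (atlas a) p /\ halfspace_boundary (chart_coord (atlas a) p)].
Arguments boundary_points {R n} M.

Definition chart_image (R : realType) (n : nat) (M : manifold R n)
    (a : chart_index M) : set 'rV[R]_n :=
  chart_coord (atlas a) @` chart_dom (atlas a).

Definition smooth (R : realType) (n : nat) (M : manifold R n) (u : M -> R)
    : Prop :=
  forall a : chart_index M,
    smooth_on (chart_image a) (fun x => u (chart_param (atlas a) x)).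

(* Components T a x i j of a (0,2)-tensor field in the chart a at the point of
   coordinates x. *)
Definition components2 (R : realType) (n : nat) (M : manifold R n) :=
  chart_index M -> 'rV[R]_n -> 'M[R]_n.

Definition is_tensor2 (R : realType) (n : nat) (M : manifold R n)
    (T : components2 M) : Prop :=
  forall (a b : chart_index M) (p : M),
    chart_dom (atlas a) p -> chart_dom (atlas b) p ->
    let x := chart_coord (atlas a) p in
    let J := hjacobian (fun y => chart_coord (atlas b) (chart_param (atlas a) y)) x in
    T a x = J *m T b (chart_coord (atlas b) p) *m J^T.

Definition smooth2 (R : realType) (n : nat) (M : manifold R n)
    (T : components2 M) : Prop :=
  forall (a : chart_index M) (i j : 'I_n),
    smooth_on (chart_image a) (fun x => T a x i j).

Definition symmetric2 (R : realType) (n : nat) (M : manifold R n)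
    (T : components2 M) : Prop :=
  forall (a : chart_index M) (x : 'rV[R]_n),
    chart_image a x -> (T a x)^T = T a x.

Definition positive_definite2 (R : realType) (n : nat) (M : manifold R n)
    (T : components2 M) : Prop :=
  forall (a : chart_index M) (x : 'rV[R]_n), chart_image a x ->
    forall v : 'rV[R]_n, v != 0 -> 0 < (v *m T a x *m v^T) 0 0.

Record metric (R : realType) (n : nat) (M : manifold R n) := Metric {
  metric_components :> components2 M;
  metric_tensor : is_tensor2 metric_components;
  metric_smooth : smooth2 metric_components;
  metric_symmetric : symmetric2 metric_components;
  metric_positive : positive_definite2 metric_components }.

Section LocalCurvature.
Variables (R : realType) (n : nat) (h : 'rV[R]_n -> 'M[R]_n).

(* Gamma^k_ij *)
Definition christoffel (k i j : 'I_n) (x : 'rV[R]_n) : R :=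
  2^-1 * \sum_(l < n) invmx (h x) k l *
    (hpartial i (fun y => h y j l) x + hpartial j (fun y => h y i l) x
     - hpartial l (fun y => h y i j) x).

(* The l-th component of R(d_i, d_j) d_k, with
   R(X, Y) Z = D_X D_Y Z - D_Y D_X Z - D_[X, Y] Z. *)
Definition riemann (l i j k : 'I_n) (x : 'rV[R]_n) : R :=
  hpartial i (christoffel l j k) x - hpartial j (christoffel l i k) x
  + \sum_(m < n) (christoffel l i m x * christoffel m j k x
                  - christoffel l j m x * christoffel m i k x).

(* Ric(Y, Z) = tr (X |-> R(X, Y) Z), positive on round spheres. *)
Definition ricci (x : 'rV[R]_n) : 'M[R]_n :=
  \matrix_(j, k) \sum_(i < n) riemann i i j k x.

Definition scalar_curvature (x : 'rV[R]_n) : R :=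
  \sum_(i < n) \sum_(j < n) invmx (h x) i j * ricci x i j.

Definition einstein (x : 'rV[R]_n) : 'M[R]_n :=
  ricci x - (scalar_curvature x / 2) *: h x.

End LocalCurvature.

Definition einstein_tensor (R : realType) (n : nat) (M : manifold R n)
    (h : components2 M) : components2 M :=
  fun a => einstein (h a).

(* e^{2u} g *)
Definition conformal (R : realType) (n : nat) (M : manifold R n) (u : M -> R)
    (g : components2 M) : components2 M :=
  fun a x => expR (2 * u (chart_param (atlas a) x)) *: g a x.

(* Main.v *)
(* With u = exp (l f), the conformal change formula
     G(e^{2u} g) = G(g)
       + (n - 2) (du (x) du - Hess u + (Lap u + (n - 3)/2 |du|^2) g)
   reads, as Hess u = l u Hess f + l^2 u df (x) df,
     G(g) + (n - 2) l u (l (u - 1) df (x) df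
       + (l |df|^2 + Lap f) g - Hess f + (n - 3)/2 l u |df|^2 g),
   which is positive for large l wherever f > 0 and df <> 0.  By compactness it
   suffices to find a positive smooth f without critical points, and exp f will
   do if f is any smooth function without critical points.

   A generic linear combination of cut-off coordinate functions has only
   nondegenerate, hence finitely many, critical points.  Among the functions
   with finitely many critical points take one with the fewest.  A local
   translation x + b(x) d, with b a bump function of small slope and d short,
   pulls functions back without creating critical points.  Such translations
   move a critical point anywhere in the interior, M being connected, and
   finally to a point near the boundary that is missed by an injective push into
   M: the composite has one critical point less, so there was none. *)

(* Positivity has to hold in every chart at a point, while the estimate near it is made in one chart
   with one bound on l; so the Einstein tensor must be known to transform as a tensor. Both this and
   the conformal change formula are drawn from the uniqueness of the Levi-Civita connection, which
   spares most manipulations of Christoffel symbols. Elementary arguments stand in for the inverse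
   function theorem and for Sard's theorem. Mean value expansions, with a separate intermediate
   point for each partial derivative, show that nondegenerate zeros are isolated. A pigeonhole
   argument gives arbitrarily small regular values on a cube, and the openness of nondegeneracy on
   compact sets makes up for their not being known to have full measure. The maps that move critical
   points are injective but may miss points, so critical points of a composite are counted through
   preimages. A boundary point is critical only if its one-sided normal derivative vanishes too, so
   it is treated like the others, through extensions across the boundary. *)
Require Import Defs.
From mathcomp Require Import all_boot all_order all_algebra.
From mathcomp Require Import all_classical all_reals all_analysis.
From mathcomp Require Import ring lra zify.
Import Order.TTheory GRing.Theory Num.Theory.
Import numFieldNormedType.Exports.
Local Open Scope classical_set_scope.
Local Open Scope ring_scope.

Set Implicit Arguments.
Unset Strict Implicit.
Unset Printing Implicit Defensive.

(** * Differential calculus in coordinates *)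

Section MeanValue.
Variables (R : realType) (n : nat).
Implicit Types (F : 'rV[R]_n -> R) (x y : 'rV[R]_n).

Lemma norm_rV_le x (r : R) : 0 <= r ->
  (`|x| <= r) <-> (forall j, `|x 0 j| <= r).
Proof.
move=> r0; rewrite [`|x|]mx_normrE; split=> [/bigmax_leP [_ h] j|h].
  exact: (h (0, j)).
by apply/bigmax_leP; split => // -[i j] _ /=; rewrite ord1.
Qed.

Lemma coord_le_norm x j : `|x 0 j| <= `|x|.
Proof. by apply: (norm_rV_le x (normr_ge0 x)).1. Qed.

Lemma is_derive_line F x (v : 'rV[R]_n) (s : R) :
  derivable F (s *: v + x) v ->
  is_derive s 1 (fun t => F (t *: v + x)) ('D_v F (s *: v + x)).
Proof.
set g := fun t => F (t *: v + x).
have E : (fun h : R => h^-1 *: ((g \o shift s) (h *: (1 : R)) - g s)) =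
   (fun h : R => h^-1 *: ((F \o shift (s *: v + x)) (h *: v) - F (s *: v + x))).
  by apply/funext => h; rewrite /g /= [h *: (1:R)]mulr1 scalerDl addrA.
by move=> dF; apply: DeriveDef; rewrite /derivable /derive E.
Qed.

Lemma mean_value_line F x (v : 'rV[R]_n) (t : R) :
  (forall s, `|s| <= `|t| -> derivable F (s *: v + x) v) ->
  exists2 s, `|s| <= `|t| & F (t *: v + x) - F x = t * 'D_v F (s *: v + x).
Proof.
move=> dF; pose g := fun s => F (s *: v + x).
have gt (s : R) : `|s| <= `|t| -> is_derive s 1 g ('D_v F (s *: v + x)).
  by move=> /dF /is_derive_line.
have gc (a b : R) : (forall s, s \in `[a, b] -> `|s| <= `|t|) ->
    {within `[a, b], continuous g}.
  move=> h; apply: derivable_within_continuous => s /h /gt; by case.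
have Fx : F x = g 0 by rewrite /g scale0r add0r.
case: (leP 0 t) => t0.
- have h s : s \in `[0, t] -> `|s| <= `|t|.
    by rewrite in_itv /= => /andP[a b]; rewrite !ger0_norm.
  have [|c /h ct E] := @MVT_segment R g (fun s => 'D_v F (s *: v + x)) 0 t t0 _ (gc _ _ h).
    move=> s sab; apply: gt; apply: h; exact: subset_itv_oo_cc.
  by exists c => //; rewrite Fx -/(g t) E subr0 mulrC.
- have h s : s \in `[t, 0] -> `|s| <= `|t|.
    by rewrite in_itv /= => /andP[a b]; rewrite !ler0_norm ?lerN2// ltW.
  have [|c /h ct E] := @MVT_segment R g (fun s => 'D_v F (s *: v + x)) t 0 (ltW t0) _ (gc _ _ h).
    move=> s sab; apply: gt; apply: h; exact: subset_itv_oo_cc.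
  by exists c => //; rewrite Fx -/(g t) -opprB E sub0r mulrN opprK mulrC.
Qed.

(* The path from x to y changes one coordinate at a time and stays in the
   sup-norm ball of centre x through y. *)
Lemma mean_value F x y :
  (forall z j, `|z - x| <= `|y - x| -> derivable F z 'e_j) ->
  exists2 xi : 'I_n -> 'rV[R]_n, (forall j, `|xi j - x| <= `|y - x|) &
    F y - F x = \sum_j (y 0 j - x 0 j) * 'D_'e_j F (xi j).
Proof.
move=> dF.
pose z k : 'rV[R]_n := \row_j if (j < k)%N then y 0 j else x 0 j.
have zS (k : 'I_n) : z k.+1 = (y 0 k - x 0 k) *: 'e_k + z k.
  apply/rowP => j; rewrite !mxE /= ltnS leq_eqVlt.
  have [->|jk] := eqVneq j k; first by rewrite eqxx ltnn mulr1 subrK.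
  by rewrite (negPf (jk : val j != val k)) mulr0 add0r.
have zn (k : 'I_n) s : `|s| <= `|y 0 k - x 0 k| -> `|s *: 'e_k + z k - x| <= `|y - x|.
  move=> sk; apply/(norm_rV_le _ (normr_ge0 _)) => j; rewrite !mxE.
  have yj i : `|y 0 i - x 0 i| <= `|y - x|.
    by have := coord_le_norm (y - x) i; rewrite !mxE.
  have [->|jk] := eqVneq j k.
    by rewrite eqxx ltnn mulr1 addrK (le_trans sk).
  by rewrite andbF mulr0 add0r; case: ifP => // _; rewrite subrr normr0.
have key (k : 'I_n) : exists xi, `|xi - x| <= `|y - x| /\
    F (z k.+1) - F (z k) = (y 0 k - x 0 k) * 'D_'e_k F xi.
  rewrite zS; have [|s sk E] := @mean_value_line F (z k) 'e_k (y 0 k - x 0 k).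
    by move=> s sk; apply: dF; apply: zn.
  by exists (s *: 'e_k + z k); split => //; apply: zn.
have [xi xiP] := choice key.
exists xi => [j|]; first by case: (xiP j).
rewrite -(eq_bigr _ (fun j _ => (xiP j).2)).
rewrite -(big_mkord xpredT (fun k => F (z k.+1) - F (z k))) telescope_sumr//.
congr (F _ - F _); apply/rowP => j; rewrite mxE ?ltn_ord ?ltn0 //.
Qed.

End MeanValue.

Lemma cvg_sum_fun (R : realType) (T : Type) (F : set_system T) (FF : Filter F)
    (I : Type) (r : seq I) (P : pred I) (f : I -> T -> R) (l : I -> R) :
  (forall i, P i -> f i @ F --> l i) ->
  (fun x => \sum_(i <- r | P i) f i x) @ F --> \sum_(i <- r | P i) l i.
Proof.
move=> h; elim: r => [|i r IH].
  by rewrite big_nil; under eq_fun do rewrite big_nil; exact: cvg_cst.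
rewrite big_cons; under eq_fun do rewrite big_cons.
by case: ifP => // Pi; apply: cvgD => //; exact: h.
Qed.

Lemma cvg_prod_fun (R : realType) (T : Type) (F : set_system T) (FF : Filter F)
    (I : Type) (r : seq I) (P : pred I) (f : I -> T -> R) (l : I -> R) :
  (forall i, P i -> f i @ F --> l i) ->
  (fun x => \prod_(i <- r | P i) f i x) @ F --> \prod_(i <- r | P i) l i.
Proof.
move=> h; elim: r => [|i r IH].
  by rewrite big_nil; under eq_fun do rewrite big_nil; exact: cvg_cst.
rewrite big_cons; under eq_fun do rewrite big_cons.
by case: ifP => // Pi; apply: cvgM => //; exact: h.
Qed.

Lemma cvg_det (R : realType) (T : Type) (F : set_system T) (FF : Filter F) m
    (A : T -> 'M[R]_m) (B : 'M[R]_m) :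
  (forall i j, (fun x => A x i j) @ F --> B i j) ->
  (fun x => \det (A x)) @ F --> \det B.
Proof.
move=> h; rewrite /determinant; apply: cvg_sum_fun => s _.
by apply: cvgM; [exact: cvg_cst|apply: cvg_prod_fun => i _; exact: h].
Qed.

Lemma cvg_rV (R : realType) n (W : Type) (F : set_system W) (FF : Filter F)
    (T : W -> 'rV[R]_n) (l : 'rV[R]_n) :
  (forall j, (fun t => T t 0 j) @ F --> l 0 j) -> T @ F --> l.
Proof.
move=> h; apply/cvgrPdist_le => e e0.
have : \forall t \near F, forall j, `|l 0 j - T t 0 j| <= e.
  by apply: filter_forall => j; move/cvgrPdist_le : (h j); exact.
by apply: filterS => t ht; apply/(norm_rV_le _ (ltW e0)) => j; rewrite !mxE.
Qed.

Lemma continuous_rV (R : realType) n (W : topologicalType) (T : W -> 'rV[R]_n) (x : W) :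
  (forall j, {for x, continuous (fun t => T t 0 j)}) -> {for x, continuous T}.
Proof. by move=> h; apply: cvg_rV => j; exact: h. Qed.

Section ChainRule.
Variables (R : realType) (n : nat).

(** The increment of [F] is expanded by [mean_value]; the intermediate points tend to [T t], where
    continuity of the partials gives the limit of the difference quotient. *)
Lemma is_derive_chain (W : normedModType R) (T : W -> 'rV[R]_n) (t v : W)
    (dT : 'I_n -> R) (F : 'rV[R]_n -> R) :
  (forall j, is_derive t v (fun s => T s 0 j) (dT j)) ->
  (\forall z \near T t, forall j, derivable F z 'e_j) ->
  (forall j, {for T t, continuous ('D_'e_j F)}) ->
  is_derive t v (F \o T) (\sum_j dT j * 'D_'e_j F (T t)).
Proof.
move=> TD Fd Fc.
have Tc (e : R) : 0 < e -> \forall h \near 0^', `|T (h *: v + t) - T t| <= e.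
  move=> e0.
  have : \forall h \near (0:R)^', forall j, `|T (h *: v + t) 0 j - T t 0 j| <= e.
    apply: filter_forall => j; apply: nbhs_dnbhs.
    have /derivable1P /derivable1_diffP /differentiable_continuous Cj := @ex_derive _ _ _ _ _ _ _ (TD j).
    move/cvgrPdist_le : Cj => /(_ e e0); rewrite scale0r add0r.
    by apply: filterS => h; rewrite distrC.
  by apply: filterS => h hj; apply/(norm_rV_le _ (ltW e0)) => j; rewrite !mxE.
have [r /= r0 Fr] := (nbhs_ballP _ _).1 Fd.
(* Intermediate points for every [h], with a junk value where [T (h *: v + t)] is too far from [T t]
   for [F] to be known to have partials. *)
have /choice[X XP] : forall h : R, exists xi : 'I_n -> 'rV[R]_n,
   `|T (h *: v + t) - T t| <= r / 2 ->
   (forall j, `|xi j - T t| <= `|T (h *: v + t) - T t|) /\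
   F (T (h *: v + t)) - F (T t) = \sum_j (T (h *: v + t) 0 j - T t 0 j) * 'D_'e_j F (xi j).
  move=> h; have [hr|hr] := pselect (`|T (h *: v + t) - T t| <= r / 2); last first.
    by exists (fun=> 0).
  have [|xi x1 x2] := @mean_value R n F (T t) (T (h *: v + t)).
    move=> z j zr; apply: Fr; rewrite -ball_normE /ball_ /= distrC.
    by rewrite (le_lt_trans zr)// (le_lt_trans hr)// ltr_pdivrMr// ltr_pMr// ltr1n.
  by exists xi.
have main : (fun h : R => h^-1 *: ((F \o T \o shift t) (h *: v) - (F \o T) t)) @ 0^' -->
    \sum_j dT j * 'D_'e_j F (T t).
  have nr : \forall h \near 0^', `|T (h *: v + t) - T t| <= r / 2 by apply: Tc; rewrite divr_gt0.
  apply: (@cvg_trans _ ((fun h : R => \sum_j (h^-1 *: (T (h *: v + t) 0 j - T t 0 j)) * 'D_'e_j F (X h j)) @ 0^')).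
    apply: near_eq_cvg; move: nr; apply: filterS => h /XP [_ E].
    rewrite /= E scaler_sumr; apply: eq_bigr => j _.
    by rewrite -mulrA.
  apply: cvg_sum_fun => j _; apply: cvgM.
    by have [d1 d2] := TD j; rewrite -d2; exact: d1.
  apply: (@cvg_comp _ _ _ (fun h => X h j) ('D_'e_j F) 0^' (nbhs (T t))); last exact: Fc.
  apply/cvgrPdist_le => e e0; have := Tc e e0; move: nr; apply: filterS2 => h /XP [h1 _] h2.
  by rewrite distrC (le_trans (h1 j)).
apply: DeriveDef; first by apply/cvg_ex; eexists; exact: main.
exact: cvg_lim main.
Qed.

End ChainRule.

(** Turns a directional derivative into a derivative on the line, where the one-variable chain rule
    applies. *)
Lemma is_derive_lineP (R : realType) (W W' : normedModType R) (f : W -> W') (x v : W) d :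
  is_derive x v f d <-> is_derive (0 : R) (1 : R) (fun h : R => f (h *: v + x)) d.
Proof.
have E : (fun h : R => h^-1 *: ((f \o shift x) (h *: v) - f x)) =
   (fun h : R => h^-1 *: (((fun h : R => f (h *: v + x)) \o shift (0 : R)) (h *: (1 : R)) - f ((0 : R) *: v + x))).
  by apply/funext => h /=; rewrite addr0 scale0r add0r [_%:A]mulr1.
by split=> -[d1 d2]; apply: DeriveDef; move: d1 d2; rewrite /derivable /derive E.
Qed.

Lemma is_derive_comp1 (R : realType) (W : normedModType R) (f : W -> R) (phi : R -> R)
    (x v : W) (a b : R) :
  is_derive (f x) (1 : R) phi a -> is_derive x v f b ->
  is_derive x v (fun y => phi (f y)) (a * b).
Proof.
move=> Dphi /is_derive_lineP Df; apply/is_derive_lineP.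
by apply: (@is_derive1_comp R phi) => //; rewrite scale0r add0r.
Qed.

(** * Closure properties of the classes [Ck] *)

Section CkClosure.
Variables (R : realType) (n : nat).
Implicit Types (V : set 'rV[R]_n) (F G : 'rV[R]_n -> R) (k : nat).

Lemma Ck_subset k V V' F : V' `<=` V -> Ck k V F -> Ck k V' F.
Proof.
move=> VV'; elim: k F => [|k IH] F [c d]; split => //; try by move=> x /VV' /c.
by move=> i; have [d1 d2] := d i; split => [x /VV' /d1 //|]; apply: IH.
Qed.

Lemma Ck_pred k V F : Ck k.+1 V F -> Ck k V F.
Proof.
by elim: k F => [|k IH] F [c d]; split => // i; have [d1 d2] := d i; split => //; exact: IH.
Qed.

Lemma Ck_derive k V F i : Ck k.+1 V F -> Ck k V ('D_'e_i F).
Proof. by move=> [_ /(_ i) []]. Qed.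

Lemma Ck_derivable k V F i x : Ck k.+1 V F -> V x -> derivable F x 'e_i.
Proof. by move=> [_ /(_ i) [d _]]; exact: d. Qed.

Lemma Ck_continuous k V F x : Ck k V F -> V x -> {for x, continuous F}.
Proof. by case: k => [|k] [c _]; exact: c. Qed.

Lemma Ck_eq k V F G : open V -> (forall x, V x -> F x = G x) ->
  Ck k V F -> Ck k V G.
Proof.
move=> oV; elim: k F G => [|k IH] F G FG.
  move=> [c _]; split => // x Vx.
  have nV : \forall z \near x, F z = G z.
    by apply: filterS (open_nbhs_nbhs (conj oV Vx)) => z /FG.
  have := c x Vx; rewrite /prop_for /continuous_at -(FG x Vx) => cx.
  exact: cvg_trans (near_eq_cvg nV) cx.
move=> [c d].
have nV x : V x -> \forall z \near x, F z = G z.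
  by move=> Vx; apply: filterS (open_nbhs_nbhs (conj oV Vx)) => z /FG.
split => [x Vx|i].
  have := c x Vx; rewrite /prop_for /continuous_at -(FG x Vx) => cx.
  exact: cvg_trans (near_eq_cvg (nV x Vx)) cx.
have [d1 d2] := d i; split => [x Vx|].
  by apply: near_eq_derivable (d1 x Vx); exact: nV.
by apply: IH d2 => x Vx; apply: near_eq_derive; exact: nV.
Qed.

Lemma Ck_cst k V (c : R) : Ck k V (fun=> c).
Proof.
elim: k c => [|k IH] c; split => //; try by move=> x _; exact: cst_continuous.
move=> i; split=> [x _|]; first exact: derivable_cst.
have -> : 'D_'e_i (fun=> c) = (fun=> 0) :> ('rV[R]_n -> R); last exact: IH.
by apply/funext => x; rewrite derive_cst.
Qed.

Lemma is_derive_coord (W : normedModType R) m (T : W -> 'rV[R]_m) x v l j :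
  is_derive x v T l -> is_derive x v (fun s => T s 0 j) (l 0 j).
Proof.
move=> [d <-]; rewrite derive_mx// mxE.
by apply: derivableP; apply: (derivable_mxP _ _ _).1.
Qed.

Lemma Ck_coord k V j : Ck k V (fun x => x 0 j).
Proof.
have D (x : 'rV[R]_n) i : is_derive x 'e_i (fun x => x 0 j) (('e_i : 'rV[R]_n) 0 j).
  by apply: (@is_derive_coord _ _ id); exact: is_derive_id.
elim: k => [|k IH]; split => //; try by move=> x _; exact: coord_continuous.
move=> i; split=> [x _|]; first by have [] := D x i.
have -> : 'D_'e_i (fun x : 'rV[R]_n => x 0 j) = (fun=> ('e_i : 'rV[R]_n) 0 j).
  by apply/funext => x; have [_ ->] := D x i.
exact: Ck_cst.
Qed.

Lemma Ck_add k V F G : open V -> Ck k V F -> Ck k V G -> Ck k V (fun x => F x + G x).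
Proof.
move=> oV; elim: k F G => [|k IH] F G [cF dF] [cG dG]; split => //.
- by move=> x Vx; apply: continuousD; [exact: cF|exact: cG].
- by move=> x Vx; apply: continuousD; [exact: cF|exact: cG].
move=> i; have [f1 f2] := dF i; have [g1 g2] := dG i; split => [x Vx|].
  by apply: derivableD; [exact: f1|exact: g1].
apply: Ck_eq (IH _ _ f2 g2) => // x Vx.
by symmetry; exact: (deriveD (f1 x Vx) (g1 x Vx)).
Qed.

Lemma Ck_mul k V F G : open V -> Ck k V F -> Ck k V G -> Ck k V (fun x => F x * G x).
Proof.
move=> oV; elim: k F G => [|k IH] F G CF CG; have [cF dF] := CF; have [cG dG] := CG; split => //.
- by move=> x Vx; apply: continuousM; [exact: cF|exact: cG].
- by move=> x Vx; apply: continuousM; [exact: cF|exact: cG].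
move=> i; have [f1 f2] := dF i; have [g1 g2] := dG i; split => [x Vx|].
  by apply: derivableM; [exact: f1|exact: g1].
have := Ck_add oV (IH _ _ (Ck_pred CF) g2) (IH _ _ (Ck_pred CG) f2).
apply: Ck_eq => // x Vx.
by symmetry; exact: (deriveM (f1 x Vx) (g1 x Vx)).
Qed.

Lemma Ck_sum k V (I : Type) (r : seq I) (P : pred I) (F : I -> 'rV[R]_n -> R) : open V ->
  (forall i, P i -> Ck k V (F i)) -> Ck k V (fun x => \sum_(i <- r | P i) F i x).
Proof.
move=> oV h; elim: r => [|i r IH].
  by apply: Ck_eq (Ck_cst k V 0) => // x _; rewrite big_nil.
case Pi : (P i).
  by apply: Ck_eq (Ck_add oV (h i Pi) IH) => // x _; rewrite big_cons Pi.
by apply: Ck_eq IH => // x _; rewrite big_cons Pi.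
Qed.

Lemma Ck_inv k V F : open V -> (forall x, V x -> F x != 0) ->
  Ck k V F -> Ck k V (fun x => (F x)^-1).
Proof.
move=> oV F0; elim: k => [|k IH] CF; have [cF dF] := CF; split => //.
- by move=> x Vx; apply: continuousV; [exact: F0|exact: cF].
- by move=> x Vx; apply: continuousV; [exact: F0|exact: cF].
move=> i; have [f1 f2] := dF i; split => [x Vx|].
  by apply: derivableV; [exact: F0|exact: f1].
have I := IH (Ck_pred CF).
have := Ck_mul oV (Ck_mul oV (Ck_cst k V (-1)) (Ck_mul oV I I)) f2.
apply: Ck_eq => // x Vx; rewrite deriveV//; [|exact: F0|exact: f1].
by rewrite mulN1r -expr2 exprVn.
Qed.

Lemma Ck_near_derivable k V F x : open V -> V x -> Ck k.+1 V F ->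
  \forall z \near x, forall j, derivable F z 'e_j.
Proof.
move=> oV Vx C; apply: filterS (open_nbhs_nbhs (conj oV Vx)) => z Vz j.
exact: Ck_derivable C Vz.
Qed.

(* Stability of the family under differentiation makes the induction on k go
   through. *)
Lemma Ck_family k V F (I : Type) (phi : I -> R -> R) (O : set R) :
  (forall i, exists (s : seq (R * I)), forall t, O t ->
     is_derive t (1 : R) (phi i) (\sum_(ci <- s) ci.1 * phi ci.2 t)) ->
  open V -> (forall x, V x -> O (F x)) ->
  Ck k V F -> forall i, Ck k V (fun x => phi i (F x)).
Proof.
move=> phiD oV VO; have c i x : V x -> {for x, continuous F} -> {for x, continuous (fun x => phi i (F x))}.
  move=> Vx cx; apply: (@continuous_comp _ _ _ F (phi i)) => //.
  have [s /(_ _ (VO x Vx)) [d _]] := phiD i.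
  exact/differentiable_continuous/derivable1_diffP.
elim: k => [|k IH] CF i; have [cF dF] := CF; split => //; try by move=> x Vx; apply: c => //; exact: cF.
move=> j; have [f1 f2] := dF j; have [s sP] := phiD i.
have D x : V x -> is_derive x 'e_j (fun x => phi i (F x))
    ((\sum_(ci <- s) ci.1 * phi ci.2 (F x)) * 'D_'e_j F x).
  by move=> Vx; apply: is_derive_comp1; [exact: sP (VO x Vx)|exact: derivableP (f1 x Vx)].
split => [x Vx|]; first by have [] := D x Vx.
have IH' := IH (Ck_pred CF).
have := Ck_mul oV (@Ck_sum k V _ s xpredT (fun ci x => ci.1 * phi ci.2 (F x)) oV
  (fun ci _ => Ck_mul oV (Ck_cst k V ci.1) (IH' ci.2))) f2.
apply: Ck_eq => // x Vx; by have [_ ->] := D x Vx.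
Qed.

End CkClosure.

Lemma Ck_comp (R : realType) (m n : nat) k (V : set 'rV[R]_m) (O : set 'rV[R]_n)
    (T : 'rV[R]_m -> 'rV[R]_n) (F : 'rV[R]_n -> R) :
  open V -> open O -> (forall x, V x -> O (T x)) ->
  (forall j, Ck k V (fun x => T x 0 j)) -> Ck k O F -> Ck k V (fun x => F (T x)).
Proof.
move=> oV oO VO.
have c (G : 'rV[R]_n -> R) x : V x -> (forall y, O y -> {for y, continuous G}) -> (forall j, {for x, continuous (fun x => T x 0 j)}) ->
    {for x, continuous (fun x => G (T x))}.
  move=> Vx cG cT; apply: (@continuous_comp _ _ _ T G); last by apply: cG; exact: VO.
  exact: continuous_rV.
elim: k F => [|k IH] F CT CF; have [cF dF] := CF; split => //;
  try by move=> x Vx; apply: c => // j; exact: Ck_continuous (CT j) Vx.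
move=> i.
have D x : V x -> is_derive x 'e_i (fun x => F (T x))
    (\sum_j 'D_'e_i (fun x => T x 0 j) x * 'D_'e_j F (T x)).
  move=> Vx; apply: is_derive_chain => [j||j].
  - by apply: derivableP; exact: Ck_derivable (CT j) Vx.
  - by apply: Ck_near_derivable CF => //; exact: VO.
  - by have [_ d2] := dF j; apply: Ck_continuous d2 _; exact: VO.
split=> [x Vx|]; first by have [] := D x Vx.
have := @Ck_sum R m k V _ (index_enum 'I_n) xpredT (fun j x => 'D_'e_i (fun x => T x 0 j) x * 'D_'e_j F (T x)) oV.
move=> /(_ (fun j _ => Ck_mul oV (Ck_derive i (CT j)) (IH _ (fun l => Ck_pred (CT l)) (dF j).2))).
by apply: Ck_eq => // x Vx; have [_ ->] := D x Vx.
Qed.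

(** * Symmetry of second partial derivatives *)

Section Schwarz.
Variables (R : realType) (n : nat).
Implicit Types (V : set 'rV[R]_n) (F : 'rV[R]_n -> R).

Lemma derive_translate F (w v y : 'rV[R]_n) l :
  is_derive (w + y) v F l -> is_derive y v (fun z => F (w + z)) l.
Proof.
move=> [d1 d2]; have E : (fun h : R => h^-1 *: (((fun z => F (w + z)) \o shift y) (h *: v) - F (w + y))) =
  (fun h : R => h^-1 *: ((F \o shift (w + y)) (h *: v) - F (w + y))).
  by apply/funext => h /=; rewrite addrCA.
by apply: DeriveDef; rewrite /derivable /derive E.
Qed.

Lemma norm_delta_le (i : 'I_n) : `|'e_i : 'rV[R]_n| <= 1.
Proof.
apply/norm_rV_le => // j; rewrite mxE /=.
by case: (j == i); rewrite ?normr1 ?normr0.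
Qed.

(** Apply the mean value theorem in direction i to the difference [G] of [F] and its translate, then
    in direction j to ['D_'e_i F]. *)
Lemma second_difference V F (x : 'rV[R]_n) (t : R) i j :
  0 <= t -> Ck 2 V F -> (forall y, `|y - x| <= t + t -> V y) ->
  exists2 p, `|p - x| <= t + t &
   F (t *: 'e_j + (t *: 'e_i + x)) - F (t *: 'e_i + x) - (F (t *: 'e_j + x) - F x)
   = t * (t * 'D_'e_j ('D_'e_i F) p).
Proof.
move=> t0 CF tV.
have le_e (s : R) k : `|s| <= `|t| -> `|s *: 'e_k : 'rV[R]_n| <= t.
  rewrite (ger0_norm t0) => st; rewrite normrZ (le_trans _ st)// ler_piMr//; exact: norm_delta_le.
have tt : `|t| <= `|t| by [].
have inV (u w : 'rV[R]_n) : `|u| <= t -> `|w| <= t -> V (u + (w + x)).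
  by move=> ut wt; apply: tV; rewrite addrA addrK (le_trans (ler_normD _ _))// lerD.
have inV1 (w : 'rV[R]_n) : `|w| <= t -> V (w + x).
  by move=> wt; rewrite -[w + x]add0r; apply: inV; rewrite ?normr0.
pose G y := F (t *: 'e_j + y) - F y.
have GD (s : R) : `|s| <= `|t| -> is_derive (s *: 'e_i + x) 'e_i G
    ('D_'e_i F (t *: 'e_j + (s *: 'e_i + x)) - 'D_'e_i F (s *: 'e_i + x)).
  move=> st.
  have A : is_derive (s *: 'e_i + x) 'e_i (fun y => F (t *: 'e_j + y)) ('D_'e_i F (t *: 'e_j + (s *: 'e_i + x))).
    apply: derive_translate; apply: derivableP; apply: Ck_derivable CF _.
    by apply: inV; exact: le_e.
  have B : is_derive (s *: 'e_i + x) 'e_i F ('D_'e_i F (s *: 'e_i + x)).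
    by apply: derivableP; apply: Ck_derivable CF _; apply: inV1; apply: le_e.
  exact: (is_deriveB A B).
have [s st E] : exists2 s : R, `|s| <= `|t| & G (t *: 'e_i + x) - G x = t * 'D_'e_i G (s *: 'e_i + x).
  by apply: (@mean_value_line _ _ G x 'e_i t) => s /GD [].
have [s' st' E'] : exists2 s' : R, `|s'| <= `|t| &
    'D_'e_i F (t *: 'e_j + (s *: 'e_i + x)) - 'D_'e_i F (s *: 'e_i + x)
    = t * 'D_'e_j ('D_'e_i F) (s' *: 'e_j + (s *: 'e_i + x)).
  apply: (@mean_value_line _ _ ('D_'e_i F) (s *: 'e_i + x) 'e_j t) => s' st'.
  by apply: Ck_derivable (Ck_derive i CF) _; apply: inV; apply: le_e.
exists (s' *: 'e_j + (s *: 'e_i + x)).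
  by rewrite addrA addrK (le_trans (ler_normD _ _))// lerD// le_e.
by rewrite -E' -[in RHS](@derive_val _ _ _ _ _ _ _ (GD s st)) -E.
Qed.

Lemma subrBACA (a b c d : R) : a - b - (c - d) = a - c - (b - d).
Proof. ring. Qed.

Lemma dist_le_common (a b a' b' e : R) :
  `|a - a'| <= e / 2 -> `|b - b'| <= e / 2 -> a' = b' -> `|a - b| <= e.
Proof.
move=> ha hb E; have -> : a - b = (a - a') - (b - b') by rewrite -E opprB addrA subrK.
by rewrite (le_trans (ler_normB _ _))// [leRHS]splitr lerD.
Qed.

(** The second difference is symmetric in i and j, so one mixed partial at [p] equals the other at
    [q], with [p] and [q] as near to [x] as desired; continuity does the rest. *)
Lemma Ck_schwarz V F x i j : open V -> V x -> Ck 2 V F ->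
  'D_'e_j ('D_'e_i F) x = 'D_'e_i ('D_'e_j F) x.
Proof.
move=> oV Vx CF; apply/eqP; rewrite -subr_eq0 -normr_le0; apply/ler_addgt0Pl => e e0; rewrite addr0.
have e20 : 0 < e / 2 by rewrite divr_gt0.
have c k l : \forall y \near x, `|'D_'e_k ('D_'e_l F) x - 'D_'e_k ('D_'e_l F) y| <= e / 2.
  have : {for x, continuous ('D_'e_k ('D_'e_l F))}.
    exact: Ck_continuous (Ck_derive k (Ck_derive l CF)) Vx.
  by move/cvgrPdist_le => /(_ _ e20).
have [r /= r0 rP] : nbhs_ball x [set y | V y /\ (`|'D_'e_j ('D_'e_i F) x - 'D_'e_j ('D_'e_i F) y| <= e / 2 /\
   `|'D_'e_i ('D_'e_j F) x - 'D_'e_i ('D_'e_j F) y| <= e / 2)].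
  apply/nbhs_ballP; apply: filterI; first exact: open_nbhs_nbhs.
  by apply: filterI; exact: c.
have rP' y : `|y - x| <= r / 4 + r / 4 -> ball x r y.
  move=> yx; rewrite -ball_normE /ball_ /= distrC (le_lt_trans yx)//.
  by lra.
have t0 : 0 < r / 4 by rewrite divr_gt0.
have [|p p1 p2] := @second_difference V F x (r / 4) i j (ltW t0) CF.
  by move=> y /rP' /rP [].
have [|q q1 q2] := @second_difference V F x (r / 4) j i (ltW t0) CF.
  by move=> y /rP' /rP [].
have /rP [_ [hp _]] := rP' _ p1; have /rP [_ [_ hq]] := rP' _ q1.
have E : 'D_'e_j ('D_'e_i F) p = 'D_'e_i ('D_'e_j F) q.
  apply: (@mulfI _ (r / 4)); first by rewrite gt_eqF.
  apply: (@mulfI _ (r / 4)); first by rewrite gt_eqF.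
  apply: etrans (esym p2) (etrans _ q2); rewrite (addrCA ((r / 4) *: 'e_j)).
  exact: subrBACA.
exact: dist_le_common hp hq E.
Qed.

End Schwarz.

(** * Smooth bump functions *)

Section Bump.
Variable R : realType.

(** For m = 0 the classical flat function exp(-1/t). The powers of 1/t make the family stable under
    differentiation up to linear combinations, as [Ck_family] asks. *)
Definition flat (m : nat) (t : R) : R :=
  if 0 < t then t^-1 ^+ m * expR (- t^-1) else 0.

Lemma flat_ge0 m t : 0 <= flat m t.
Proof.
rewrite /flat; case: ifP => // t0.
by rewrite mulr_ge0 ?expR_ge0// exprn_ge0// invr_ge0 ltW.
Qed.

Lemma flat_gt0 m t : 0 < t -> 0 < flat m t.
Proof.
by move=> t0; rewrite /flat t0 mulr_gt0 ?expR_gt0// exprn_gt0// invr_gt0.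
Qed.

(** From the term of degree m + 2 of the exponential series at 1/t. The factor t^2 makes the
    derivative at 0 vanish. *)
Lemma flat_le m t : 0 <= t -> flat m t <= (m.+2)`!%:R * t ^+ 2.
Proof.
move=> t0; rewrite /flat; case: ifP => [{}t0|_]; last by rewrite mulr_ge0 ?exprn_ge0.
have f0 : 0 < (m.+2)`!%:R :> R by rewrite ltr0n fact_gt0.
have := @expR_ge1Dxn R t^-1 m.+1; rewrite invr_ge0 (ltW t0) => /(_ isT) h.
have {h} : t^-1 ^+ m.+2 / (m.+2)`!%:R <= expR t^-1 by apply: le_trans h; rewrite lerDr.
rewrite ler_pdivrMr// => h.
rewrite expRN ler_pdivrMr ?expR_gt0//.
rewrite -(@ler_pM2l _ (t^-1 ^+ 2)) ?exprn_gt0 ?invr_gt0//.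
rewrite -exprD add2n (le_trans h)//.
set E := expR _; rewrite le_eqVlt; apply/orP; left; apply/eqP; field.
by rewrite gt_eqF.
Qed.

Lemma is_derive_flat m t :
  is_derive t (1 : R) (flat m) (flat m.+2 t - m%:R * flat m.+1 t).
Proof.
have [t0|t0|t0] := ltgtP t 0.
- have nt : \forall s \near t, cst 0 s = flat m s.
    by near=> s; rewrite /flat /= ifF//; apply/negbTE; rewrite -leNgt ltW//; near: s; exact: lt_nbhsl.
  apply: near_eq_is_derive nt _.
  by rewrite /flat !ifF ?mulr0 ?subrr; [exact: is_derive_cst|apply/negbTE; rewrite -leNgt ltW..].
- have nt : \forall s \near t, (fun s => s^-1 ^+ m * expR (- s^-1)) s = flat m s.
    by near=> s; rewrite /flat /= ifT//; near: s; exact: lt_nbhsr.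
  apply: near_eq_is_derive nt _.
  have DV : is_derive t (1 : R) (fun s : R => s^-1) (- t ^- 2).
    have tn0 : t != 0 by rewrite gt_eqF.
    apply: DeriveDef; first by apply: (@derivableV _ _ id) => //; exact: derivable_id.
    have := @deriveV R _ id t 1 tn0 (@derivable_id _ _ _ _).
    by rewrite derive_id [_ *: _]mulr1.
  have DN : is_derive t (1 : R) (fun s : R => - s^-1) (t ^- 2).
    by rewrite -[t ^- 2]opprK; apply: is_deriveN.
  have DE : is_derive t (1 : R) (fun s : R => expR (- s^-1)) (expR (- t^-1) * t ^- 2).
    by apply: (@is_derive_comp1 R R (fun s : R => - s^-1) (@expR R)).
  have DX : is_derive t (1 : R) (fun s : R => s^-1 ^+ m) ((m%:R * t^-1 ^+ m.-1) * - t ^- 2).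
    have := @is_deriveX _ _ (fun s : R => s^-1) m t 1 _ DV.
    by rewrite exprfctE.
  have DM := is_deriveM DX DE.
  apply: (is_derive_eq DM); rewrite /flat t0 /GRing.scale /= -exprVn.
  case: m {DM DX} => [|m] /=; first by rewrite !expr0 !mul0r mul1r mulr0 addr0 subr0 mulrC.
  rewrite !exprS; ring.
- rewrite t0 /flat ltxx mulr0 subr0 -/(flat m).
  have main : (fun h : R => h^-1 *: ((flat m \o shift 0) (h *: (1 : R)) - flat m 0)) @ 0^' --> (0 : R).
    apply/cvgrPdist_le => e e0.
    have c0 : 0 < (m.+2)`!%:R :> R by rewrite ltr0n fact_gt0.
    near=> h.
    have hn0 : h != 0 by near: h; exact: nbhs_dnbhs_neq.
    rewrite sub0r normrN /= addr0 [h *: 1]mulr1 {2}/flat ltxx subr0 normrM.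
    have [h0|h0] := leP h 0.
      by rewrite /flat ifF ?normr0 ?mulr0 ?ltW//; apply/negbTE; rewrite -leNgt.
    rewrite (ger0_norm (flat_ge0 _ _)) normfV (gtr0_norm h0) ler_pdivrMl//.
    apply: le_trans (flat_le m (ltW h0)) _.
    rewrite expr2 mulrCA ler_pM2l// -ler_pdivlMl//.
    rewrite (le_trans (ler_norm h))//.
    near: h; apply: dnbhs0_le; by rewrite mulr_gt0 ?invr_gt0.
  apply: DeriveDef; first by apply/cvg_ex; eexists; exact: main.
  exact: cvg_lim main.
Unshelve. all: by end_near. Qed.

Lemma Ck_flat n k (V : set 'rV[R]_n) F m : open V -> Ck k V F -> Ck k V (fun x => flat m (F x)).
Proof.
move=> oV CF; apply: (@Ck_family _ _ _ _ _ _ flat setT) => // i.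
exists [:: (1, i.+2); (- i%:R, i.+1)] => t _.
by rewrite !big_cons big_nil addr0 mul1r mulNr; exact: is_derive_flat.
Qed.

Lemma Ck_expR n k (V : set 'rV[R]_n) F : open V -> Ck k V F -> Ck k V (fun x => expR (F x)).
Proof.
move=> oV CF; apply: (@Ck_family _ _ _ _ _ unit (fun=> @expR R) setT _ oV _ CF tt) => // i.
exists [:: (1, tt)] => t _.
by rewrite big_cons big_nil addr0 mul1r; exact: is_derive_expR.
Qed.

(** The quotient flat(s) / (flat(s) + flat(1 - s)) is 1 where s >= 1 and 0 where s <= 0. *)
Lemma bump_exists n (c : 'rV[R]_n) (r : R) : 0 < r ->
  exists (b : 'rV[R]_n -> R) (d : R), [/\ 0 < d, forall k, Ck k setT b,
    forall x, 0 <= b x <= 1,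
    forall x, `|x - c| <= d -> b x = 1 & forall x, r <= `|x - c| -> b x = 0].
Proof.
move=> r0.
(* The sup norm is not smooth, so s is built from the Euclidean square [q]. It dominates the square
   of the sup norm, so s <= 0 at distance at least r from c. *)
pose q (x : 'rV[R]_n) : R := \sum_k (x 0 k - c 0 k) * (x 0 k - c 0 k).
pose s (x : 'rV[R]_n) : R := 2 - 2 * (r ^- 2) * q x.
pose D x := flat 0 (s x) + flat 0 (1 - s x).
have D0 x : 0 < D x.
  rewrite /D; have [h|h] := ltP 0 (s x).
    by rewrite ltr_wpDr ?flat_ge0 ?flat_gt0.
  by rewrite ltr_wpDl ?flat_ge0 ?flat_gt0// subr_gt0 (le_lt_trans h).
exists (fun x => flat 0 (s x) * (D x)^-1).
have Cs k : Ck k setT s.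
  have oT : open ([set: 'rV[R]_n]) by exact: openT.
  have Cq : Ck k setT q.
    apply: Ck_sum => // i _.
    have C1 : Ck k setT (fun x : 'rV[R]_n => x 0 i - c 0 i).
      by apply: Ck_add => //; [exact: Ck_coord|exact: Ck_cst].
    exact: Ck_mul.
  apply: (Ck_eq oT (F := fun x => 2 + (- (2 * r ^- 2)) * q x)).
    by move=> x _; rewrite mulNr.
  apply: Ck_add => //; first exact: Ck_cst.
  by apply: Ck_mul => //; exact: Ck_cst.
have CD k : Ck k setT D.
  have oT : open ([set: 'rV[R]_n]) by exact: openT.
  apply: Ck_add => //; apply: Ck_flat => //.
  apply: (Ck_eq oT (F := fun x => 1 + (- 1) * s x)); first by move=> x _; rewrite mulN1r.
  by apply: Ck_add => //; [exact: Ck_cst|apply: Ck_mul => //; exact: Ck_cst].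
have d2 : 0 < r ^+ 2 by rewrite exprn_gt0.
have N0 : 0 < (2 * n.+1%:R : R) by rewrite mulr_gt0.
(* The 1 makes squares of coordinates at most their absolute values; the other bound then gives q <=
   r^2/2, that is s >= 1. The successor of n avoids a division by 0. *)
exists (Num.min 1 (r ^+ 2 / (2 * n.+1%:R))); split => [||x|x xd|x xr].
- by rewrite lt_min ltr01 divr_gt0.
- move=> k; have oT : open ([set: 'rV[R]_n]) by exact: openT.
  apply: Ck_mul => //; first exact: Ck_flat.
  by apply: Ck_inv => // x _; rewrite gt_eqF.
- by rewrite divr_ge0 ?flat_ge0 ?(ltW (D0 _))//= ler_pdivrMr// mul1r lerDl flat_ge0.
- have sx : 1 <= s x.
    rewrite /s lerBrDr -lerBrDl (_ : 2 - 1 = 1 :> R); last by ring.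
    rewrite mulrAC ler_pdivrMr// mul1r.
    have -> : r ^+ 2 = 2 * \sum_(k < n.+1) (r ^+ 2 / (2 * n.+1%:R)).
      rewrite sumr_const card_ord -mulr_natr.
      have : n.+1%:R != 0 :> R by rewrite pnatr_eq0.
      by set N := n.+1%:R => N1; field.
    rewrite ler_pM2l// big_ord_recr /= ler_wpDr//; first by rewrite divr_ge0 ?ltW.
    apply: ler_sum => k _.
    move: xd; rewrite le_min => /andP[x1 x2].
    have h := coord_le_norm (x - c) k; rewrite !mxE in h.
    rewrite -[leLHS]ger0_norm; last by rewrite -expr2 sqr_ge0.
    rewrite normrM (le_trans _ x2)//.
    by rewrite -[leRHS]mulr1 ler_pM// (le_trans h).
  have -> : D x = flat 0 (s x).
    by rewrite /D [flat 0 (1 - _)]/flat ifF ?addr0//; apply/negbTE; rewrite -leNgt subr_le0.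
  by rewrite divff// gt_eqF// flat_gt0// (lt_le_trans _ sx).
- rewrite [flat 0 (s x)]/flat ifF ?mul0r//; apply/negbTE; rewrite -leNgt.
  rewrite /s subr_le0 mulrAC ler_pdivlMr// ler_pM2l//.
  have [k kP] : exists k, r <= `|x 0 k - c 0 k|.
    apply: contrapT => /forallNP h; move: xr; apply/negP; rewrite -ltNge.
    rewrite [ltLHS]mx_normrE; apply/bigmax_ltP; split => // -[i j] _ /=.
    by rewrite ord1 !mxE ltNge; apply/negP; exact: h.
  rewrite /q (bigD1 k)//= ler_wpDr//.
    by apply: sumr_ge0 => i _; rewrite -expr2 sqr_ge0.
  by rewrite -expr2 -[leRHS]real_normK ?num_real// ler_pXn2r// nnegrE// ltW.
Qed.

End Bump.

(** * Smooth germs on the half-space *)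

Section Germ.
Variables (R : realType) (n : nat).
Implicit Types (V : set 'rV[R]_n) (F f g : 'rV[R]_n -> R) (x y : 'rV[R]_n).
Local Notation H := (halfspace R n).

(** Smoothness up to the boundary as a property of one point; the values of [f] off the half-space
    are ignored. Calculus rules can thus be stated at a point without naming domains. *)
Definition smooth_germ x f : Prop :=
  exists (V : set 'rV[R]_n) (F : 'rV[R]_n -> R),
    [/\ open V, V x, forall k, Ck k V F & forall y, V y -> H y -> F y = f y].

Lemma smooth_germ_interior x f F (P : set 'rV[R]_n) : nbhs x P ->
  (forall k, Ck k P^° F) -> (forall y, P y -> H y -> F y = f y) -> smooth_germ x f.
Proof.
move=> nP CF Ff; exists P^°, F; split => //; first exact: open_interior.
by move=> y /interior_subset /Ff.
Qed.

Lemma smooth_on_germ (W A : set 'rV[R]_n) f : open W -> A = W `&` H ->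
  smooth_on A f <-> (forall x, A x -> smooth_germ x f).
Proof.
move=> oW ->; split => [sf x xA|sf x xA].
  have [V [F [oV Vx CF Ff]]] := sf x xA.
  exists (V `&` W), F; split => [|||y [Vy Wy] Hy].
  - exact: openI.
  - by split => //; case: xA.
  - by move=> k; apply: Ck_subset (CF k) => y [].
  - exact: Ff.
have [V [F [oV Vx CF Ff]]] := sf x xA.
by exists V, F; split => // y Vy [_ Hy]; exact: Ff.
Qed.

Lemma smooth_germ_near x f : smooth_germ x f -> \forall y \near x, smooth_germ y f.
Proof.
move=> [V [F [oV Vx CF Ff]]]; apply: filterS (open_nbhs_nbhs (conj oV Vx)) => y Vy.
by exists V, F.
Qed.

Lemma smooth_germ_eq x f g : (\forall y \near x, H y -> f y = g y) ->
  smooth_germ x f -> smooth_germ x g.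
Proof.
move=> fg [V [F [oV Vx CF Ff]]].
have nV := open_nbhs_nbhs (conj oV Vx).
apply: (@smooth_germ_interior _ _ F (V `&` [set y | H y -> f y = g y])).
- exact: filterI.
- by move=> k; apply: Ck_subset (CF k) => y /interior_subset [].
- by move=> y [Vy fgy] Hy; rewrite Ff// fgy.
Qed.

(** A single extension computes [hpartial] at all half-space points near [x], so iterated [hpartial]
    reduces to iterated partials of that extension. *)
Lemma hpartial_ext x f : smooth_germ x f -> exists V F,
  [/\ open V, V x, forall k, Ck k V F, forall y, V y -> H y -> F y = f y &
    forall y i, V y -> H y -> hpartial i f y = 'D_'e_i F y].
Proof.
move=> [V [F [oV Vx CF Ff]]]; exists V, F; split => // y i Vy Hy.
by apply: (hpartial_extension oV Vy Hy _ Ff); exact: Ck_derivable (CF 1) Vy.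
Qed.

Lemma hpartial_germ_eq x f g i : smooth_germ x f -> H x ->
  (\forall y \near x, H y -> f y = g y) -> hpartial i f x = hpartial i g x.
Proof.
move=> sf Hx fg; have [V [F [oV Vx CF Ff Fp]]] := hpartial_ext sf.
rewrite Fp//; symmetry.
have nV : nbhs x (V `&` [set y | H y -> f y = g y]) by apply: filterI => //; exact: open_nbhs_nbhs.
apply: (hpartial_extension (open_interior _) nV Hx); first exact: Ck_derivable (CF 1) Vx.
by move=> y /interior_subset [Vy fgy] Hy; rewrite Ff// fgy.
Qed.

Lemma smooth_germ_hpartial x f i : smooth_germ x f -> smooth_germ x (hpartial i f).
Proof.
move=> /hpartial_ext [V [F [oV Vx CF Ff Fp]]]; exists V, ('D_'e_i F); split => //.
  by move=> k; exact: Ck_derive (CF k.+1).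
by move=> y Vy Hy; rewrite Fp.
Qed.

Lemma smooth_germ_cvg x f : smooth_germ x f -> H x -> f @ within H (nbhs x) --> f x.
Proof.
move=> [V [F [oV Vx CF Ff]]] Hx; rewrite -(Ff x Vx Hx).
have cF : F @ within H (nbhs x) --> F x.
  apply: cvg_trans (Ck_continuous (CF 0) Vx); apply: cvg_app; exact: cvg_within.
apply: cvg_trans cF; apply: near_eq_cvg; rewrite /within /=.
by apply: filterS (open_nbhs_nbhs (conj oV Vx)) => y Vy Hy; rewrite Ff.
Qed.

Lemma smooth_germ_cst x (c : R) : smooth_germ x (fun=> c).
Proof. by exists setT, (fun=> c); split => //; [exact: openT|move=> k; exact: Ck_cst]. Qed.

Lemma smooth_germ_Ck x f : (forall k, Ck k setT f) -> smooth_germ x f.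
Proof. by move=> Cf; exists setT, f; split => //; exact: openT. Qed.

Lemma smooth_germ_coord x j : smooth_germ x (fun y => y 0 j).
Proof. by apply: smooth_germ_Ck => k; exact: Ck_coord. Qed.

Lemma smooth_germ_add x f g : smooth_germ x f -> smooth_germ x g ->
  smooth_germ x (fun y => f y + g y).
Proof.
move=> [V [F [oV Vx CF Ff]]] [W [G [oW Wx CG Gg]]].
have oVW := openI oV oW.
exists (V `&` W), (fun y => F y + G y); split => //.
  by move=> k; apply: Ck_add => //; [apply: Ck_subset (CF k)|apply: Ck_subset (CG k)] => y [].
by move=> y [Vy Wy] Hy; rewrite Ff// Gg.
Qed.

Lemma smooth_germ_mul x f g : smooth_germ x f -> smooth_germ x g ->
  smooth_germ x (fun y => f y * g y).
Proof.
move=> [V [F [oV Vx CF Ff]]] [W [G [oW Wx CG Gg]]].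
have oVW := openI oV oW.
exists (V `&` W), (fun y => F y * G y); split => //.
  by move=> k; apply: Ck_mul => //; [apply: Ck_subset (CF k)|apply: Ck_subset (CG k)] => y [].
by move=> y [Vy Wy] Hy; rewrite Ff// Gg.
Qed.

Lemma smooth_germ_opp x f : smooth_germ x f -> smooth_germ x (fun y => - f y).
Proof.
move=> sf; under eq_fun do rewrite -mulN1r.
by apply: smooth_germ_mul => //; exact: smooth_germ_cst.
Qed.

Lemma smooth_germ_sub x f g : smooth_germ x f -> smooth_germ x g ->
  smooth_germ x (fun y => f y - g y).
Proof. by move=> sf sg; apply: smooth_germ_add => //; exact: smooth_germ_opp. Qed.

Lemma smooth_germ_sum x (I : Type) (r : seq I) (P : pred I) (f : I -> 'rV[R]_n -> R) :
  (forall i, P i -> smooth_germ x (f i)) -> smooth_germ x (fun y => \sum_(i <- r | P i) f i y).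
Proof.
move=> h; elim: r => [|i r IH].
  by under eq_fun do rewrite big_nil; exact: smooth_germ_cst.
under eq_fun do rewrite big_cons.
by case Pi : (P i) => //; apply: smooth_germ_add => //; exact: h.
Qed.

Lemma smooth_germ_prod x (I : Type) (r : seq I) (P : pred I) (f : I -> 'rV[R]_n -> R) :
  (forall i, P i -> smooth_germ x (f i)) -> smooth_germ x (fun y => \prod_(i <- r | P i) f i y).
Proof.
move=> h; elim: r => [|i r IH].
  by under eq_fun do rewrite big_nil; exact: smooth_germ_cst.
under eq_fun do rewrite big_cons.
by case Pi : (P i) => //; apply: smooth_germ_mul => //; exact: h.
Qed.

Lemma smooth_germ_expR x f : smooth_germ x f -> smooth_germ x (fun y => expR (f y)).
Proof.
move=> [V [F [oV Vx CF Ff]]]; exists V, (fun y => expR (F y)); split => //.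
  by move=> k; exact: Ck_expR.
by move=> y Vy Hy; rewrite Ff.
Qed.

Lemma smooth_germ_inv x f : H x -> f x != 0 -> smooth_germ x f ->
  smooth_germ x (fun y => (f y)^-1).
Proof.
move=> Hx fx0 [V [F [oV Vx CF Ff]]].
have Fx0 : F x != 0 by rewrite Ff.
have nF : \forall y \near x, F y != 0.
  have c := Ck_continuous (CF 0) Vx.
  apply: (c [set t : R | t != 0]); apply: open_nbhs_nbhs; split => //.
apply: (@smooth_germ_interior _ _ (fun y => (F y)^-1) (V `&` [set y | F y != 0])).
- by apply: filterI => //; exact: open_nbhs_nbhs.
- move=> k; apply: Ck_inv; first exact: open_interior.
    by move=> y /interior_subset [].
  by apply: Ck_subset (CF k) => y /interior_subset [].
- by move=> y [Vy _] Hy; rewrite Ff.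
Qed.

Lemma hpartial_cst x i (c : R) : H x -> hpartial i (fun=> c) x = 0.
Proof.
move=> Hx; rewrite (@hpartial_extension R n i _ (fun=> c) setT x)//; last exact: openT.
exact: derive_cst.
Qed.

Lemma hpartial_coord x i j : H x -> hpartial i (fun y => y 0 j) x = (i == j)%:R.
Proof.
move=> Hx; have [d1 d2] : is_derive x 'e_i (fun y : 'rV[R]_n => y 0 j) (('e_i : 'rV[R]_n) 0 j).
  by apply: (@is_derive_coord _ _ _ id); exact: is_derive_id.
rewrite (@hpartial_extension R n i _ (fun y : 'rV[R]_n => y 0 j) setT x)//; last exact: openT.
by rewrite d2 mxE eqxx eq_sym.
Qed.

Lemma hpartial_add x f g i : smooth_germ x f -> smooth_germ x g -> H x ->
  hpartial i (fun y => f y + g y) x = hpartial i f x + hpartial i g x.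
Proof.
move=> /hpartial_ext [V [F [oV Vx CF Ff Fp]]] /hpartial_ext [W [G [oW Wx CG Gg Gp]]] Hx.
have DF : is_derive x 'e_i F ('D_'e_i F x) := derivableP (Ck_derivable (CF 1) Vx); have DG : is_derive x 'e_i G ('D_'e_i G x) := derivableP (Ck_derivable (CG 1) Wx).
have [D1 D2] := is_deriveD DF DG.
rewrite (@hpartial_extension R n i _ (F + G) (V `&` W) x)//.
- by rewrite Fp// Gp.
- exact: openI.
- by move=> y [Vy Wy] Hy; rewrite -Ff// -Gg.
Qed.

Lemma hpartial_mul x f g i : smooth_germ x f -> smooth_germ x g -> H x ->
  hpartial i (fun y => f y * g y) x = hpartial i f x * g x + f x * hpartial i g x.
Proof.
move=> /hpartial_ext [V [F [oV Vx CF Ff Fp]]] /hpartial_ext [W [G [oW Wx CG Gg Gp]]] Hx.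
have DF : is_derive x 'e_i F ('D_'e_i F x) := derivableP (Ck_derivable (CF 1) Vx); have DG : is_derive x 'e_i G ('D_'e_i G x) := derivableP (Ck_derivable (CG 1) Wx).
have [D1 D2] := is_deriveM DF DG.
rewrite (@hpartial_extension R n i _ (F * G) (V `&` W) x)//.
- by rewrite D2 Fp// Gp// -Ff// -Gg// addrC [in RHS]mulrC.
- exact: openI.
- by move=> y [Vy Wy] Hy; rewrite -Ff// -Gg.
Qed.

Lemma hpartial_opp x f i : smooth_germ x f -> H x ->
  hpartial i (fun y => - f y) x = - hpartial i f x.
Proof.
move=> sf Hx; under eq_fun do rewrite -mulN1r.
by rewrite hpartial_mul// ?hpartial_cst ?mul0r ?add0r ?mulN1r//; exact: smooth_germ_cst.
Qed.

Lemma hpartial_sum x (I : Type) (r : seq I) (P : pred I) (f : I -> 'rV[R]_n -> R) i :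
  (forall k, P k -> smooth_germ x (f k)) -> H x ->
  hpartial i (fun y => \sum_(k <- r | P k) f k y) x = \sum_(k <- r | P k) hpartial i (f k) x.
Proof.
move=> h Hx; elim: r => [|k r IH].
  by under eq_fun do rewrite big_nil; rewrite hpartial_cst// big_nil.
under eq_fun do rewrite big_cons.
rewrite big_cons; case Pk : (P k) => //.
by rewrite hpartial_add ?IH//; [exact: h|exact: smooth_germ_sum].
Qed.

Lemma hpartial_expR x f i : smooth_germ x f -> H x ->
  hpartial i (fun y => expR (f y)) x = expR (f x) * hpartial i f x.
Proof.
move=> /hpartial_ext [V [F [oV Vx CF Ff Fp]]] Hx.
have DF : is_derive x 'e_i F ('D_'e_i F x) := derivableP (Ck_derivable (CF 1) Vx).
have [D1 D2] := is_derive_comp1 (is_derive_expR (F x)) DF.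
rewrite (@hpartial_extension R n i _ (fun y => expR (F y)) V x)//.
- by rewrite D2 Fp// Ff.
- by move=> y Vy Hy; rewrite Ff.
Qed.

Lemma hpartial_comm x f i j : smooth_germ x f -> H x ->
  hpartial i (hpartial j f) x = hpartial j (hpartial i f) x.
Proof.
move=> /hpartial_ext [V [F [oV Vx CF Ff Fp]]] Hx.
have E k l : hpartial k (hpartial l f) x = 'D_'e_k ('D_'e_l F) x.
  apply: (@hpartial_extension R n k (hpartial l f) ('D_'e_l F) V x oV Vx Hx).
    exact: Ck_derivable (Ck_derive l (CF 2)) Vx.
  by move=> y Vy Hy; rewrite Fp.
rewrite (E i j) (E j i); exact: (Ck_schwarz j i oV Vx (CF 2)).
Qed.

Section Chain.
Variables (T : 'rV[R]_n -> 'rV[R]_n) (f : 'rV[R]_n -> R) (x : 'rV[R]_n).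
Hypotheses (sT : forall j, smooth_germ x (fun y => T y 0 j))
  (HT : \forall y \near x, H y -> H (T y)) (sf : smooth_germ (T x) f) (Hx : H x).

(** Off the half-space [f] and [T] carry no information, so the chain rule is run on extensions: [S]
    of [T], coordinate by coordinate, and [F] of [f], with [W] shrunk until [S] maps it into the
    domain of [F]. *)
Let chain_ext : exists V F (W : set 'rV[R]_n) (S : 'rV[R]_n -> 'rV[R]_n),
  [/\ open V, V (T x), forall k, Ck k V F & forall y i, V y -> H y -> hpartial i f y = 'D_'e_i F y] /\
  [/\ open W, W x, forall y, W y -> V (S y), forall j k, Ck k W (fun y => S y 0 j) &
   (forall y, W y -> H y -> S y = T y /\ F (S y) = f (T y)) /\
   (forall j i, hpartial i (fun y => T y 0 j) x = 'D_'e_i (fun y => S y 0 j) x)].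
Proof.
have /choice [Z ZP] : forall j, exists VF : set 'rV[R]_n * ('rV[R]_n -> R),
  [/\ open VF.1, VF.1 x, forall k, Ck k VF.1 VF.2, forall y, VF.1 y -> H y -> VF.2 y = T y 0 j &
    forall y i, VF.1 y -> H y -> hpartial i (fun y => T y 0 j) y = 'D_'e_i VF.2 y].
  by move=> j; have [V [F h]] := hpartial_ext (sT j); exists (V, F).
pose S (y : 'rV[R]_n) : 'rV[R]_n := \row_j (Z j).2 y.
have [V [F [oV Vx CF Ff Fp]]] := hpartial_ext sf.
have Sj j : (fun y => S y 0 j) = (Z j).2 by apply/funext => y; rewrite mxE.
have ST y : (forall j, (Z j).1 y) -> H y -> S y = T y.
  move=> Zy Hy; apply/rowP => j; rewrite mxE; have [_ _ _ h _] := ZP j.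
  by rewrite h.
have nZ : \forall y \near x, forall j, (Z j).1 y.
  by apply: (@filter_forall _ _ _ (nbhs x) (nbhs_filter x)) => j; have [u1 u2 _ _ _] := ZP j; exact: open_nbhs_nbhs.
have Sx : S x = T x by apply: ST => //; exact: nbhs_singleton nZ.
have nV : \forall y \near x, V (S y).
  have : {for x, continuous S}.
    apply: continuous_rV => j; rewrite Sj; have [_ u2 C _ _] := ZP j.
    exact: Ck_continuous (C 0) u2.
  by apply; rewrite Sx; exact: open_nbhs_nbhs.
have nW : nbhs x [set y | (forall j, (Z j).1 y) /\ (V (S y) /\ (H y -> H (T y)))].
  by apply: filterI => //; exact: filterI.
exists V, F, ([set y | (forall j, (Z j).1 y) /\ (V (S y) /\ (H y -> H (T y)))]^°), S.
split; split => //.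
- exact: open_interior.
- by move=> y /interior_subset [_ []].
- move=> j k; rewrite Sj; have [_ _ C _ _] := ZP j; apply: Ck_subset (C k).
  by move=> y /interior_subset [].
- split => [y /interior_subset [Zy [VSy HTy]] Hy|j i].
    have E := ST y Zy Hy; split => //; rewrite E Ff//; last exact: HTy.
    by rewrite -E.
  by rewrite Sj; have [_ u2 _ _ ->] := ZP j.
Qed.

Lemma smooth_germ_comp : smooth_germ x (fun y => f (T y)).
Proof.
have [V [F [W [S [[oV Vx CF Fp] [oW Wx VS CS [SP _]]]]]]] := chain_ext.
exists W, (fun y => F (S y)); split => //.
  by move=> k; apply: (Ck_comp (O := V)).
by move=> y Wy Hy; have [] := SP y Wy Hy.
Qed.

Lemma hpartial_chain i : hpartial i (fun y => f (T y)) x =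
  \sum_j hpartial i (fun y => T y 0 j) x * hpartial j f (T x).
Proof.
have [V [F [W [S [[oV Vx CF Fp] [oW Wx VS CS [SP Sp]]]]]]] := chain_ext.
have [Sx _] := SP x Wx Hx.
have [D1 D2] : is_derive x 'e_i (F \o S) (\sum_j 'D_'e_i (fun y => S y 0 j) x * 'D_'e_j F (S x)).
  apply: is_derive_chain => [j||j].
  - by apply: derivableP; apply: Ck_derivable (CS j 1) Wx.
  - by rewrite Sx; apply: Ck_near_derivable (CF 1).
  - by rewrite Sx; apply: Ck_continuous (Ck_derive j (CF 1)) Vx.
rewrite (@hpartial_extension R n i _ (F \o S) W x)//; last first.
  by move=> y Wy Hy; have [_] := SP y Wy Hy.
rewrite D2; apply: eq_bigr => j _; rewrite Sp Sx Fp//.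
exact: (nbhs_singleton HT).
Qed.

End Chain.

End Germ.

(** * Compactness and a weak form of Sard's theorem *)

(** Compactness as an induction principle, used for every passage from local to global. If [P K]
    failed, the sets whose complement in [K] satisfies [P] would form a proper filter, and its
    cluster point would contradict the local hypothesis. *)
Lemma compact_ideal (T : topologicalType) (K : set T) (P : set T -> Prop) :
  compact K -> P set0 -> (forall A B, P A -> P B -> P (A `|` B)) ->
  (forall A B, A `<=` B -> P B -> P A) ->
  (forall x, K x -> exists2 U, nbhs x U & P U) -> P K.
Proof.
move=> cK P0 PU PS Px; apply: contrapT => nPK.
pose F : set_system T := [set B | P (K `\` B)].
have FF : ProperFilter F.
  apply: Build_ProperFilter_ex.
    move=> B FB; apply: contrapT => nB; apply: nPK; move: FB; rewrite /F /=.
    have -> : B = set0 by apply/seteqP; split => // x Bx; case: nB; exists x.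
    by rewrite setD0.
  split.
  - by rewrite /F /= setDT.
  - by move=> A B FA FB; rewrite /F /= setDIr; exact: PU.
  - by move=> A B AB; apply: PS; exact: setDS.
have FK : F K by rewrite /F /= setDv.
have [x [Kx cx]] := cK F FF FK.
have [U nU PUx] := Px x Kx.
have FU : F (~` U) by rewrite /F /= setDE setCK; apply: PS PUx; exact: subIsetr.
by have [y []] := cx _ _ FU nU.
Qed.

Section Uniform.
Variables (R : realType) (n : nat) (K : set 'rV[R]_n) (I : finType) (g : I -> 'rV[R]_n -> R).
Hypotheses (cK : compact K) (cg : forall i x, K x -> {for x, continuous (g i)}).

Let near_dist (e : R) x : 0 < e -> K x -> \forall y \near x, forall i, `|g i x - g i y| <= e.
Proof.
move=> e0 Kx; apply: (@filter_forall _ _ _ (nbhs x) (nbhs_filter x)) => i.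
by have /cvgrPdist_le := cg (i := i) Kx; apply.
Qed.

Lemma uniform_continuous_family (e : R) : 0 < e -> exists2 d : R, 0 < d &
  forall x y, K x -> K y -> `|x - y| <= d -> forall i, `|g i x - g i y| <= e.
Proof.
move=> e0.
pose P A := exists2 d : R, 0 < d & forall x y, A x -> K x -> K y -> `|x - y| <= d ->
  forall i, `|g i x - g i y| <= e.
suff [d d0 dP] : P K by exists d => // x y Kx; exact: dP.
apply: (compact_ideal cK).
- by exists 1.
- move=> A B [a a0 aP] [b b0 bP]; exists (Num.min a b); first by rewrite lt_min a0.
  move=> x y [Ax|Bx] Kx Ky; rewrite le_min => /andP[xa xb]; [exact: aP|exact: bP].
- by move=> A B AB [b b0 bP]; exists b => // x y /AB; exact: bP.
move=> x Kx; have e20 : 0 < e / 2 by rewrite divr_gt0.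
have /nbhs_ballP [r /= r0 rP] := near_dist e20 Kx.
exists (ball x (r / 2)); first by apply: nbhsx_ballx; rewrite divr_gt0.
exists (r / 2); first by rewrite divr_gt0.
move=> y z xy Ky Kz yz i.
have by_ : ball x r y by apply: le_ball xy; rewrite ler_pdivrMr// ler_pMr// ler1n.
have bz : ball x r z.
  move: xy; rewrite -!ball_normE /ball_ /= => xy.
  have -> : x - z = (x - y) + (y - z) by rewrite addrA subrK.
  by rewrite (le_lt_trans (ler_normD _ _))// [ltRHS]splitr ltr_leD.
have hy := rP _ by_ i; have hz := rP _ bz i.
have -> : g i y - g i z = (g i x - g i z) - (g i x - g i y).
  by rewrite opprB [RHS]addrC addrA subrK.
by rewrite (le_trans (ler_normB _ _))// [leRHS]splitr lerD.
Qed.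

Lemma bounded_family : exists2 L : R, 0 < L & forall x, K x -> forall i, `|g i x| <= L.
Proof.
pose P A := exists2 L : R, 0 < L & forall x, A x -> forall i, `|g i x| <= L.
apply: (compact_ideal (P := P) cK).
- by exists 1.
- move=> A B [a a0 aP] [b b0 bP]; exists (Num.max a b); first by rewrite lt_max a0.
  by move=> x [Ax|Bx] i; rewrite le_max; [rewrite aP|rewrite bP ?orbT].
- by move=> A B AB [b b0 bP]; exists b => // x /AB; exact: bP.
move=> x Kx; exists [set y | forall i, `|g i x - g i y| <= 1]; first exact: near_dist.
exists (1 + \sum_i `|g i x|); first by rewrite ltr_pwDl// sumr_ge0.
move=> y xy i; rewrite -[g i y](subrK (g i x)) (le_trans (ler_normD _ _))// lerD//.
  by rewrite distrC.
by rewrite (bigD1 i)//= lerDl sumr_ge0.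
Qed.

End Uniform.

Lemma compact_cube (R : realType) n (c : 'rV[R]_n) (r : R) : compact [set x | `|x - c| <= r].
Proof.
have -> : [set x | `|x - c| <= r] = closed_ball_ (fun z => `|z|) c r.
  by apply/seteqP; split => x; rewrite /closed_ball_ /= distrC.
apply: bounded_closed_compact; last exact: closed_closed_ball_.
exists (`|c| + r); split; first exact: num_real.
move=> M cM x; rewrite /closed_ball_ /= distrC => xr.
rewrite -(subrK c x) (le_trans (ler_normD _ _))// (le_trans _ (ltW cM))//.
by rewrite addrC lerD.
Qed.

(** A kernel vector divided by its largest coordinate. With coefficient 1 at [k] and the others at
    most 1, the hyperplane it defines can be solved stably for coordinate [k]. *)
Lemma det0_normalized (R : realType) n (A : 'M[R]_n.+1) : \det A = 0 ->
  exists (nu : 'I_n.+1 -> R) (k : 'I_n.+1), [/\ nu k = 1, forall j, `|nu j| <= 1 &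
    forall i, \sum_j A i j * nu j = 0].
Proof.
rewrite -det_tr => /eqP /det0P [v v0 vA].
pose k := [arg max_(j > ord0) `|v 0 j|]%O.
have kmax j : `|v 0 j| <= `|v 0 k|.
  by rewrite /k; case: Order.TotalTheory.arg_maxP => // i _ /(_ j); exact.
have vk0 : v 0 k != 0.
  apply: contra_neq v0 => vk; apply/rowP => j; rewrite mxE; apply/eqP.
  by rewrite -normr_le0 (le_trans (kmax j))// vk normr0.
exists (fun j => v 0 j / v 0 k), k; split => [|j|i]; first by rewrite divff.
  by rewrite normrM normfV ler_pdivrMr ?mul1r// normr_gt0.
under eq_bigr do rewrite mulrA; rewrite -mulr_suml.
have /rowP /(_ i) := vA; rewrite !mxE => E.
rewrite (eq_bigr (fun j => v 0 j * A^T j i)) ?E ?mul0r// => j _.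
by rewrite mxE mulrC.
Qed.

Lemma mean_const (R : realType) n (a e : R) :
  \sum_(i < n.+1) \sum_(j < n.+1) (a * 1 * (e / (n.+1%:R * n.+1%:R))) = e * a.
Proof.
have nn (x : R) : x *+ n.+1 *+ n.+1 = x * n.+1%:R * n.+1%:R by rewrite !mulr_natr.
rewrite !sumr_const !card_ord nn.
have : n.+1%:R != 0 :> R by rewrite pnatr_eq0.
by move: (n.+1%:R : R) => N N0; field.
Qed.

Lemma exists_ord_near (R : realType) (N : nat) (t : R) : (0 < N)%N -> 0 <= t <= N%:R ->
  exists i : 'I_N, `|t - i%:R| <= 1.
Proof.
move=> N0 /andP[t0 tN]; have /andP[h1 h2] := truncn_itv t0.
have [hN|hN] := ltnP (Num.trunc t) N.
  exists (Ordinal hN); rewrite /= ger0_norm ?subr_ge0// lerBlDr addrC -[1]/(1%:R) -natrD addn1.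
  exact: ltW.
(* The end point t = N exceeds the last index N - 1 by exactly 1, which the bound allows. *)
have tE : t = N%:R by apply/eqP; rewrite eq_le tN/= (le_trans _ h1)// ler_nat.
have hN1 : (N.-1 < N)%N by rewrite prednK.
exists (Ordinal hN1); rewrite /= tE -natrB ?leq_pred//.
have -> : (N - N.-1 = 1)%N by lia.
by rewrite normr1.
Qed.

Lemma nat_eq_of_dist_lt1 (R : realType) (p q : nat) : `|p%:R - q%:R : R| < 1 -> p = q.
Proof.
wlog pq : p q / (p <= q)%N => [h|].
  by case: (leqP p q) => [|/ltnW] pq; [exact: h|rewrite distrC => H; exact/esym/h].
rewrite distrC -natrB// ger0_norm ?ler0n// -[ltRHS]/(1%:R : R) ltr_nat ltnS leqn0 subn_eq0 => qp.
by apply/eqP; rewrite eqn_leq pq.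
Qed.

Lemma addn_sub_le_double (p q b : nat) : (p < q + b -> p + b - q <= 2 * b)%N.
Proof. lia. Qed.

Lemma addn_subIr (p p' q b : nat) :
  (q < p + b -> q < p' + b -> p + b - q = p' + b - q -> p = p')%N.
Proof. lia. Qed.

Lemma double_lt_triple (p q : nat) : (0 < p -> 0 < q -> 2 * (p * q) < 3 * q * p)%N.
Proof. nia. Qed.

Section Sard.
Variables (R : realType) (n : nat).
Local Notation I := 'I_n.+1.
Local Notation E := 'rV[R]_n.+1.
Variables (V : set E) (c : E) (r : R) (G : I -> E -> R).
Hypotheses (r0 : 0 < r) (rV : forall x, `|x - c| <= 2 * r -> V x) (CG : forall j, Ck 1 V (G j)).

Let Jac (x : E) : 'M[R]_n.+1 := \matrix_(i, j) 'D_'e_i (G j) x.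

Let Q2 := [set x | `|x - c| <= 2 * r].

Let mv x y j : `|x - c| <= r -> `|y - x| <= r ->
  exists2 xi : I -> E, (forall i, `|xi i - x| <= `|y - x|) &
    G j y - G j x = \sum_i (y 0 i - x 0 i) * 'D_'e_i (G j) (xi i).
Proof.
move=> xr yx; apply: mean_value => z i zx; apply: Ck_derivable (CG j) _; apply: rV.
rewrite -(subrK x z) -addrA (le_trans (ler_normD _ _))// mulr_natl mulr2n lerD//.
exact: le_trans zx yx.
Qed.

Let inQ2 x y : `|x - c| <= r -> `|y - x| <= r -> Q2 y.
Proof.
move=> xr yx; rewrite /Q2 /= -(subrK x y) -addrA (le_trans (ler_normD _ _))//.
by rewrite mulr_natl mulr2n lerD.
Qed.

Let lipschitz : exists2 L : R, 0 < L & forall x y j, `|x - c| <= r -> `|y - x| <= r ->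
  `|G j y - G j x| <= L * `|y - x|.
Proof.
have [L L0 LP] := @bounded_family R _ Q2 _ (fun ij : I * I => 'D_'e_ij.1 (G ij.2))
  (@compact_cube R n.+1 c (2 * r)) (fun ij x Qx => Ck_continuous (Ck_derive ij.1 (CG ij.2)) (rV Qx)).
exists (n.+1%:R * L); first by rewrite mulr_gt0.
move=> x y j xr yx; have [xi xi1 ->] := mv j xr yx.
rewrite (le_trans (ler_norm_sum _ _ _))//.
have -> : n.+1%:R * L * `|y - x| = \sum_(i < n.+1) (`|y - x| * L).
  by rewrite sumr_const card_ord -mulr_natl; ring.
rewrite ler_sum// => i _.
rewrite normrM ler_pM//.
  by have := coord_le_norm (y - x) i; rewrite !mxE.
by apply: (LP _ _ (i, j)); apply: inQ2 xr _; rewrite (le_trans (xi1 i)).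
Qed.

(* Near a critical point the values of G lie close to a hyperplane. *)
Let slab (e : R) : 0 < e -> exists2 d : R, 0 < d & forall x y (nu : I -> R),
  `|x - c| <= r -> `|y - x| <= r -> `|y - x| <= d -> (forall j, `|nu j| <= 1) ->
  (forall i, \sum_j Jac x i j * nu j = 0) ->
  `|\sum_j nu j * (G j y - G j x)| <= e * `|y - x|.
Proof.
move=> e0; pose e' := e / (n.+1%:R * n.+1%:R).
have e'0 : 0 < e' by rewrite divr_gt0.
have [d d0 dP] := @uniform_continuous_family R _ Q2 _ (fun ij : I * I => 'D_'e_ij.1 (G ij.2))
  (@compact_cube R n.+1 c (2 * r)) (fun ij x Qx => Ck_continuous (Ck_derive ij.1 (CG ij.2)) (rV Qx)) e' e'0.
exists d => // x y nu xr yx yd nu1 nuJ.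
have /choice [xi xiP] : forall j, exists xi : I -> E, (forall i, `|xi i - x| <= `|y - x|) /\
    G j y - G j x = \sum_i (y 0 i - x 0 i) * 'D_'e_i (G j) (xi i).
  by move=> j; have [xi h1 h2] := mv j xr yx; exists xi.
have -> : \sum_j nu j * (G j y - G j x) = \sum_i \sum_j
    (y 0 i - x 0 i) * nu j * ('D_'e_i (G j) (xi j i) - 'D_'e_i (G j) x).
  under eq_bigr => j _ do rewrite (xiP j).2 mulr_sumr.
  rewrite exchange_big /=; apply: eq_bigr => i _.
  rewrite -[LHS]subr0 -[X in _ - X](mulr0 (y 0 i - x 0 i)) -[X in _ * X](nuJ i) mulr_sumr -sumrB.
  by apply: eq_bigr => j _; rewrite mxE; ring.
rewrite -(mean_const n `|y - x| e) -/e'.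
rewrite (le_trans (ler_norm_sum _ _ _))// ler_sum// => i _.
rewrite (le_trans (ler_norm_sum _ _ _))// ler_sum// => j _.
rewrite !normrM ler_pM ?mulr_ge0//.
  rewrite ler_pM//.
  by have := coord_le_norm (y - x) i; rewrite !mxE.
have [h _] := xiP j.
apply: (dP _ _ _ _ _ (i, j)) => /=.
- by apply: inQ2 xr _; rewrite (le_trans (h i)).
- by apply: inQ2 xr _; rewrite subrr normr0 ltW.
- by rewrite (le_trans (h i)).
Qed.

Lemma sard (eps : R) : 0 < eps -> exists2 w : E, `|w| <= eps &
  forall x, `|x - c| <= r -> (forall j, G j x = w 0 j) -> \det (Jac x) != 0.
Proof.
move=> eps0; apply: contrapT => none.
have bad (w : E) : `|w| <= eps -> exists x, [/\ `|x - c| <= r, forall j, G j x = w 0 j & \det (Jac x) = 0].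
  move=> we; apply: contrapT => nx; apply: none; exists w => // x xr xw.
  by apply/eqP => dx; apply: nx; exists x.
have [L L0 LP] := lipschitz.
(* Cut the cube into N^(n+1) cells of side h, and take the K^(n+1) values in
   a grid of mesh s.  If all of them are critical, those attained in one cell
   lie, by [slab], within s/4 of a hyperplane and so are determined by n of
   their coordinates, which leaves (2aC+1)^n possibilities per cell.  For
   a > (3C)^n this is less than a^(n+1) = (K/N)^(n+1). *)
pose C := (Num.trunc (L * (4 * r) / eps)).+1.
have CP : L * (4 * r) < C%:R * eps by rewrite -ltr_pdivrMr// truncnS_gt.
pose a := ((3 * C) ^ n).+1.
have a0 : 0 < a%:R :> R by rewrite ltr0n.
(* The slope for [slab] is set so that over a length h it amounts to s / 4 ([eh] below). *)
have e0 : 0 < eps / (16 * a%:R * r) by rewrite divr_gt0// !mulr_gt0.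
have [d d0 dP] := slab e0.
have mdr0 : 0 < Num.min d r by rewrite lt_min d0.
pose N := (Num.trunc (4 * r / Num.min d r)).+1.
have N0 : 0 < N%:R :> R by rewrite ltr0n.
(* Cell indices are recorded only to within 1, so two points with the same index may be two steps of
   2r/N apart. *)
pose h := 4 * r / N%:R.
have h0 : 0 < h by rewrite divr_gt0// mulr_gt0.
have hdr : h <= Num.min d r.
  by rewrite ler_pdivrMr// [leRHS]mulrC -ler_pdivrMr// ltW// truncnS_gt.
pose K := (a * N)%N.
pose s : R := eps / (a%:R * N%:R).
have s0 : 0 < s by rewrite divr_gt0// mulr_gt0.
have Lh : L * h < s * (a * C)%:R.
  rewrite /h /s natrM mulrA ltr_pdivrMr//.
  have -> : eps / (a%:R * N%:R) * (a%:R * C%:R) * N%:R = C%:R * eps.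
    by move: (a%:R : R) (N%:R : R) (C%:R : R) a0 N0 => a' N' C' a0' N0'; field; rewrite !gt_eqF.
  exact: CP.
have eh : eps / (16 * a%:R * r) * h = s / 4.
  rewrite /h /s.
  by move: (a%:R : R) (N%:R : R) a0 N0 => a' N' a0' N0'; field; rewrite !gt_eqF.
pose cand := {ffun I -> 'I_K}.
have /choice [X XP] : forall m : cand, exists x, [/\ `|x - c| <= r,
    forall j, G j x = s * (m j)%:R & \det (Jac x) = 0].
  move=> m; have [|x [x1 x2 x3]] := bad (\row_j (s * (m j)%:R)).
    apply/norm_rV_le => [|j]; first exact: ltW.
    rewrite mxE ger0_norm; last by rewrite mulr_ge0// ltW.
    rewrite /s mulrAC ler_pdivrMr ?mulr_gt0// ler_pM2l// -natrM ler_nat.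
    exact: ltnW.
  by exists x; split => // j; rewrite x2 mxE.
have /choice [kap kapP] : forall m : cand, exists k : {ffun I -> 'I_N}, forall j,
    `|(X m 0 j - c 0 j + r) * (N%:R / (2 * r)) - (k j)%:R| <= 1.
  move=> m; have [xr _ _] := XP m.
  have /choice [k kP] : forall j, exists i : 'I_N,
      `|(X m 0 j - c 0 j + r) * (N%:R / (2 * r)) - i%:R| <= 1.
    move=> j; apply: exists_ord_near => //.
    have := coord_le_norm (X m - c) j; rewrite !mxE => /le_trans /(_ xr).
    rewrite ler_norml => /andP[u1 u2]; apply/andP; split.
      by rewrite mulr_ge0 ?divr_ge0 ?mulr_ge0 ?(ltW r0)// -lerBlDr sub0r.
    rewrite mulrA ler_pdivrMr ?mulr_gt0// mulrC ler_pM2l//.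
    by rewrite mulr_natl mulr2n lerD.
  by exists [ffun j => k j] => j; rewrite ffunE.
have close m m' : kap m = kap m' -> `|X m - X m'| <= h.
  move=> km; apply/norm_rV_le => [|j]; first exact: ltW.
  have h1 := kapP m j; have h2 := kapP m' j; rewrite km in h1.
  rewrite !mxE.
  have Nr0 : 0 < N%:R / (2 * r) by rewrite divr_gt0// mulr_gt0.
  have := le_trans (ler_normB _ _) (lerD h1 h2).
  set u := X m 0 j; set v := X m' 0 j; set q := (kap m' j)%:R; set p := N%:R / (2 * r).
  have -> : (u - c 0 j + r) * p - q - ((v - c 0 j + r) * p - q) = (u - v) * p.
    by move: u v q p (c 0 j) => u v q p z; ring.
  rewrite normrM (gtr0_norm Nr0) -ler_pdivlMr//.
  suff -> : (1 + 1) / p = h by [].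
  by rewrite /p /h; move: (N%:R : R) N0 => N' N0'; field; rewrite !gt_eqF.
have /choice [nk nkP] : forall m : cand, exists nk : (I -> R) * I,
    [/\ nk.1 nk.2 = 1, forall j, `|nk.1 j| <= 1 & forall i, \sum_j Jac (X m) i j * nk.1 j = 0].
  move=> m; have [_ _ /det0_normalized [nu [k nuP]]] := XP m.
  by exists (nu, k).
have /choice [ref refP] : forall k : {ffun I -> 'I_N}, exists m0 : cand,
    forall m, kap m = k -> kap m0 = k.
  move=> k; have [[m0 m0k]|nm] := pselect (exists m, kap m = k); first by exists m0.
  have K0 : (0 < K)%N by rewrite muln_gt0.
  by exists [ffun => Ordinal K0] => m mk; case: nm; exists m.
pose rf m := ref (kap m).
have kaprf m : kap (rf m) = kap m by exact: refP.
(* The n coordinates other than the one singled out by the kernel vector at the reference point of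
   the cell, as offsets from the reference value. Adding a C makes them natural numbers, and [gap]
   bounds them by 2aC. *)
pose pr (m : cand) : {ffun 'I_n -> 'I_(2 * (a * C)).+1} :=
  [ffun j : 'I_n => inord (m (lift (nk (rf m)).2 j) + a * C - rf m (lift (nk (rf m)).2 j))%N].
have gap (m : cand) j : (m j < rf m j + a * C)%N /\ (rf m j < m j + a * C)%N.
  have [xr xm _] := XP m; have [yr ym _] := XP (rf m).
  have xy := close m (rf m) (esym (kaprf m)).
  have := LP (X (rf m)) (X m) j yr (le_trans xy _).
  rewrite (le_trans hdr _) ?ge_min ?lexx ?orbT// => /(_ isT).
  rewrite xm ym => /le_lt_trans /(_ (le_lt_trans (ler_wpM2l (ltW L0) xy) Lh)).
  rewrite -mulrBr normrM (gtr0_norm s0) ltr_pM2l// ltr_norml => /andP[g1 g2].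
  split; rewrite -(ltr_nat R) natrD.
    by rewrite -ltrBlDl.
  by rewrite -ltrBlDl -ltrN2 opprB.
have flat_sum (m : cand) : `|\sum_j (nk (rf m)).1 j * (s * (m j)%:R - s * (rf m j)%:R)| <= s / 4.
  have [xr xm _] := XP m; have [yr ym _] := XP (rf m).
  have xy := close m (rf m) (esym (kaprf m)).
  have [_ nu1 nuJ] := nkP (rf m).
  have := dP (X (rf m)) (X m) (nk (rf m)).1 yr.
  rewrite !(le_trans xy (le_trans hdr _)) ?ge_min ?lexx ?orbT// => /(_ isT isT nu1 nuJ).
  under eq_bigr do rewrite xm ym.
  by move=> /le_trans; apply; rewrite -eh ler_pM2l.
have inj : injective (fun m : cand => (kap m, pr m)).
  move=> m m' [km pm]; have rfE : rf m = rf m' by rewrite /rf km.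
  have eqj j : j != (nk (rf m)).2 -> m j = m' j.
    move=> jk; case: (unliftP (nk (rf m)).2 j) jk => [j' ->|->]; last by rewrite eqxx.
    move=> _; move/ffunP/(_ j') : pm; rewrite !ffunE -rfE => /(congr1 val).
    set l := lift _ _; have [g1 g2] := gap m l; have [g3 g4] := gap m' l.
    rewrite -rfE in g3 g4.
    rewrite /= !inordK => [E||]; last 2 first; rewrite ?ltnS.
    - exact: addn_sub_le_double.
    - exact: addn_sub_le_double.
    - by apply: val_inj; exact: addn_subIr g2 g4 E.
  apply/ffunP => j; have [->|/eqj//] := eqVneq j (nk (rf m)).2.
  apply: val_inj => /=; apply: (@nat_eq_of_dist_lt1 R).
  (* The other coordinates agree, so the difference of the two slab estimates leaves s times the
     difference of the remaining coordinates, at most s/2: these are integers at distance less than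
     1. *)
  have f1 := flat_sum m; have f2 := flat_sum m'; rewrite -rfE in f2.
  have [nuk _ _] := nkP (rf m).
  have := le_trans (ler_normB _ _) (lerD f1 f2).
  rewrite -sumrB (bigD1 (nk (rf m)).2)//= big1 ?addr0 => [|i /eqj ->]; last by rewrite subrr.
  rewrite nuk !mul1r opprB [X in `|X|](_ : _ = s * ((m (nk (rf m)).2)%:R - (m' (nk (rf m)).2)%:R)); last by ring.
  rewrite normrM (gtr0_norm s0) => hh.
  rewrite -(ltr_pM2l s0) (le_lt_trans hh)// mulr1; lra.
have := leq_card _ inj.
rewrite card_prod !card_ffun !card_ord /K expnMn mulnC leq_pmul2l ?expn_gt0//.
apply/negP; rewrite -ltnNge.
apply: (@leq_ltn_trans ((3 * C * a) ^ n)).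
  have mono (p q e : nat) : (p <= q)%N -> (p ^ e <= q ^ e)%N.
    by move=> pq; elim: e => // e IH; rewrite !expnS leq_mul.
  by apply: mono; exact: double_lt_triple.
rewrite expnMn expnS ltn_pmul2r ?expn_gt0//.
Qed.

End Sard.

(** * Curvature and changes of coordinates *)

Section MatrixGerm.
Variables (R : realType) (n : nat).
Local Notation E := 'rV[R]_n.
Local Notation H := (halfspace R n).

Definition smooth_mx (p q : nat) (x : E) (A : E -> 'M[R]_(p, q)) : Prop :=
  forall r s, smooth_germ x (fun y => A y r s).

Definition mxpartial (p q : nat) (i : 'I_n) (A : E -> 'M[R]_(p, q)) (x : E) : 'M[R]_(p, q) :=
  \matrix_(r, s) hpartial i (fun y => A y r s) x.

Variable (x : E).

Lemma smooth_mx_mul p q r (A : E -> 'M[R]_(p, q)) (B : E -> 'M[R]_(q, r)) :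
  smooth_mx x A -> smooth_mx x B -> smooth_mx x (fun y => A y *m B y).
Proof.
move=> sA sB i j; under eq_fun do rewrite mxE.
by apply: smooth_germ_sum => k _; apply: smooth_germ_mul.
Qed.

Lemma smooth_mx_add p q (A B : E -> 'M[R]_(p, q)) :
  smooth_mx x A -> smooth_mx x B -> smooth_mx x (fun y => A y + B y).
Proof. by move=> sA sB i j; under eq_fun do rewrite mxE; exact: smooth_germ_add. Qed.

Lemma smooth_mx_opp p q (A : E -> 'M[R]_(p, q)) :
  smooth_mx x A -> smooth_mx x (fun y => - A y).
Proof. by move=> sA i j; under eq_fun do rewrite mxE; exact: smooth_germ_opp. Qed.

Lemma smooth_mx_scale p q (f : E -> R) (A : E -> 'M[R]_(p, q)) :
  smooth_germ x f -> smooth_mx x A -> smooth_mx x (fun y => f y *: A y).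
Proof. by move=> sf sA i j; under eq_fun do rewrite mxE; exact: smooth_germ_mul. Qed.

Lemma smooth_mx_tr p q (A : E -> 'M[R]_(p, q)) :
  smooth_mx x A -> smooth_mx x (fun y => (A y)^T).
Proof. by move=> sA i j; under eq_fun do rewrite mxE; exact: sA. Qed.

Lemma smooth_mx_cst p q (A : 'M[R]_(p, q)) : smooth_mx x (fun=> A).
Proof. by move=> i j; exact: smooth_germ_cst. Qed.

Lemma smooth_mx_sum p q (I : finType) (A : I -> E -> 'M[R]_(p, q)) :
  (forall k, smooth_mx x (A k)) -> smooth_mx x (fun y => \sum_k A k y).
Proof.
move=> sA i j; under eq_fun do rewrite summxE.
by apply: smooth_germ_sum => k _; exact: sA.
Qed.

Lemma smooth_mx_eq p q (A B : E -> 'M[R]_(p, q)) :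
  (\forall y \near x, H y -> A y = B y) -> smooth_mx x A -> smooth_mx x B.
Proof.
by move=> AB sA i j; apply: smooth_germ_eq (sA i j); apply: filterS AB => y h Hy; rewrite h.
Qed.

Lemma smooth_mx_partial p q i (A : E -> 'M[R]_(p, q)) :
  smooth_mx x A -> smooth_mx x (mxpartial i A).
Proof.
by move=> sA r s; under eq_fun do rewrite mxE; apply: smooth_germ_hpartial; exact: sA.
Qed.

Lemma smooth_germ_det p (A : E -> 'M[R]_p) :
  smooth_mx x A -> smooth_germ x (fun y => \det (A y)).
Proof.
move=> sA; apply: smooth_germ_sum => s _; apply: smooth_germ_mul.
  exact: smooth_germ_cst.
by apply: smooth_germ_prod => i _; exact: sA.
Qed.

Hypothesis Hx : H x.

(** Cramer's rule, which describes [invmx] where the matrix is invertible, that is, on the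
    half-space near [x]. *)
Lemma smooth_mx_inv p (A : E -> 'M[R]_p) :
  (\forall y \near x, H y -> A y \in unitmx) ->
  smooth_mx x A -> smooth_mx x (fun y => invmx (A y)).
Proof.
move=> uA sA; apply: (@smooth_mx_eq _ _ (fun y => (\det (A y))^-1 *: \adj (A y))).
  by apply: filterS uA => y h Hy; rewrite /invmx h.
apply: smooth_mx_scale.
  apply: smooth_germ_inv => //; last exact: smooth_germ_det.
  by have := nbhs_singleton uA Hx; rewrite unitmxE unitfE.
move=> i j; under eq_fun do rewrite mxE /cofactor.
apply: smooth_germ_mul; first exact: smooth_germ_cst.
apply: smooth_germ_det => r s; under eq_fun do rewrite !mxE; exact: sA.
Qed.

Lemma mxpartial_eq p q i (A B : E -> 'M[R]_(p, q)) :
  smooth_mx x A -> (\forall y \near x, H y -> A y = B y) -> mxpartial i A x = mxpartial i B x.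
Proof.
move=> sA AB; apply/matrixP => r s; rewrite !mxE.
by apply: hpartial_germ_eq => //; apply: filterS AB => y h Hy; rewrite h.
Qed.

Lemma mxpartial_mul p q r i (A : E -> 'M[R]_(p, q)) (B : E -> 'M[R]_(q, r)) :
  smooth_mx x A -> smooth_mx x B ->
  mxpartial i (fun y => A y *m B y) x = mxpartial i A x *m B x + A x *m mxpartial i B x.
Proof.
move=> sA sB; apply/matrixP => k l; rewrite !mxE -big_split /=.
under eq_fun do rewrite mxE.
rewrite hpartial_sum//; last by move=> m _; exact: smooth_germ_mul.
by apply: eq_bigr => m _; rewrite hpartial_mul// !mxE.
Qed.

Lemma mxpartial_add p q i (A B : E -> 'M[R]_(p, q)) :
  smooth_mx x A -> smooth_mx x B ->
  mxpartial i (fun y => A y + B y) x = mxpartial i A x + mxpartial i B x.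
Proof.
move=> sA sB; apply/matrixP => k l; rewrite !mxE; under eq_fun do rewrite mxE.
exact: hpartial_add.
Qed.

Lemma mxpartial_opp p q i (A : E -> 'M[R]_(p, q)) :
  smooth_mx x A -> mxpartial i (fun y => - A y) x = - mxpartial i A x.
Proof.
move=> sA; apply/matrixP => k l; rewrite !mxE; under eq_fun do rewrite mxE.
exact: hpartial_opp.
Qed.

Lemma mxpartial_scale p q i (f : E -> R) (A : E -> 'M[R]_(p, q)) :
  smooth_germ x f -> smooth_mx x A ->
  mxpartial i (fun y => f y *: A y) x = hpartial i f x *: A x + f x *: mxpartial i A x.
Proof.
move=> sf sA; apply/matrixP => k l; rewrite !mxE; under eq_fun do rewrite mxE.
exact: hpartial_mul.
Qed.

Lemma mxpartial_sum p q i (I : finType) (A : I -> E -> 'M[R]_(p, q)) :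
  (forall k, smooth_mx x (A k)) ->
  mxpartial i (fun y => \sum_k A k y) x = \sum_k mxpartial i (A k) x.
Proof.
move=> sA; apply/matrixP => k l; rewrite !mxE summxE; under eq_fun do rewrite summxE.
by rewrite hpartial_sum// => [|j _]; [apply: eq_bigr => j _; rewrite mxE|exact: sA].
Qed.

Lemma mxpartial_tr p q i (A : E -> 'M[R]_(p, q)) : mxpartial i (fun y => (A y)^T) x = (mxpartial i A x)^T.
Proof. by apply/matrixP => k l; rewrite !mxE; under eq_fun do rewrite mxE. Qed.

Lemma mxpartial_cst p q i (A : 'M[R]_(p, q)) : mxpartial i (fun=> A) x = 0.
Proof. by apply/matrixP => k l; rewrite !mxE hpartial_cst. Qed.

Lemma mxpartial_comm p q i j (A : E -> 'M[R]_(p, q)) : smooth_mx x A ->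
  mxpartial i (mxpartial j A) x = mxpartial j (mxpartial i A) x.
Proof.
move=> sA; apply/matrixP => k l.
have D a b : mxpartial a (mxpartial b A) x k l = hpartial a (hpartial b (fun y => A y k l)) x.
  by rewrite mxE; congr (hpartial a _ x); apply/funext => y; rewrite mxE.
exact: (etrans (D i j) (etrans (hpartial_comm i j (sA k l) Hx) (esym (D j i)))).
Qed.

End MatrixGerm.

(** * The Levi-Civita connection and its uniqueness *)

Section LeviCivita.
Variables (R : realType) (n : nat).
Local Notation E := 'rV[R]_n.
Local Notation H := (halfspace R n).
Implicit Types (h : E -> 'M[R]_n) (x : E).

(** A pseudo-Riemannian metric near [x], smooth up to the boundary. *)
Definition metric_germ x h : Prop := smooth_mx x h /\
  (\forall y \near x, H y -> (h y)^T = h y /\ h y \in unitmx).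

(** Row [j] holds the components of the covariant derivative of the [j]-th coordinate field in
    direction [i]. *)
Definition connection h (i : 'I_n) x : 'M[R]_n := \matrix_(j, k) christoffel h k i j x.

(* Matrices act on row vectors, whence the reversed order of the products. *)
Definition curvature (C : 'I_n -> E -> 'M[R]_n) i j x : 'M[R]_n :=
  mxpartial i (C j) x - mxpartial j (C i) x + C j x *m C i x - C i x *m C j x.

Lemma riemann_curvature h l i j k x : riemann h l i j k x = curvature (connection h) i j x k l.
Proof.
have D a b : hpartial a (christoffel h l b k) x = mxpartial a (connection h b) x k l.
  by rewrite mxE; congr (hpartial a _ x); apply/funext => y; rewrite mxE.
rewrite /riemann /curvature sumrB addrA.
rewrite [hpartial i _ x]D [hpartial j _ x]D.
move: (mxpartial _ _ _) (mxpartial _ _ _) => A B; rewrite !mxE; congr (_ + _ - _).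
  by apply: eq_bigr => m _; rewrite !mxE mulrC.
by apply: eq_bigr => m _; rewrite !mxE mulrC.
Qed.

Lemma ricciE h x j k : ricci h x j k = \sum_i curvature (connection h) i j x k i.
Proof. by rewrite mxE; apply: eq_bigr => i _; rewrite riemann_curvature. Qed.

Lemma metric_germ_near x h : metric_germ x h -> \forall y \near x, metric_germ y h.
Proof.
move=> [sh ph].
have A : \forall y \near x, forall r, forall s, smooth_germ y (fun z => h z r s).
  do 2 (apply: (@filter_forall _ _ _ (nbhs x) (nbhs_filter x)) => ?).
  exact: smooth_germ_near.
have B : \forall y \near x, \forall z \near y, H z -> (h z)^T = h z /\ h z \in unitmx.
  by apply/near_join.
by apply: filterS2 A B => y Ay By.
Qed.

Section AtPoint.
Variables (h : E -> 'M[R]_n) (x : E).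
Hypotheses (mh : metric_germ x h) (Hx : H x).

Let sh : smooth_mx x h. Proof. by case: mh. Qed.

Lemma metric_germ_sym : (h x)^T = h x.
Proof. by case: mh => _ /nbhs_singleton /(_ Hx) []. Qed.

Lemma metric_germ_unit : h x \in unitmx.
Proof. by case: mh => _ /nbhs_singleton /(_ Hx) []. Qed.

Lemma metric_partial_sym l : (mxpartial l h x)^T = mxpartial l h x.
Proof.
rewrite -mxpartial_tr; symmetry; apply: mxpartial_eq => //.
by case: mh => _; apply: filterS => y h1 /h1 [].
Qed.

Lemma smooth_connection i : smooth_mx x (connection h i).
Proof.
have sI : smooth_mx x (fun y => invmx (h y)).
  by apply: smooth_mx_inv => //; case: mh => _; apply: filterS => y h1 /h1 [].
move=> j k; under eq_fun do rewrite mxE /christoffel.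
apply: smooth_germ_mul; first exact: smooth_germ_cst.
apply: smooth_germ_sum => l _; apply: smooth_germ_mul; first exact: sI.
by apply: smooth_germ_sub; [apply: smooth_germ_add|]; apply: smooth_germ_hpartial; exact: sh.
Qed.

(** Multiplication by the metric lowers the upper index: these are the Christoffel symbols of the
    first kind. *)
Lemma connection_metric i : connection h i x *m h x = 2^-1 *: (mxpartial i h x
   + \matrix_(j, m) mxpartial j h x i m - \matrix_(j, m) mxpartial m h x i j).
Proof.
set P := _ + _ - _.
have -> : connection h i x = 2^-1 *: (P *m invmx (h x)).
  apply/matrixP => j k; rewrite !mxE /christoffel; congr (_ * _).
  apply: eq_bigr => l _; rewrite !mxE mulrC; congr (_ * _).
  by rewrite -[in RHS]metric_germ_sym -trmx_inv mxE.
by rewrite -scalemxAl mulmxKV// metric_germ_unit.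
Qed.

Lemma connection_compat i : mxpartial i h x = connection h i x *m h x + (connection h i x *m h x)^T.
Proof.
rewrite connection_metric; apply/matrixP => j k; rewrite !mxE.
have S l a b : mxpartial l h x a b = mxpartial l h x b a by rewrite -[in LHS]metric_partial_sym mxE.
have := S i j k; rewrite !mxE => ->; lra.
Qed.

Lemma connection_sym i j k : connection h i x j k = connection h j x i k.
Proof.
rewrite !mxE /christoffel; congr (_ * _); apply: eq_bigr => l _; congr (_ * _).
have := metric_partial_sym l; move/matrixP => /(_ i j); rewrite !mxE => ->.
by rewrite [hpartial i _ x + _]addrC.
Qed.

(** The fundamental theorem of Riemannian geometry: the Koszul combination of the compatibility
    equations determines the connection. Both transformation laws below are proved by checking these
    two hypotheses for a candidate. *)
Lemma connection_unique (C : 'I_n -> 'M[R]_n) :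
  (forall i j k, C i j k = C j i k) ->
  (forall i, mxpartial i h x = C i *m h x + (C i *m h x)^T) ->
  forall i, connection h i x = C i.
Proof.
move=> Csym Cmet i; apply: (can_inj (mulmxK metric_germ_unit)).
have Psym a b m : (C a *m h x) a b = (C a *m h x) a b by [].
have PS a b m : (C a *m h x) b m = (C b *m h x) a m.
  by rewrite !mxE; apply: eq_bigr => l _; rewrite Csym.
rewrite connection_metric; apply/matrixP => j m.
have E a b l : mxpartial a h x b l = (C a *m h x) b l + (C a *m h x) l b.
  by rewrite Cmet !mxE.
rewrite [LHS]mxE [X in _ * X]mxE [X in _ * (X + _)]mxE [X in _ * (_ + X)]mxE.
rewrite [X in _ * (_ + X + _)]mxE [X in _ * (_ + _ - X)]mxE !E.
rewrite (PS j i m) (PS m i j) (PS m j i); lra.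
Qed.

End AtPoint.

End LeviCivita.

(** The first two hypotheses are the last two differentiated: that for [Gj] in direction i, that for
    [Gi] in direction j. The second derivative [ddJ] is common to both and cancels in their
    difference. *)
Lemma gauge_algebra (R : realType) (n : nat) (Gi Gj J Ai Aj dij dji ddJ dAij dAji dJi dJj : 'M[R]_n) :
  dij *m J + Gj *m dJi = ddJ + (dJi *m Aj + J *m dAij) ->
  dji *m J + Gi *m dJj = ddJ + (dJj *m Ai + J *m dAji) ->
  Gi *m J = dJi + J *m Ai -> Gj *m J = dJj + J *m Aj ->
  (dij - dji + Gj *m Gi - Gi *m Gj) *m J = J *m (dAij - dAji + Aj *m Ai - Ai *m Aj).
Proof.
move=> E1 E2 E3 E4.
have Ei : dJi = Gi *m J - J *m Ai by rewrite E3 addrK.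
have Ej : dJj = Gj *m J - J *m Aj by rewrite E4 addrK.
rewrite {E3 E4}Ei {}Ej in E1 E2.
rewrite !(mulmxDl, mulmxBl, mulmxDr, mulmxBr, mulNmx, mulmxN, mulmxA) in E1 E2 *.
move: (dij *m J) (dji *m J) (Gj *m Gi *m J) (Gi *m Gj *m J) (Gi *m J *m Aj) (Gj *m J *m Ai)
  (J *m Ai *m Aj) (J *m Aj *m Ai) (J *m dAij) (J *m dAji) E1 E2.
move=> x1 x2 x3 x4 x5 x6 x7 x8 x9 x10 /matrixP E1 /matrixP E2.
apply/matrixP => a b; have := E1 a b; have := E2 a b; rewrite !mxE; lra.
Qed.

(** Metric compatibility of the transformed connection: the left side is the derivative of
    [J *m K *m J^T], with [D] the derivative of [J] and [P] the pulled-back connection. *)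
Lemma pullback_compat_algebra (R : realType) (n : nat) (D J P K : 'M[R]_n) : K^T = K ->
  (D *m K + J *m (P *m K + K *m P^T)) *m J^T + J *m K *m D^T =
  (D + J *m P) *m K *m J^T + ((D + J *m P) *m K *m J^T)^T.
Proof.
move=> KT; rewrite !trmx_mul trmxK KT [(D + J *m P)^T]linearD /= trmx_mul.
rewrite !(mulmxDl, mulmxDr, mulmxA).
move: (D *m K *m J^T) (J *m P *m K *m J^T) (J *m K *m P^T *m J^T) (J *m K *m D^T) => a b c d.
by apply/matrixP => i j; rewrite !mxE; ring.
Qed.

Lemma invmx_eq (R : comUnitRingType) (n : nat) (A B : 'M[R]_n) : A *m B = 1%:M -> invmx A = B.
Proof.
by move=> AB; have [uA _] := mulmx1_unit AB; rewrite -[LHS]mulmx1 -AB mulKmx.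
Qed.

(** * Tensoriality of the curvature *)

Section Change.
Variables (R : realType) (n : nat).
Local Notation E := 'rV[R]_n.
Local Notation H := (halfspace R n).
Variables (tau : E -> E) (h h' : E -> 'M[R]_n).
Local Notation J := (hjacobian tau).

Definition change_germ x : Prop :=
  [/\ forall j, smooth_germ x (fun y => tau y 0 j), \forall y \near x, H y -> H (tau y),
    metric_germ x h, metric_germ (tau x) h' &
    \forall y \near x, H y -> h y = J y *m h' (tau y) *m (J y)^T].

Lemma smooth_map_cvg (x : E) : (forall j, smooth_germ x (fun y => tau y 0 j)) -> H x ->
  tau @ within H (nbhs x) --> tau x.
Proof. by move=> st Hx; apply: cvg_rV => j; exact: smooth_germ_cvg. Qed.

Lemma change_germ_near (x : E) : H x -> change_germ x -> \forall y \near x, H y -> change_germ y.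
Proof.
move=> Hx [st Ht mh mh' Eh].
have A : \forall y \near x, forall j, smooth_germ y (fun y => tau y 0 j).
  apply: (@filter_forall _ _ _ (nbhs x) (nbhs_filter x)) => j.
  exact: smooth_germ_near.
have B : \forall y \near x, H y -> metric_germ (tau y) h'.
  exact: (smooth_map_cvg st Hx) (metric_germ_near mh').
have C : \forall y \near x, \forall z \near y, H z -> H (tau z) by apply/near_join.
have D : \forall y \near x, \forall z \near y, H z -> h z = J z *m h' (tau z) *m (J z)^T by apply/near_join.
have M := metric_germ_near mh.
have I P Q (nP : nbhs x P) (nQ : nbhs x Q) := @filterI _ _ (nbhs_filter x) _ _ nP nQ.
apply: (@filterS _ _ (nbhs_filter x) _ _ _ (I _ _ (I _ _ A B) (I _ _ (I _ _ C D) M))).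
by move=> y [[? By] [[? ?] ?]] Hy; split => //; exact: By.
Qed.

Section AtPoint.
Variable (x : E).
Hypotheses (Hx : H x) (cg : change_germ x).

Let st j : smooth_germ x (fun y => tau y 0 j). Proof. by case: cg. Qed.
Let Ht : \forall y \near x, H y -> H (tau y). Proof. by case: cg. Qed.
Let mh : metric_germ x h. Proof. by case: cg. Qed.
Let mh' : metric_germ (tau x) h'. Proof. by case: cg. Qed.
Let Hy : H (tau x). Proof. exact: nbhs_singleton Ht Hx. Qed.

Lemma smooth_jacobian : smooth_mx x J.
Proof. by move=> i j; under eq_fun do rewrite mxE; exact: smooth_germ_hpartial. Qed.
Let sJ := smooth_jacobian.

Lemma smooth_mx_comp p q (A : E -> 'M[R]_(p, q)) :
  smooth_mx (tau x) A -> smooth_mx x (fun y => A (tau y)).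
Proof. by move=> sA i j; apply: (@smooth_germ_comp _ _ tau (fun y => A y i j)). Qed.

Lemma mxpartial_chain p q i (A : E -> 'M[R]_(p, q)) : smooth_mx (tau x) A ->
  mxpartial i (fun y => A (tau y)) x = \sum_k J x i k *: mxpartial k A (tau x).
Proof.
move=> sA; apply/matrixP => r s; rewrite mxE summxE.
rewrite (@hpartial_chain _ _ tau (fun y => A y r s))//.
by apply: eq_bigr => k _; rewrite !mxE.
Qed.

Lemma change_metricE : h x = J x *m h' (tau x) *m (J x)^T.
Proof. by case: cg => _ _ _ _ /nbhs_singleton; apply. Qed.

Lemma change_unit : J x \in unitmx.
Proof.
have := metric_germ_unit mh Hx.
by rewrite change_metricE !unitmxE !det_mulmx !unitrM => /andP[/andP[]].
Qed.

(** The pullback by [tau] of the connection form of [h'], still in the frame of the target. *)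
Definition pulled_connection i y : 'M[R]_n := \sum_k J y i k *: connection h' k (tau y).

Lemma smooth_pulled_connection i : smooth_mx x (pulled_connection i).
Proof.
apply: smooth_mx_sum => k; apply: smooth_mx_scale; first exact: sJ.
by apply: smooth_mx_comp; exact: smooth_connection.
Qed.

(** The inhomogeneous law for a change of frame. By [connection_unique] it suffices that the
    candidate is symmetric, because second partials of [tau] commute and [h'] has no torsion, and
    compatible with the pulled-back metric. *)
Lemma connection_change i :
  connection h i x *m J x = mxpartial i J x + J x *m pulled_connection i x.
Proof.
pose B i := mxpartial i J x + J x *m pulled_connection i x.
have UJ := change_unit.
suff -> : connection h i x = B i *m invmx (J x) by rewrite mulmxKV.
move: i; apply: (connection_unique mh Hx) => [i j k|i].
  rewrite !mxE; apply: eq_bigr => m _; congr (_ * _); rewrite /B !mxE; congr (_ + _).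
    have D a b : hpartial a (fun y => J y b m) x = hpartial a (hpartial b (fun y => tau y 0 m)) x.
      by congr (hpartial a _ x); apply/funext => y; rewrite mxE.
    rewrite (D i j) (D j i); exact: hpartial_comm i j (st m) Hx.
  have D a b : \sum_q J x a q * pulled_connection b x q m =
      \sum_q \sum_p J x a q * (J x b p * connection h' p (tau x) q m).
    apply: eq_bigr => q _; rewrite summxE mulr_sumr; apply: eq_bigr => p _.
    by congr (_ * _); rewrite mxE.
  rewrite (D j i) (D i j) [RHS]exchange_big; apply: eq_bigr => q _; apply: eq_bigr => p _.
  by rewrite (connection_sym mh' Hy p q) mulrCA.
have Eh : mxpartial i h x = mxpartial i (fun y => J y *m h' (tau y) *m (J y)^T) x.
  by apply: mxpartial_eq => //; case: mh => //; case: cg.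
have sh' : smooth_mx (tau x) h' by case: mh'.
have shx := smooth_mx_comp sh'.
rewrite Eh mxpartial_mul//; [|exact: smooth_mx_mul|exact: smooth_mx_tr].
rewrite mxpartial_mul// mxpartial_tr mxpartial_chain// change_metricE.
have -> : \sum_k J x i k *: mxpartial k h' (tau x) =
   pulled_connection i x *m h' (tau x) + h' (tau x) *m (pulled_connection i x)^T.
  rewrite mulmx_suml linear_sum mulmx_sumr -big_split; apply: eq_bigr => k _ /=.
  rewrite (connection_compat mh' Hy) trmx_mul (metric_germ_sym mh' Hy) scalerDr.
  by rewrite -scalemxAl linearZ /= -scalemxAr.
rewrite !mulmxA mulmxKV//.
exact: pullback_compat_algebra (metric_germ_sym mh' Hy).
Qed.

End AtPoint.

(** [connection_change] holds at all half-space points near [x], so it may be differentiated;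
    [gauge_algebra] then eliminates the inhomogeneous terms. *)
Lemma curvature_gauge x i j : H x -> change_germ x ->
  curvature (connection h) i j x *m J x = J x *m curvature pulled_connection i j x.
Proof.
move=> Hx cg; have [st Ht mh mh' _] := cg.
have sJ := smooth_jacobian cg; have sC := smooth_connection mh Hx.
have sP := smooth_pulled_connection Hx cg.
have near_eq k : \forall y \near x, H y ->
    connection h k y *m J y = mxpartial k J y + J y *m pulled_connection k y.
  by apply: filterS (change_germ_near Hx cg) => y h1 Hy; apply: connection_change => //; exact: h1.
have key a b : mxpartial a (connection h b) x *m J x + connection h b x *m mxpartial a J x =
   mxpartial a (mxpartial b J) x + (mxpartial a J x *m pulled_connection b x
      + J x *m mxpartial a (pulled_connection b) x).
  rewrite -mxpartial_mul// (mxpartial_eq Hx a (smooth_mx_mul (sC b) sJ) (near_eq b)).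
  rewrite mxpartial_add//; first by rewrite mxpartial_mul.
    exact: smooth_mx_partial.
  exact: smooth_mx_mul.
apply: (gauge_algebra (key i j) _ (connection_change Hx cg i) (connection_change Hx cg j)).
by rewrite (mxpartial_comm Hx i j sJ); exact: key.
Qed.

(** Curvature commutes with pullback: derivatives of [J] enter as second partials of [tau] and
    cancel by their symmetry. *)
Lemma curvature_pulled x i j : H x -> change_germ x -> curvature pulled_connection i j x =
  \sum_p \sum_q (J x i p * J x j q) *: curvature (connection h') p q (tau x).
Proof.
move=> Hx cg; have [st Ht mh mh' _] := cg.
have Hy : H (tau x) by exact: nbhs_singleton Ht Hx.
have sJ := smooth_jacobian cg.
have sC k : smooth_mx x (fun y => connection h' k (tau y)).
  by apply: smooth_mx_comp => //; exact: smooth_connection.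
pose G k := connection h' k (tau x).
pose dG p q := mxpartial p (connection h' q) (tau x).
have D a b : mxpartial a (pulled_connection b) x =
   (\sum_q mxpartial a J x b q *: G q) + \sum_p \sum_q (J x a p * J x b q) *: dG p q.
  rewrite mxpartial_sum//; last by move=> k; apply: smooth_mx_scale => //; exact: sJ.
  rewrite [X in _ + X]exchange_big -big_split; apply: eq_bigr => q _ /=.
  rewrite mxpartial_scale//.
  rewrite mxpartial_chain//; last exact: smooth_connection.
  rewrite scaler_sumr [mxpartial a J x b q]mxE; congr (_ + _).
  by apply: eq_bigr => p _; rewrite scalerA mulrC.
have S : \sum_q mxpartial i J x j q *: G q = \sum_q mxpartial j J x i q *: G q.
  apply: eq_bigr => q _; congr (_ *: _).
  have D2 a b : mxpartial a J x b q = hpartial a (hpartial b (fun y => tau y 0 q)) x.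
    by rewrite mxE; congr (hpartial a _ x); apply/funext => y; rewrite mxE.
  exact: (etrans (D2 i j) (etrans (hpartial_comm i j (st q) Hx) (esym (D2 j i)))).
have P a b : pulled_connection a x *m pulled_connection b x =
    \sum_p \sum_q (J x a p * J x b q) *: (G p *m G q).
  rewrite mulmx_suml; apply: eq_bigr => p _; rewrite mulmx_sumr; apply: eq_bigr => q _.
  by rewrite -scalemxAl -scalemxAr scalerA.
rewrite /curvature (D i j) (D j i) S (P i j) (P j i).
rewrite [X in _ - (_ + X)]exchange_big [X in _ - _ + X - _]exchange_big /=.
rewrite opprD addrACA subrr add0r -!sumrB -big_split -sumrB; apply: eq_bigr => p _ /=.
rewrite -!sumrB -big_split -sumrB; apply: eq_bigr => q _ /=.
by rewrite [J x j q * _]mulrC !scalerBr !scalerDr scalerN.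
Qed.

Lemma ricci_change x : H x -> change_germ x ->
  ricci h x = J x *m ricci h' (tau x) *m (J x)^T.
Proof.
move=> Hx cg; have UJ := change_unit Hx cg.
have F i j : curvature (connection h) i j x =
   \sum_p \sum_q (J x i p * J x j q) *: (J x *m curvature (connection h') p q (tau x) *m invmx (J x)).
  apply: (can_inj (mulmxK UJ)); rewrite curvature_gauge// curvature_pulled//.
  rewrite mulmx_sumr mulmx_suml; apply: eq_bigr => p _.
  rewrite mulmx_sumr mulmx_suml; apply: eq_bigr => q _.
  by rewrite -scalemxAr -scalemxAl mulmxKV.
move: (J x) UJ F => Jx UJ F; apply/matrixP => j k; rewrite ricciE.
transitivity (\sum_p \sum_q Jx j q * (Jx *m curvature (connection h') p q (tau x)) k p).
  under eq_bigr do rewrite F summxE.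
  rewrite exchange_big; apply: eq_bigr => p _ /=.
  under eq_bigr do rewrite summxE.
  rewrite exchange_big; apply: eq_bigr => q _ /=.
  set K := Jx *m curvature _ _ _ _.
  (* Writing [K] as K J^-1 J produces the sum over [i] of the trace on the left, whose terms carry
     the factor [Jx i p]. *)
  have -> : K k p = (K *m invmx (Jx) *m Jx) k p by rewrite mulmxKV.
  rewrite [X in _ = _ * X]mxE mulr_sumr; apply: eq_bigr => i _.
  by move: (K *m invmx (Jx)) => L; rewrite [LHS]mxE; move: (Jx i p) (Jx j q) (L k i) => a b c; ring.
transitivity (\sum_q \sum_p \sum_m Jx j q * (Jx k m * curvature (connection h') p q (tau x) m p)).
  rewrite exchange_big; apply: eq_bigr => q _; apply: eq_bigr => p _ /=.
  by rewrite mxE mulr_sumr.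
transitivity (\sum_m \sum_q \sum_p Jx j q * (Jx k m * curvature (connection h') p q (tau x) m p)).
  by rewrite [RHS]exchange_big; apply: eq_bigr => q _; rewrite exchange_big.
rewrite [RHS]mxE; apply: eq_bigr => m _; rewrite [(_ *m _) j m]mxE [_^T m k]mxE mulr_suml.
apply: eq_bigr => q _; rewrite ricciE mulr_sumr mulr_suml; apply: eq_bigr => p _.
by rewrite mulrA mulrAC.
Qed.

(** As the trace of h^-1 Ric^T, in which [J] cancels by cyclicity. *)
Lemma scalar_curvature_change x : H x -> change_germ x ->
  scalar_curvature h x = scalar_curvature h' (tau x).
Proof.
move=> Hx cg; have UJ := change_unit Hx cg; have [st Ht mh mh' _] := cg.
have Uh := metric_germ_unit mh' (nbhs_singleton Ht Hx).
have tr (k : E -> 'M[R]_n) y : scalar_curvature k y = \tr (invmx (k y) *m (ricci k y)^T).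
  rewrite /scalar_curvature /mxtrace; apply: eq_bigr => i _; rewrite [RHS]mxE.
  by apply: eq_bigr => j _; rewrite [(ricci k y)^T _ _]mxE.
rewrite !tr ricci_change// (change_metricE Hx cg) !trmx_mul trmxK.
have UJT : (J x)^T \in unitmx by rewrite unitmx_tr.
have -> : invmx (J x *m h' (tau x) *m (J x)^T) =
    invmx (J x)^T *m (invmx (h' (tau x)) *m invmx (J x)).
  by apply: invmx_eq; rewrite !mulmxA (mulmxK UJT) (mulmxK Uh) mulmxV.
rewrite mxtrace_mulC !mulmxA (mulmxK UJT) -!mulmxA mxtrace_mulC -!mulmxA (mulVmx UJ) mulmx1.
exact: mxtrace_mulC.
Qed.

Lemma einstein_change x : H x -> change_germ x ->
  einstein h x = J x *m einstein h' (tau x) *m (J x)^T.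
Proof.
move=> Hx cg; rewrite /einstein scalar_curvature_change// ricci_change//.
by rewrite (change_metricE Hx cg) mulmxBr mulmxBl -scalemxAr -scalemxAl.
Qed.

End Change.

(** * Curvature of a conformal metric *)

Lemma sum_delta (R : pzRingType) (n : nat) (f : 'I_n -> R) (j : 'I_n) :
  \sum_i f i * (j == i)%:R = f j.
Proof.
rewrite (bigD1 j)//= eqxx mulr1 big1 ?addr0// => i /negPf.
by rewrite eq_sym => ->; rewrite mulr0.
Qed.

Lemma rank1_mul (R : comPzRingType) (n : nat) (a b c d : 'rV[R]_n) :
  (a^T *m b) *m (c^T *m d) = (b *m c^T) 0 0 *: (a^T *m d).
Proof.
by rewrite mulmxA -(mulmxA a^T) [in LHS](mx11_scalar (b *m c^T)) mul_mx_scalar -scalemxAl.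
Qed.

Section ConformalAlgebra.
Variables (R : realType) (n : nat).
Implicit Types (K : 'M[R]_n) (u : 'rV[R]_n).

Local Notation e_ := (@delta_mx _ 1 n 0).

(* The difference of the Levi-Civita connections of e^{2u} h and h, where u is
   the row of partial derivatives and U its gradient:
   S^k_ij = u_j delta_ik + u_i delta_jk - h_ij U^k. *)
Definition conformal_shift K u (U : 'rV[R]_n) (i : 'I_n) : 'M[R]_n :=
  u^T *m e_ i + u 0 i *: 1%:M - (e_ i *m K)^T *m U.

Lemma rank1E (a b : 'rV[R]_n) k i : (a^T *m b) k i = a 0 k * b 0 i.
Proof. by rewrite mxE big_ord1 mxE. Qed.

Lemma row_delta_mul K i k : (e_ i *m K) 0 k = K i k.
Proof. by rewrite -rowE mxE. Qed.

Lemma conformal_shiftE K u U i j k :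
  conformal_shift K u U i j k = u 0 j * (k == i)%:R + u 0 i * (j == k)%:R - K i j * U 0 k.
Proof.
rewrite /conformal_shift mxE [X in X + _]mxE [X in _ + X]mxE !rank1E row_delta_mul.
by rewrite [X in _ + X - _]mxE !mxE eqxx.
Qed.

Variables (K : 'M[R]_n) (u : 'rV[R]_n).
Hypotheses (KT : K^T = K) (KU : K \in unitmx).
Let U := u *m invmx K.
Let S := conformal_shift K u U.
Let N := (U *m u^T) 0 0.

Let dot_delta (a : 'rV[R]_n) j : (e_ j *m a^T) 0 0 = a 0 j.
Proof. by rewrite -rowE !mxE. Qed.

Let dot_U i : (U *m (e_ i *m K)^T) 0 0 = u 0 i.
Proof.
rewrite trmx_mul KT mulmxA /U mulmxKV// trmx_delta mxE (bigD1 i)//= mxE !eqxx mulr1 big1 ?addr0// => j /negPf h.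
by rewrite mxE h mulr0.
Qed.

Let dot_K i j : (e_ j *m (e_ i *m K)^T) 0 0 = K i j.
Proof. by rewrite dot_delta row_delta_mul. Qed.

Lemma conformal_shift_mul i j : S j *m S i =
  (2 * u 0 j) *: (u^T *m e_ i) + u 0 i *: (u^T *m e_ j) + (u 0 i * u 0 j) *: 1%:M
  - K i j *: (u^T *m U) - u 0 j *: ((e_ i *m K)^T *m U) - N *: ((e_ j *m K)^T *m e_ i).
Proof.
rewrite /S /conformal_shift.
set a := _ *m e_ j; set b := _ *m e_ i; set c := (e_ j *m K)^T *m U; set d := (e_ i *m K)^T *m U.
have E1 : a *m b = u 0 j *: b by rewrite /a /b rank1_mul dot_delta.
have E2 : a *m d = K i j *: (u^T *m U) by rewrite /a /d rank1_mul dot_K.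
have E3 : c *m b = N *: ((e_ j *m K)^T *m e_ i) by rewrite /c /b rank1_mul.
have E4 : c *m d = u 0 i *: c by rewrite /c /d rank1_mul dot_U.
rewrite !(mulmxDl, mulmxDr, mulNmx, mulmxN) E1 E2 E3 E4 -!scalemxAl -!scalemxAr !mulmx1 !mul1mx.
rewrite scalerA; clear E1 E2 E3 E4.
move: (u^T *m U) ((e_ j *m K)^T *m e_ i) (1%:M : 'M[R]_n) b a c d => x1 x2 x3 b a c d.
by apply/matrixP => r s; rewrite !mxE; move: (u 0 i) (u 0 j) => p q; ring.
Qed.

(** The part of the conformal Ricci tensor that is quadratic in the differential of the exponent. *)
Lemma conformal_quadratic j k : \sum_i (S j *m S i - S i *m S j) k i =
  (n%:R - 2) * (u 0 j * u 0 k - N * K j k).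
Proof.
have Ksym a b : K a b = K b a by rewrite -[in LHS]KT mxE.
have sU : \sum_i K i k * U 0 i = u 0 k.
  have <- : (U *m K) 0 k = u 0 k by rewrite /U mulmxKV.
  by rewrite mxE; apply: eq_bigr => i _; rewrite mulrC.
have sN : \sum_i u 0 i * U 0 i = N.
  by rewrite /N mxE; apply: eq_bigr => i _; rewrite [u^T i 0]mxE mulrC.
have E i : (S j *m S i - S i *m S j) k i = u 0 j * u 0 k - u 0 k * u 0 i * (j == i)%:R
   - u 0 j * (K i k * U 0 i) + K j k * (u 0 i * U 0 i) - N * (K j k - K i k * (j == i)%:R).
  rewrite !conformal_shift_mul (Ksym j i).
  have e1 : (u^T *m e_ i) k i = u 0 k by rewrite rank1E mxE !eqxx mulr1.
  have e2 : (u^T *m e_ j) k i = u 0 k * (j == i)%:R by rewrite rank1E mxE eqxx eq_sym.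
  have e3 l : ((e_ l *m K)^T *m U) k i = K l k * U 0 i by rewrite rank1E row_delta_mul.
  have e4 : ((e_ j *m K)^T *m e_ i) k i = K j k by rewrite rank1E row_delta_mul mxE !eqxx mulr1.
  have e5 : ((e_ i *m K)^T *m e_ j) k i = K i k * (j == i)%:R.
    by rewrite rank1E row_delta_mul mxE eqxx eq_sym.
  move: e1 e2 (e3 i) (e3 j) e4 e5.
  move: (u^T *m e_ i) (u^T *m e_ j) ((e_ i *m K)^T *m U) ((e_ j *m K)^T *m U)
    ((e_ j *m K)^T *m e_ i) ((e_ i *m K)^T *m e_ j) (u^T *m U) (1%:M : 'M[R]_n) (U 0 i) N.
  move=> a1 a2 a3 a4 a5 a6 a7 a8 z N0 e1 e2 e3i e3j e4 e5; rewrite !mxE e1 e2 e3i e3j e4 e5; ring.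
have nat (x : R) : x *+ n = n%:R * x by rewrite mulr_natl.
have EB := sum_delta (fun i => u 0 k * u 0 i) j.
have EC : \sum_i u 0 j * (K i k * U 0 i) = u 0 j * u 0 k by rewrite -mulr_sumr sU.
have ED : \sum_i K j k * (u 0 i * U 0 i) = K j k * N by rewrite -mulr_sumr sN.
have EE : \sum_i N * (K j k - K i k * (j == i)%:R) = N * (n%:R * K j k - K j k).
  by rewrite -mulr_sumr sumrB (sum_delta (fun i => K i k) j) sumr_const card_ord nat.
under eq_bigr do rewrite E.
rewrite sumrB big_split /= sumrB sumrB sumr_const card_ord (nat (u 0 j * u 0 k)).
rewrite {}EB {}EC {}ED {}EE; move: N (n%:R : R) (u 0 j) (u 0 k) (K j k) => a b c d e.
by ring.
Qed.

Variables (G : 'I_n -> 'M[R]_n) (W : 'I_n -> 'rV[R]_n).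
Hypotheses (Gsym : forall i j k, G i j k = G j i k) (Wsym : forall i j, W i 0 j = W j 0 i).

Definition covariant_hessian : 'M[R]_n := \matrix_(i, k) (W i - u *m (G i)^T) 0 k.
(** The derivative in direction [i] of the shift in direction [j], in algebraic form: [W] stands for
    the derivative of [u], that of [K] is rewritten by the compatibility of [G], and that of [U]
    comes from differentiating U K = u. *)
Definition shift_derivative i j : 'M[R]_n :=
  (W i)^T *m e_ j + W i 0 j *: 1%:M
  - ((e_ j *m (G i *m K + (G i *m K)^T))^T *m U
     + (e_ j *m K)^T *m ((W i - U *m (G i *m K + (G i *m K)^T)) *m invmx K)).

(** The covariant derivative of the shift. Besides the Hessian terms there are a multiple of the
    identity and a final bracket, symmetric in i and j because [W] is symmetric and [G]
    torsion-free; both will cancel in the curvature. *)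
Lemma shift_covariant i j : shift_derivative i j + S j *m G i - G i *m S j =
  (W i - u *m (G i)^T)^T *m e_ j + W i 0 j *: 1%:M - (e_ j *m K)^T *m ((W i - u *m (G i)^T) *m invmx K)
  + (u^T *m (e_ j *m G i) - ((e_ j *m G i) *m K)^T *m U).
Proof.
have E1 : (W i - U *m (G i *m K + (G i *m K)^T)) *m invmx K =
    (W i - u *m (G i)^T) *m invmx K - U *m G i.
  have UK : U *m K = u by rewrite /U mulmxKV.
  rewrite trmx_mul KT mulmxDr !mulmxA UK.
  rewrite opprD addrA !mulmxBl mulmxK//.
  by move: (W i *m invmx K) (U *m G i) (u *m (G i)^T *m invmx K) => a b c; rewrite addrAC.
rewrite /shift_derivative E1 /S /conformal_shift.
move: ((W i - u *m (G i)^T) *m invmx K) => Z.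
have A1 : (e_ j *m (G i *m K + (G i *m K)^T))^T = K *m (G i)^T *m (e_ j)^T + G i *m K *m (e_ j)^T.
  by rewrite trmx_mul [(_ + _)^T]linearD /= trmxK mulmxDl trmx_mul KT.
have A2 : (e_ j *m K)^T = K *m (e_ j)^T by rewrite trmx_mul KT.
have A3 : (W i - u *m (G i)^T)^T = (W i)^T - G i *m u^T.
  by rewrite [LHS]linearB /= trmx_mul trmxK.
have A4 : (e_ j *m G i *m K)^T = K *m (G i)^T *m (e_ j)^T by rewrite !trmx_mul KT mulmxA.
rewrite A1 A2 A3 A4.
rewrite !(mulmxDl, mulmxDr, mulNmx, mulmxN) -!scalemxAl -!scalemxAr mul1mx mulmx1 !mulmxA.
move: ((W i)^T *m e_ j) (G i *m u^T *m e_ j) (K *m (e_ j)^T *m Z) (u^T *m e_ j *m G i)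
  (K *m (G i)^T *m (e_ j)^T *m U) (G i *m K *m (e_ j)^T *m U) (K *m (e_ j)^T *m U *m G i).
move=> a1 a2 a3 a4 a5 a6 a7.
by apply/matrixP => r s; rewrite !mxE; ring.
Qed.

End ConformalAlgebra.

(** Compatibility of the shifted connection with the conformal metric: [e] stands for exp(2u), whose
    i-th derivative is 2 e u_i. *)
Lemma shift_compat_algebra (R : realType) (n : nat) (G K : 'M[R]_n) (u U : 'rV[R]_n) (i : 'I_n) (e : R) :
  K^T = K -> U *m K = u ->
  (e * (2 * u 0 i)) *: K + e *: (G *m K + (G *m K)^T) =
  (G + conformal_shift K u U i) *m (e *: K) + ((G + conformal_shift K u U i) *m (e *: K))^T.
Proof.
move=> KT UK; rewrite /conformal_shift -scalemxAr [(_ *: _)^T]linearZ /= -scalerDr -scalerA -scalerDr.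
congr (_ *: _).
set d := delta_mx 0 i.
have E : (G + (u^T *m d + u 0 i *: 1%:M - (d *m K)^T *m U)) *m K =
    G *m K + (u^T *m (d *m K) + u 0 i *: K - (d *m K)^T *m u).
  rewrite mulmxDl mulmxBl mulmxDl -[(d *m K)^T *m U *m K]mulmxA UK -!mulmxA -scalemxAl mul1mx.
  by [].
have T : (u^T *m (d *m K))^T = (d *m K)^T *m u by rewrite trmx_mul trmxK.
have T' : ((d *m K)^T *m u)^T = u^T *m (d *m K) by rewrite trmx_mul trmxK.
rewrite E [(G *m K + _)^T]linearD /= [(_ - _)^T]linearB /= [(_ + _)^T]linearD /= T T' [(_ *: K)^T]linearZ /= KT.
move: (G *m K) ((G *m K)^T) (u^T *m (d *m K)) ((d *m K)^T *m u) => a b c f.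
by apply/matrixP => r s; rewrite !mxE; move: (u 0 i) => p; ring.
Qed.

Section Conformal.
Variables (R : realType) (n : nat).
Local Notation E := 'rV[R]_n.
Local Notation H := (halfspace R n).
Variables (h : E -> 'M[R]_n) (u : E -> R).

Definition conformal_metric y : 'M[R]_n := expR (2 * u y) *: h y.
Definition gradient_row (f : E -> R) y : 'rV[R]_n := \row_k hpartial k f y.

Local Notation ht := conformal_metric.
Local Notation du := (gradient_row u).
Let U y := du y *m invmx (h y).
Let S i y := conformal_shift (h y) (du y) (U y) i.

Section AtPoint.
Variable (x : E).
Hypotheses (Hx : H x) (mh : metric_germ x h) (su : smooth_germ x u).

Lemma smooth_gradient : smooth_mx x du.
Proof. by move=> i j; under eq_fun do rewrite mxE; exact: smooth_germ_hpartial. Qed.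

Lemma smooth_conformal_factor : smooth_germ x (fun y => expR (2 * u y)).
Proof.
by apply: smooth_germ_expR; apply: smooth_germ_mul => //; exact: smooth_germ_cst.
Qed.

Lemma metric_germ_conformal : metric_germ x ht.
Proof.
case: mh => sh ph; split.
  by apply: smooth_mx_scale => //; exact: smooth_conformal_factor.
apply: filterS ph => y h1 Hy; have [hT hU] := h1 Hy.
rewrite /ht linearZ /= hT; split => //.
by rewrite unitmxZ// unitfE gt_eqF// expR_gt0.
Qed.

Lemma gradient_U : U x *m h x = du x.
Proof. by rewrite /U mulmxKV// (metric_germ_unit mh Hx). Qed.

Lemma connection_conformal i : connection ht i x = connection h i x + S i x.
Proof.
move: i; apply: (connection_unique metric_germ_conformal Hx) => [i j k|i].
  rewrite mxE [RHS]mxE (connection_sym mh Hx i j) /S !conformal_shiftE; congr (_ + _).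
  have hs : h x i j = h x j i by rewrite -[in LHS](metric_germ_sym mh Hx) mxE.
  by rewrite hs [k == i]eq_sym [k == j]eq_sym addrC [RHS]addrC; congr (_ + _); rewrite addrC.
have sf := smooth_conformal_factor; have [sh _] := mh.
rewrite mxpartial_scale// (connection_compat mh Hx).
have -> : hpartial i (fun y => expR (2 * u y)) x = expR (2 * u x) * (2 * du x 0 i).
  have s2 : smooth_germ x (fun=> 2 : R) by exact: smooth_germ_cst.
  rewrite hpartial_expR//; last exact: smooth_germ_mul.
  by rewrite hpartial_mul// hpartial_cst// mul0r add0r mxE.
rewrite /ht; apply: shift_compat_algebra; first exact: metric_germ_sym mh Hx.
exact: gradient_U.
Qed.

Lemma smooth_U : smooth_mx x U.
Proof.
apply: smooth_mx_mul; first exact: smooth_gradient.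
have [sh ph] := mh; apply: smooth_mx_inv => //.
by apply: filterS ph => y h1 /h1 [].
Qed.

Lemma smooth_shift i : smooth_mx x (S i).
Proof.
have [sh _] := mh; have sU := smooth_U; have sd := smooth_gradient.
apply: smooth_mx_add; first apply: smooth_mx_add.
- by apply: smooth_mx_mul; [exact: smooth_mx_tr|exact: smooth_mx_cst].
- by apply: smooth_mx_scale; [exact: sd|exact: smooth_mx_cst].
apply: smooth_mx_opp; apply: smooth_mx_mul => //; apply: smooth_mx_tr.
by apply: smooth_mx_mul => //; exact: smooth_mx_cst.
Qed.

(** Obtained by differentiating U h = du, which avoids differentiating an inverse matrix. *)
Lemma mxpartial_U i : mxpartial i U x =
  (mxpartial i du x - U x *m mxpartial i h x) *m invmx (h x).
Proof.
have [sh ph] := mh; have uh := metric_germ_unit mh Hx.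
apply: (can_inj (mulmxK uh)); rewrite mulmxKV//; apply/eqP; rewrite -subr_eq opprK; apply/eqP; symmetry.
rewrite -mxpartial_mul//; last exact: smooth_U.
apply: mxpartial_eq => //; first exact: smooth_gradient.
by apply: filterS ph => y h1 /h1 [_ hu]; rewrite /U mulmxKV.
Qed.

Lemma mxpartial_shift i j : mxpartial i (S j) x =
  shift_derivative (h x) (du x) (fun k => connection h k x) (fun k => mxpartial k du x) i j.
Proof.
have [sh _] := mh; have sU := smooth_U; have sd := smooth_gradient.
have sdT := smooth_mx_tr sd.
have sc p q (A : 'M[R]_(p, q)) : smooth_mx x (fun=> A) by exact: smooth_mx_cst.
have s1 : smooth_mx x (fun y => (du y)^T *m delta_mx 0 j) by exact: smooth_mx_mul.
have s2 : smooth_mx x (fun y => du y 0 j *: (1%:M : 'M[R]_n)).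
  by apply: smooth_mx_scale => //; exact: sd.
have s3 : smooth_mx x (fun y => (delta_mx 0 j : 'rV[R]_n) *m h y) by exact: smooth_mx_mul.
have s4 := smooth_mx_tr s3.
have s5 := smooth_mx_mul s4 sU.
have s6 := smooth_mx_opp s5.
rewrite /S /conformal_shift mxpartial_add//; last exact: smooth_mx_add.
rewrite mxpartial_add// mxpartial_mul// mxpartial_cst// mulmx0 addr0 mxpartial_tr.
rewrite mxpartial_scale//.
rewrite mxpartial_cst// scaler0 addr0 mxpartial_opp// mxpartial_mul// mxpartial_tr mxpartial_mul//.
rewrite mxpartial_cst// mul0mx add0r mxpartial_U (connection_compat mh Hx) /shift_derivative.
by congr (_ + _ *: _ - _); rewrite mxE; congr (hpartial i _ x); apply/funext => y; rewrite !mxE.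
Qed.

End AtPoint.

End Conformal.

(** The curvature of a connection G + S is that of G, plus the antisymmetrised covariant derivative
    of S, plus a commutator. *)
Lemma curvature_add_algebra (R : realType) (n : nat) (dGij dGji dSij dSji Gi Gj Si Sj : 'M[R]_n) :
  (dGij + dSij) - (dGji + dSji) + (Gj + Sj) *m (Gi + Si) - (Gi + Si) *m (Gj + Sj) =
  (dGij - dGji + Gj *m Gi - Gi *m Gj) +
  ((dSij + Sj *m Gi - Gi *m Sj) - (dSji + Si *m Gj - Gj *m Si)) + (Sj *m Si - Si *m Sj).
Proof.
rewrite !(mulmxDl, mulmxDr).
move: (Gj *m Gi) (Gi *m Gj) (Sj *m Gi) (Gi *m Sj) (Si *m Gj) (Gj *m Si) (Sj *m Si) (Si *m Sj).
by move=> a b c d e f g k; apply/matrixP => r s; rewrite !mxE; ring.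
Qed.

Lemma entry_cancel (R : realType) (n : nat) (A B C D M O : 'M[R]_n) (w w' a b c d : R) k i :
  A k i = a -> B k i = b -> C k i = c -> D k i = d -> w = w' ->
  (A + w *: O - C + M - (B + w' *: O - D + M)) k i = a - b - c + d.
Proof. by move=> <- <- <- <- <-; rewrite !mxE; ring. Qed.

Lemma ricci_entry (R : realType) (n : nat) (A B C K : 'M[R]_n) (t l g p q : R) j k :
  C j k = p * q ->
  A j k + (- t * B j k - l * K j k) + t * (p * q - g * K j k) =
  (A - t *: (B - C) - (l + t * g) *: K) j k.
Proof. by move=> E; rewrite !mxE E; ring. Qed.

Section Conformal.
Variables (R : realType) (n : nat).
Local Notation E := 'rV[R]_n.
Local Notation H := (halfspace R n).
Variables (h : E -> 'M[R]_n) (u : E -> R) (x : E).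
Hypotheses (Hx : H x) (mh : metric_germ x h) (su : smooth_germ x u).

Local Notation ht := (conformal_metric h u).
Local Notation du := (gradient_row u).
Local Notation e_ := (@delta_mx _ 1 n 0).
Let K := h x.
Let U := du x *m invmx K.
Let S := conformal_shift K (du x) U.
Let G := fun i => connection h i x.
Let W := fun i => mxpartial i du x.

Definition hessian (f : E -> R) y : 'M[R]_n :=
  covariant_hessian (gradient_row f y) (fun i => connection h i y) (fun i => mxpartial i (gradient_row f) y).
Definition laplacian (f : E -> R) y : R := \sum_i (hessian f y *m invmx (h y)) i i.
Definition gradient_sqnorm (f : E -> R) y : R :=
  (gradient_row f y *m invmx (h y) *m (gradient_row f y)^T) 0 0.

Lemma curvature_conformal i j : curvature (connection ht) i j x = curvature (connection h) i j x +
  ((shift_derivative K (du x) G W i j + S j *m G i - G i *m S j) -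
   (shift_derivative K (du x) G W j i + S i *m G j - G j *m S i)) + (S j *m S i - S i *m S j).
Proof.
have nC k : \forall y \near x, H y -> connection ht k y = connection h k y +
    conformal_shift (h y) (du y) (du y *m invmx (h y)) k.
  have I P Q (nP : nbhs x P) (nQ : nbhs x Q) := @filterI _ _ (nbhs_filter x) _ _ nP nQ.
  apply: (@filterS _ _ (nbhs_filter x) _ _ _ (I _ _ (metric_germ_near mh) (smooth_germ_near su))).
  by move=> y [m s] Hy; exact: connection_conformal.
have D a b : mxpartial a (connection ht b) x = mxpartial a (connection h b) x + shift_derivative K (du x) G W a b.
  rewrite -(@mxpartial_shift _ _ h u x Hx mh su) -mxpartial_add//.
  - exact: (mxpartial_eq Hx a (smooth_connection (metric_germ_conformal mh su) Hx b) (nC b)).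
  - exact: smooth_connection mh Hx b.
  - exact: smooth_shift.
rewrite /curvature (D i j) (D j i) !(connection_conformal Hx mh su).
exact: curvature_add_algebra.
Qed.

Let Wsym i j : W i 0 j = W j 0 i.
Proof.
have D a b : W a 0 b = hpartial a (hpartial b u) x.
  by rewrite mxE; congr (hpartial a _ x); apply/funext => y; rewrite mxE.
exact: (etrans (D i j) (etrans (hpartial_comm i j su Hx) (esym (D j i)))).
Qed.

Lemma hessianE i k : hessian u x i k = (W i - du x *m (G i)^T) 0 k.
Proof. by rewrite mxE. Qed.

(** The part of the conformal Ricci tensor that is linear in the Hessian. *)
Lemma shift_contraction j k :
  \sum_i ((shift_derivative K (du x) G W i j + S j *m G i - G i *m S j) -
   (shift_derivative K (du x) G W j i + S i *m G j - G j *m S i)) k i =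
  - (n%:R - 2) * hessian u x j k - laplacian u x * K j k.
Proof.
have KT := metric_germ_sym mh Hx; have KU := metric_germ_unit mh Hx.
pose V i := W i - du x *m (G i)^T.
have Vi i l : V i 0 l = hessian u x i l by rewrite hessianE.
have rowVi i l : (V i *m invmx K) 0 l = (hessian u x *m invmx K) i l.
  by rewrite !mxE; apply: eq_bigr => m _; rewrite Vi.
have eG i : e_ j *m G i = e_ i *m G j.
  by rewrite -!rowE; apply/rowP => l; rewrite [LHS]mxE [RHS]mxE; exact: connection_sym.
have C a b : shift_derivative K (du x) G W a b + S b *m G a - G a *m S b =
    (V a)^T *m e_ b + W a 0 b *: 1%:M - (e_ b *m K)^T *m (V a *m invmx K)
    + ((du x)^T *m (e_ b *m G a) - ((e_ b *m G a) *m K)^T *m U).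
  exact: shift_covariant.
have E i : ((shift_derivative K (du x) G W i j + S j *m G i - G i *m S j) -
   (shift_derivative K (du x) G W j i + S i *m G j - G j *m S i)) k i =
   hessian u x i k * (j == i)%:R - hessian u x j k - K j k * (hessian u x *m invmx K) i i
    + K i k * (hessian u x *m invmx K) j i.
  rewrite (C i j) (C j i) (eG i).
  have e1 : ((V i)^T *m e_ j) k i = hessian u x i k * (j == i)%:R by rewrite rank1E Vi; congr (_ * _); rewrite mxE eqxx eq_sym.
  have e2 : ((V j)^T *m e_ i) k i = hessian u x j k by rewrite rank1E Vi [X in _ * X]mxE !eqxx mulr1.
  have e3 : ((e_ j *m K)^T *m (V i *m invmx K)) k i = K j k * (hessian u x *m invmx K) i i.
    by rewrite rank1E row_delta_mul rowVi.
  have e4 : ((e_ i *m K)^T *m (V j *m invmx K)) k i = K i k * (hessian u x *m invmx K) j i.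
    by rewrite rank1E row_delta_mul rowVi.
  exact: entry_cancel e1 e2 e3 e4 (Wsym i j).
under eq_bigr do rewrite E.
have nat (t : R) : t *+ n = n%:R * t by rewrite mulr_natl.
have EA := sum_delta (fun i => hessian u x i k) j.
have EB : \sum_i K j k * (hessian u x *m invmx K) i i = K j k * laplacian u x by rewrite -mulr_sumr.
have EC : \sum_i K i k * (hessian u x *m invmx K) j i = hessian u x j k.
  have <- : (hessian u x *m invmx K *m K) j k = hessian u x j k by rewrite mulmxKV.
  by rewrite [RHS]mxE; apply: eq_bigr => i _; rewrite mulrC.
rewrite big_split /= sumrB sumrB sumr_const card_ord (nat (hessian u x j k)).
rewrite {}EA {}EB {}EC; move: (hessian u x j k) (laplacian u x) (n%:R : R) (K j k) => a b c d.
by ring.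
Qed.

Lemma ricci_conformal : ricci ht x = ricci h x
  - (n%:R - 2) *: (hessian u x - (du x)^T *m du x)
  - (laplacian u x + (n%:R - 2) * gradient_sqnorm u x) *: h x.
Proof.
have KT := metric_germ_sym mh Hx; have KU := metric_germ_unit mh Hx.
apply/matrixP => j k; rewrite ricciE.
have -> : \sum_i curvature (connection ht) i j x k i = \sum_i curvature (connection h) i j x k i +
    (- (n%:R - 2) * hessian u x j k - laplacian u x * K j k)
    + (n%:R - 2) * (du x 0 j * du x 0 k - gradient_sqnorm u x * K j k).
  rewrite -(conformal_quadratic (du x) KT KU j k) -shift_contraction -!big_split /=.
  by apply: eq_bigr => i _; rewrite curvature_conformal !mxE.
rewrite -ricciE.
exact: ricci_entry (rank1E (du x) (du x) j k).
Qed.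

(** The scalar curvature of the conformal metric carries a factor exp(-2u), which cancels that of
    the metric it multiplies; what remains is the trace of [ricci_conformal] with respect to [h]. *)
Lemma einstein_conformal : einstein ht x = einstein h x + (n%:R - 2) *:
  ((du x)^T *m du x - hessian u x + (laplacian u x + (n%:R - 3) / 2 * gradient_sqnorm u x) *: h x).
Proof.
have KT := metric_germ_sym mh Hx; have KU := metric_germ_unit mh Hx.
pose tr (A : 'M[R]_n) := \sum_i \sum_j invmx (h x) i j * A i j.
have trD A B : tr (A + B) = tr A + tr B.
  by rewrite /tr -big_split; apply: eq_bigr => i _; rewrite -big_split; apply: eq_bigr => j _; rewrite mxE mulrDr.
have trZ a A : tr (a *: A) = a * tr A.
  by rewrite /tr mulr_sumr; apply: eq_bigr => i _; rewrite mulr_sumr; apply: eq_bigr => j _; rewrite mxE mulrCA.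
have trB A B : tr (A - B) = tr A - tr B by rewrite trD -scaleN1r trZ mulN1r.
have invsym i j : invmx (h x) i j = invmx (h x) j i.
  by rewrite -[in LHS]KT -trmx_inv mxE.
have tr_h : tr (h x) = n%:R.
  rewrite /tr -[RHS](mxtrace1 R n) -(mulVmx KU); apply: eq_bigr => i _; rewrite [RHS]mxE.
  by apply: eq_bigr => j _; rewrite -[in X in _ * X]KT [(h x)^T _ _]mxE.
have tr_hess : tr (hessian u x) = laplacian u x.
  rewrite /tr /laplacian; apply: eq_bigr => i _; rewrite [RHS]mxE.
  by apply: eq_bigr => j _; rewrite mulrC invsym.
have tr_du : tr ((du x)^T *m du x) = gradient_sqnorm u x.
  rewrite /tr /gradient_sqnorm [RHS]mxE; apply: eq_bigr => j _.
  rewrite [(du x *m _) 0 j]mxE mulr_suml; apply: eq_bigr => i _.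
  rewrite rank1E [((du x)^T) j 0]mxE (invsym j i).
  by move: (invmx (h x) i j) (du x 0 i) (du x 0 j) => a q p; ring.
have sc : scalar_curvature ht x = (expR (2 * u x))^-1 * tr (ricci ht x).
  rewrite /tr mulr_sumr; apply: eq_bigr => i _; rewrite mulr_sumr; apply: eq_bigr => j _.
  rewrite mulrA; congr (_ * _); rewrite /conformal_metric invmxZ ?mxE//.
  by rewrite unitmxZ// unitfE gt_eqF// expR_gt0.
have e0 : expR (2 * u x) != 0 by rewrite gt_eqF// expR_gt0.
have sch : scalar_curvature h x = tr (ricci h x) by [].
rewrite /einstein sc sch ricci_conformal /conformal_metric scalerA.
have -> (t : R) : (expR (2 * u x))^-1 * t / 2 * expR (2 * u x) = t / 2 by field.
rewrite !trB !trZ !trB tr_h tr_hess tr_du.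
move: (tr (ricci h x)) (ricci h x) (hessian u x) ((du x)^T *m du x) (laplacian u x) (gradient_sqnorm u x) (n%:R : R) (h x).
by move=> a A B C d e f F; apply/matrixP => r s; rewrite !mxE; field.
Qed.

End Conformal.

(** * Local positivity *)

Section QuadraticForm.
Variables (R : realType) (n : nat).
Implicit Types (A : 'M[R]_n) (v : 'rV[R]_n).

Definition qform A v : R := (v *m A *m v^T) 0 0.

Lemma qformE A v : qform A v = \sum_i \sum_j v 0 i * A i j * v 0 j.
Proof.
rewrite /qform mxE exchange_big; apply: eq_bigr => j _; rewrite [v^T j 0]mxE.
by rewrite [(v *m A) 0 j]mxE mulr_suml.
Qed.

Lemma qformD A B v : qform (A + B) v = qform A v + qform B v.
Proof. by rewrite /qform mulmxDr mulmxDl mxE. Qed.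

Lemma qformZ a A v : qform (a *: A) v = a * qform A v.
Proof. by rewrite /qform -scalemxAr -scalemxAl mxE. Qed.

Lemma qformB A B v : qform (A - B) v = qform A v - qform B v.
Proof. by rewrite qformD -scaleN1r qformZ mulN1r. Qed.

Lemma qform_rank1 (w : 'rV[R]_n) v : qform (w^T *m w) v = ((w *m v^T) 0 0) ^+ 2.
Proof.
rewrite /qform mulmxA -mulmxA mxE big_ord1 expr2; congr (_ * _).
by rewrite -[in RHS](trmxK w) -trmx_mul [RHS]mxE.
Qed.

Lemma qform_scale A (a : R) v : qform A (a *: v) = a ^+ 2 * qform A v.
Proof.
rewrite /qform linearZ /= -!scalemxAl -scalemxAr scalerA mxE expr2.
by [].
Qed.

Lemma qform_norm_le A v (c : R) : (forall i j, `|A i j| <= c) ->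
  `|qform A v| <= n%:R * n%:R * c * `|v| ^+ 2.
Proof.
move=> Ac; rewrite qformE.
have -> : n%:R * n%:R * c * `|v| ^+ 2 = \sum_(i < n) \sum_(j < n) (`|v| * c * `|v|).
  rewrite !sumr_const !card_ord; have nat (t : R) : t *+ n *+ n = n%:R * n%:R * t.
    by rewrite -mulrA !mulr_natl.
  by rewrite nat expr2; move: (n%:R : R) `|v| => a b; ring.
rewrite (le_trans (ler_norm_sum _ _ _))// ler_sum// => i _.
rewrite (le_trans (ler_norm_sum _ _ _))// ler_sum// => j _.
rewrite !normrM !ler_pM ?mulr_ge0 ?coord_le_norm//.
Qed.

(** The minimum over the unit sphere of the sup norm, which is non-empty for [0 < n], extended by
    homogeneity. *)
Lemma qform_lower_bound A : (0 < n)%N -> (forall v, v != 0 -> 0 < qform A v) ->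
  exists2 c : R, 0 < c & forall v, c * `|v| ^+ 2 <= qform A v.
Proof.
move=> n0 pA.
pose Sph := [set v : 'rV[R]_n | `|v| = 1].
have cS : compact Sph.
  apply: bounded_closed_compact.
    exists 1; split; first exact: num_real.
    by move=> M M1 v /= ->; exact: ltW.
  have -> : Sph = (fun v : 'rV[R]_n => `|v|) @^-1` [set 1] by [].
  apply: (@closed_comp _ _ (fun v : 'rV[R]_n => `|v|)) => [v _|]; first exact: norm_continuous.
  exact: closed_eq.
have Sn : Sph !=set0.
  exists ('e_(Ordinal n0)); rewrite /Sph /=; apply/eqP; rewrite eq_le norm_delta_le /=.
  by have := coord_le_norm ('e_(Ordinal n0) : 'rV[R]_n) (Ordinal n0); rewrite mxE !eqxx normr1.
have cq : {within Sph, continuous (qform A)}.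
  apply: continuous_subspaceT => v.
  have -> : qform A = (fun w => \sum_i \sum_j w 0 i * A i j * w 0 j) by apply/funext => w; exact: qformE.
  apply: (@cvg_sum_fun R _ (nbhs v) (nbhs_filter v)) => i _.
  apply: (@cvg_sum_fun R _ (nbhs v) (nbhs_filter v)) => j _.
  by apply: cvgM; [apply: cvgM; [exact: coord_continuous|exact: cvg_cst]|exact: coord_continuous].
have [v0 v0S v0min] := EVT_min_rV Sn cS cq.
have v01 : `|v0| = 1 by move: v0S; rewrite inE.
exists (qform A v0).
  by apply: pA; rewrite -normr_gt0 v01.
move=> v; have [->|vn0] := eqVneq v 0.
  rewrite normr0 expr0n mulr0 qformE big1// => i _; rewrite big1// => j _.
  by rewrite mxE !mul0r.
have nv : 0 < `|v| by rewrite normr_gt0.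
have : qform A v0 <= qform A (`|v|^-1 *: v).
  by apply: v0min; rewrite inE /Sph /= normrZ normfV normr_id mulVf// gt_eqF.
by rewrite qform_scale exprVn ler_pdivlMl ?exprn_gt0// mulrC.
Qed.

End QuadraticForm.

Section Exponential.
Variables (R : realType) (n : nat).
Local Notation E := 'rV[R]_n.
Local Notation H := (halfspace R n).
Variables (h : E -> 'M[R]_n) (f : E -> R) (l : R) (x : E).
Hypotheses (Hx : H x) (mh : metric_germ x h) (sf : smooth_germ x f).

Local Notation u := (fun y => expR (l * f y)).
Local Notation df := (gradient_row f).

Lemma smooth_germ_scaled : smooth_germ x (fun y => l * f y).
Proof. by apply: smooth_germ_mul => //; exact: smooth_germ_cst. Qed.

Lemma smooth_germ_exp : smooth_germ x u.
Proof. exact: smooth_germ_expR smooth_germ_scaled. Qed.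

Lemma hpartial_exp i : hpartial i u x = l * u x * hpartial i f x.
Proof.
have sl : smooth_germ x (fun=> l) by exact: smooth_germ_cst.
rewrite hpartial_expR//; last exact: smooth_germ_scaled.
by rewrite hpartial_mul// hpartial_cst// mul0r add0r mulrCA mulrA.
Qed.

Lemma gradient_exp : gradient_row u x = (l * u x) *: df x.
Proof. by apply/rowP => k; rewrite !mxE hpartial_exp. Qed.

End Exponential.

Section ExponentialHessian.
Variables (R : realType) (n : nat).
Local Notation E := 'rV[R]_n.
Local Notation H := (halfspace R n).
Variables (h : E -> 'M[R]_n) (f : E -> R) (l : R) (x : E).
Hypotheses (Hx : H x) (mh : metric_germ x h) (sf : smooth_germ x f).

Local Notation u := (fun y => expR (l * f y)).
Local Notation df := (gradient_row f).

Lemma hessian_exp : hessian h u x =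
  (l * u x) *: hessian h f x + (l ^+ 2 * u x) *: ((df x)^T *m df x).
Proof.
have su := smooth_germ_exp l sf.
have slu : smooth_germ x (fun y => l * u y) by apply: smooth_germ_mul => //; exact: smooth_germ_cst.
have sd : smooth_mx x df by exact: smooth_gradient.
have nE : \forall y \near x, H y -> gradient_row u y = (l * u y) *: df y.
  apply: (@filterS _ _ (nbhs_filter x) _ _ _ (smooth_germ_near sf)) => y s Hy.
  exact: gradient_exp.
have D i : mxpartial i (gradient_row u) x =
    (l * (l * u x * df x 0 i)) *: df x + (l * u x) *: mxpartial i df x.
  have su' : smooth_mx x (gradient_row u) by exact: smooth_gradient.
  rewrite (mxpartial_eq Hx i su' nE) mxpartial_scale//; congr (_ *: _ + _).
  rewrite hpartial_mul//; last exact: smooth_germ_cst.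
  by rewrite hpartial_cst// mul0r add0r hpartial_exp// mxE.
apply/matrixP => i k; rewrite mxE D gradient_exp//.
rewrite [RHS]mxE [X in _ = X + _]mxE [X in _ = _ + X]mxE rank1E [hessian h f x i k]mxE.
have e (t s : R) (a b w : 'rV[R]_n) (C : 'M[R]_n) : (t *: a + s *: b - s *: w *m C) 0 k =
    t * a 0 k + s * (b - w *m C) 0 k.
  by rewrite -scalemxAl -addrA -scalerBr mxE [X in X + _]mxE [X in _ + X]mxE.
rewrite e addrC; congr (_ + _); move: (df x 0 i) (df x 0 k) (expR _) => a b c; ring.
Qed.

Lemma gradient_sqnorm_exp : gradient_sqnorm h u x = l ^+ 2 * (u x) ^+ 2 * gradient_sqnorm h f x.
Proof.
rewrite /gradient_sqnorm gradient_exp// -!scalemxAl linearZ /= -scalemxAr scalerA mxE.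
by rewrite -expr2 exprMn.
Qed.

Lemma laplacian_exp : laplacian h u x = l * u x * laplacian h f x + l ^+ 2 * u x * gradient_sqnorm h f x.
Proof.
have -> : gradient_sqnorm h f x = \sum_i ((df x)^T *m df x *m invmx (h x)) i i.
  rewrite /gradient_sqnorm mxE; apply: eq_bigr => i _.
  by rewrite -mulmxA rank1E [((df x)^T) i 0]mxE mulrC.
rewrite /laplacian hessian_exp !mulr_sumr -big_split; apply: eq_bigr => i _ /=.
by rewrite mulmxDl -!scalemxAl !mxE.
Qed.

Lemma qform_einstein_exp v :
  qform (einstein (conformal_metric h u) x) v = qform (einstein h x) v + (n%:R - 2) * (l * u x *
   (l * (u x - 1) * ((df x *m v^T) 0 0) ^+ 2 + (l * gradient_sqnorm h f x * qform (h x) v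
     + qform (laplacian h f x *: h x - hessian h f x) v)
     + (n%:R - 3) / 2 * (l * u x * gradient_sqnorm h f x * qform (h x) v))).
Proof.
have su := smooth_germ_exp l sf.
rewrite einstein_conformal// qformD qformZ; congr (_ + _ * _).
have sq (a : R) (d : 'rV[R]_n) : (a *: d)^T *m (a *: d) = a ^+ 2 *: (d^T *m d).
  by rewrite [(a *: d)^T]linearZ /= -scalemxAl -scalemxAr scalerA expr2.
rewrite gradient_exp// sq hessian_exp laplacian_exp gradient_sqnorm_exp.
rewrite !(qformB, qformD, qformZ) qform_rank1.
move: (qform (h x) v) (qform (hessian h f x) v) ((df x *m v^T) 0 0) (laplacian h f x)
  (gradient_sqnorm h f x) (expR (l * f x)) (n%:R : R) => a b c d e w m.
by field.
Qed.

End ExponentialHessian.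

Section SmoothCurvature.
Variables (R : realType) (n : nat).
Local Notation E := 'rV[R]_n.
Local Notation H := (halfspace R n).
Variables (h : E -> 'M[R]_n) (f : E -> R) (x : E).
Hypotheses (Hx : H x) (mh : metric_germ x h) (sf : smooth_germ x f).

Lemma smooth_invmetric : smooth_mx x (fun y => invmx (h y)).
Proof.
by case: mh => sh ph; apply: smooth_mx_inv => //; apply: filterS ph => y h1 /h1 [].
Qed.

Lemma smooth_ricci : smooth_mx x (ricci h).
Proof.
have sC := smooth_connection mh Hx.
move=> j k; under eq_fun do rewrite ricciE; apply: smooth_germ_sum => i _.
suff : smooth_mx x (curvature (connection h) i j) by apply.
apply: smooth_mx_add; [apply: smooth_mx_add; [apply: smooth_mx_add|]|].
- exact: smooth_mx_partial.
- by apply: smooth_mx_opp; exact: smooth_mx_partial.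
- exact: smooth_mx_mul.
- by apply: smooth_mx_opp; exact: smooth_mx_mul.
Qed.

Lemma smooth_einstein : smooth_mx x (einstein h).
Proof.
have [sh _] := mh; have sI := smooth_invmetric; have sR := smooth_ricci.
apply: smooth_mx_add => //; apply: smooth_mx_opp; apply: smooth_mx_scale => //.
apply: smooth_germ_mul; last exact: smooth_germ_cst.
apply: smooth_germ_sum => i _; apply: smooth_germ_sum => j _.
by apply: smooth_germ_mul; [exact: sI|exact: sR].
Qed.

Lemma smooth_hessian : smooth_mx x (hessian h f).
Proof.
have sd := smooth_gradient sf; have sC := smooth_connection mh Hx.
move=> i k; under eq_fun do rewrite mxE.
suff : smooth_mx x (fun y => mxpartial i (gradient_row f) y - gradient_row f y *m (connection h i y)^T) by apply.
apply: smooth_mx_add; first exact: smooth_mx_partial.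
by apply: smooth_mx_opp; apply: smooth_mx_mul => //; exact: smooth_mx_tr.
Qed.

Lemma smooth_laplacian : smooth_germ x (laplacian h f).
Proof.
apply: smooth_germ_sum => i _; have := smooth_mx_mul smooth_hessian smooth_invmetric.
exact.
Qed.

Lemma smooth_gradient_sqnorm : smooth_germ x (gradient_sqnorm h f).
Proof.
have sd := smooth_gradient sf.
exact: (smooth_mx_mul (smooth_mx_mul sd smooth_invmetric) (smooth_mx_tr sd)).
Qed.

End SmoothCurvature.

Section LocalPositivity.
Variables (R : realType) (n : nat).
Local Notation E := 'rV[R]_n.
Local Notation H := (halfspace R n).

Lemma smooth_mx_near_dist (x : E) p q (A : E -> 'M[R]_(p, q)) (e : R) : smooth_mx x A -> H x -> 0 < e ->
  \forall y \near x, H y -> forall i j, `|A x i j - A y i j| <= e.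
Proof.
move=> sA Hx e0.
have : \forall y \near x, forall i j, H y -> `|A x i j - A y i j| <= e.
  apply: (@filter_forall _ _ _ (nbhs x) (nbhs_filter x)) => i.
  apply: (@filter_forall _ _ _ (nbhs x) (nbhs_filter x)) => j.
  by move: (smooth_germ_cvg (sA i j) Hx) => /cvgrPdist_le /(_ e e0).
by apply: filterS => y hy Hy i j; exact: hy.
Qed.

Lemma qform_near_bounded (x : E) (A : E -> 'M[R]_n) : smooth_mx x A -> H x ->
  exists2 C : R, 0 < C & \forall y \near x, H y -> forall v, `|qform (A y) v| <= C * `|v| ^+ 2.
Proof.
move=> sA Hx.
pose c := 1 + \sum_i \sum_j `|A x i j|.
have c0 : 0 < c by rewrite ltr_pwDl// sumr_ge0// => i _; exact: sumr_ge0.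
exists (n%:R * n%:R * c + 1); first by rewrite ltr_wpDl ?mulr_ge0 ?ler0n ?(ltW c0).
apply: filterS (smooth_mx_near_dist sA Hx (ltr01 : 0 < 1 :> R)) => y hy Hy v.
rewrite mulrDl mul1r ler_wpDr ?exprn_ge0//; apply: qform_norm_le => i j.
rewrite -[A y i j](subrK (A x i j)) (le_trans (ler_normD _ _))// lerD//.
  by rewrite distrC; exact: hy.
rewrite (bigD1 i)//= (bigD1 j)//= -addrA lerDl addr_ge0//.
  exact: sumr_ge0.
by apply: sumr_ge0 => k _; exact: sumr_ge0.
Qed.

Lemma qform_near_lower_bound (x : E) (A : E -> 'M[R]_n) : (0 < n)%N -> smooth_mx x A -> H x ->
  (forall v, v != 0 -> 0 < qform (A x) v) ->
  exists2 c : R, 0 < c & \forall y \near x, H y -> forall v, c * `|v| ^+ 2 <= qform (A y) v.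
Proof.
move=> n0 sA Hx pA; have [c c0 cP] := qform_lower_bound n0 pA.
have N0 : 0 < n%:R :> R by rewrite ltr0n.
exists (c / 2); first by rewrite divr_gt0.
(* With n^2 entries off by at most this much, the form changes by at most half of its lower
   bound. *)
have e0 : 0 < c / (2 * (n%:R * n%:R)) by rewrite divr_gt0// !mulr_gt0.
apply: filterS (smooth_mx_near_dist sA Hx e0) => y hy Hy v.
have : `|qform (A x - A y) v| <= n%:R * n%:R * (c / (2 * (n%:R * n%:R))) * `|v| ^+ 2.
  by apply: qform_norm_le => i j; rewrite !mxE; exact: hy.
have -> : n%:R * n%:R * (c / (2 * (n%:R * n%:R))) = c / 2.
  by move: (n%:R : R) N0 => N N0; field; rewrite gt_eqF.
rewrite qformB => /ler_normlP [_ h2].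
move: (cP v) h2; move: (qform (A x) v) (qform (A y) v) (`|v| ^+ 2) => a b t.
by have -> : c / 2 * t = c * t / 2 by [rewrite mulrAC]; move: (c * t) => s; lra.
Qed.

Variables (h : E -> 'M[R]_n) (f : E -> R) (x : E).
Hypotheses (Hx : H x) (mh : metric_germ x h) (sf : smooth_germ x f).
Hypotheses (hn : (3 <= n)%N) (f0 : forall y, 0 < f y) (ph : forall v, v != 0 -> 0 < qform (h x) v).
Hypothesis df0 : gradient_row f x != 0.

Lemma gradient_sqnorm_gt0 : 0 < gradient_sqnorm h f x.
Proof.
have KT := metric_germ_sym mh Hx; have KU := metric_germ_unit mh Hx.
pose w := gradient_row f x *m invmx (h x).
have wK : w *m h x = gradient_row f x by rewrite mulmxKV.
have w0 : w != 0 by apply: contra_neq df0 => w0; rewrite -wK w0 mul0mx.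
have := ph w0; rewrite /qform /gradient_sqnorm wK.
have -> : gradient_row f x *m w^T = (w *m (gradient_row f x)^T)^T by rewrite [RHS]trmx_mul trmxK.
by rewrite mxE.
Qed.

(** For m = n - 2, a = (df v)^2, N = |df|^2, q = h(v, v) and t = |v|^2. The term l N q outweighs B
    and leaves (C + 1) t; the rest of the bracket is nonnegative as u, m >= 1, and the factor m l u
    >= 1 does no harm, so that E0 is outweighed with t to spare. *)
Lemma positivity_estimate (E0 B a q N c C D m u l t : R) :
  1 <= m -> 1 <= u -> 1 <= l -> 0 <= a -> 0 < c -> 0 < N -> 0 < C -> 0 < D -> 0 < t ->
  c * t <= q -> `|E0| <= C * t -> `|B| <= D * t -> D + C + 1 <= l * (N * c) ->
  0 < E0 + m * (l * u * (l * (u - 1) * a + (l * N * q + B) + (m - 1) / 2 * (l * u * N * q))).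
Proof.
move=> m1 u1 l1 a0 c0 N0 C0 D0 t0 cq /ler_normlP [e1 _] /ler_normlP [b1 _] lb.
have l0 : 0 < l by apply: lt_le_trans l1.
have u0 : 0 < u by apply: lt_le_trans u1.
have q0 : 0 < q by apply: lt_le_trans cq; exact: mulr_gt0.
set P := _ + _ + _.
have P1 : (C + 1) * t <= P.
  have x1 : 0 <= l * (u - 1) * a by rewrite !mulr_ge0 ?subr_ge0// ltW.
  have x2 : 0 <= (m - 1) / 2 * (l * u * N * q).
    by rewrite mulr_ge0 ?divr_ge0 ?subr_ge0// ltW// !mulr_gt0.
  have x3 : (D + C + 1) * t <= l * N * q.
    apply: (@le_trans _ _ (l * (N * c) * t)); first by rewrite ler_pM2r.
    by rewrite -!mulrA ler_pM2l// ler_pM2l.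
  have x4 : - (D * t) <= B by rewrite lerNl.
  have -> : (C + 1) * t = 0 + ((D + C + 1) * t + - (D * t)) + 0 by ring.
  by rewrite /P !lerD.
have P0 : 0 <= P by apply: le_trans P1; rewrite mulr_ge0 ?ltW// ltr_wpDl// ltW.
have x5 : P <= m * (l * u * P).
  rewrite mulrA ler_peMl// -[leLHS](mul1r 1) ler_pM// -[leLHS](mul1r 1) ler_pM//.
have x6 : - (C * t) <= E0 by rewrite lerNl.
apply: (@lt_le_trans _ _ t) => //.
have -> : t = - (C * t) + (C + 1) * t by ring.
by rewrite lerD// (le_trans P1).
Qed.

Lemma local_einstein_positive : exists l0 : R, \forall y \near x, H y -> forall l, l0 <= l ->
  forall v, v != 0 -> 0 < qform (einstein (conformal_metric h (fun z => expR (l * f z))) y) v.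
Proof.
have n0 : (0 < n)%N by exact: leq_trans hn.
have [sh _] := mh.
have [c c0 cP] := qform_near_lower_bound n0 sh Hx ph.
have [C C0 CP] := qform_near_bounded (smooth_einstein Hx mh) Hx.
have sB : smooth_mx x (fun y => laplacian h f y *: h y - hessian h f y).
  apply: smooth_mx_add; first by apply: smooth_mx_scale => //; exact: smooth_laplacian.
  by apply: smooth_mx_opp; exact: smooth_hessian.
have [D D0 DP] := qform_near_bounded sB Hx.
have N0 := gradient_sqnorm_gt0; set N := gradient_sqnorm h f x in N0.
have NP : \forall y \near x, H y -> N / 2 <= gradient_sqnorm h f y.
  have N20 : 0 < N / 2 by rewrite divr_gt0.
  move: (smooth_germ_cvg (smooth_gradient_sqnorm Hx mh sf) Hx) => /cvgrPdist_le /(_ _ N20).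
  apply: filterS => y; rewrite -/N ler_norml => /andP[_]; rewrite lerBlDr => hh.
  by move: hh; move: (gradient_sqnorm h f y) N {N0 N20} => g N' hh; lra.
(* The 1 secures l >= 1. The quotient is what [positivity_estimate] asks for, with N / 2 because
   near x the square |df|^2 is only known to stay above half its value at x. *)
exists (Num.max 1 ((D + C + 1) / (N / 2 * c))).
have I P Q (nP : nbhs x P) (nQ : nbhs x Q) := @filterI _ _ (nbhs_filter x) _ _ nP nQ.
apply: (@filterS _ _ (nbhs_filter x) _ _ _ (I _ _ (I _ _ cP CP) (I _ _ (I _ _ DP NP)
  (I _ _ (metric_germ_near mh) (smooth_germ_near sf))))).
move=> y [[cy Cy] [[Dy Ny] [my sy]]] Hy l; rewrite ge_max => /andP[l1 l2] v v0.
rewrite qform_einstein_exp//.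
have -> : n%:R - 3 = n%:R - 2 - 1 :> R by ring.
have l0 : 0 < l by apply: lt_le_trans l1.
have Ny0 : 0 < gradient_sqnorm h f y by apply: lt_le_trans (Ny Hy); rewrite divr_gt0.
apply: (@positivity_estimate _ _ _ _ _ c C D _ _ _ (`|v| ^+ 2)) => //.
- by rewrite lerBrDr -(natrD _ 1 2) ler_nat.
- by rewrite -[leLHS]expR0 ler_expR mulr_ge0 ?ltW.
- exact: sqr_ge0.
- by rewrite exprn_gt0// normr_gt0.
- exact: cy.
- exact: Cy.
- exact: Dy.
- rewrite -ler_pdivrMr; last exact: mulr_gt0.
  apply: le_trans l2; rewrite ler_pM2l; last by rewrite !addr_gt0.
  by rewrite lef_pV2 ?posrE ?mulr_gt0 ?divr_gt0// ler_pM2r//; exact: Ny.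
Qed.

End LocalPositivity.

(** * Charts *)

Section Charts.
Variables (R : realType) (n : nat) (M : manifold R n).
Local Notation H := (halfspace R n).
Local Notation dom a := (chart_dom (atlas (m := M) a)).
Local Notation phi a := (chart_coord (atlas (m := M) a)).
Local Notation par a := (chart_param (atlas (m := M) a)).
Implicit Types (a b : chart_index M) (p q : M) (u : M -> R).

Lemma chart_imageE a : exists2 W : set 'rV[R]_n, open W & chart_image a = W `&` H.
Proof. exact: chart_coord_open. Qed.

Lemma chart_coord_halfspace a p : dom a p -> H (phi a p).
Proof.
move=> ap; have [W _ E] := chart_imageE a.
have : chart_image a (phi a p) by exists p.
by rewrite E => -[].
Qed.

Lemma chart_near a p (P : set 'rV[R]_n) : dom a p -> nbhs (phi a p) P ->
  \forall q \near p, dom a q /\ P (phi a q).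
Proof.
move=> ap nP; have od := chart_dom_open (atlas a).
have nd : nbhs p (dom a) by apply: open_nbhs_nbhs.
have := (subspace_continuousP (dom a) (phi a)).1 (chart_coord_continuous (c := atlas a)) p ap.
move=> /(_ P nP) nP0; have nP' : nbhs p [set q | dom a q -> P (phi a q)] by exact: nP0.
by apply: filterS2 nd nP' => q dq h; split => //; exact: h.
Qed.

Lemma image_near a p : dom a p -> \forall y \near phi a p, H y -> chart_image a y.
Proof.
move=> ap; have [W oW E] := chart_imageE a.
have : chart_image a (phi a p) by exists p.
rewrite E => -[Wp _]; apply: filterS (open_nbhs_nbhs (conj oW Wp)) => y Wy Hy.
by split.
Qed.

Lemma chart_image_param a y : chart_image a y -> dom a (par a y) /\ phi a (par a y) = y.
Proof. by move=> [q dq <-]; rewrite chart_coordK. Qed.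

Lemma param_near a p (U : set M) : dom a p -> nbhs p U ->
  \forall y \near phi a p, H y -> [/\ dom a (par a y), phi a (par a y) = y & U (par a y)].
Proof.
move=> ap nU.
have ip : chart_image a (phi a p) by exists p.
have := (subspace_continuousP (chart_image a) (par a)).1 (chart_param_continuous (c := atlas a)) _ ip.
rewrite chart_coordK// => /(_ U nU) nP0.
have nP : nbhs (phi a p) [set y | chart_image a y -> U (par a y)] by exact: nP0.
apply: filterS2 nP (image_near ap) => y h1 h2 Hy.
by have [d1 d2] := chart_image_param (h2 Hy); split => //; exact: h1 (h2 Hy).
Qed.

Definition transition a b y := phi b (par a y).

Section Transition.
Variables (a b : chart_index M) (p : M).
Hypotheses (ap : dom a p) (bp : dom b p).
Let x := phi a p.

Lemma transitionE : transition a b x = phi b p.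
Proof. by rewrite /transition chart_coordK. Qed.

Lemma transition_near : \forall y \near x, H y ->
  [/\ dom a (par a y), dom b (par a y), phi a (par a y) = y & par b (transition a b y) = par a y].
Proof.
have nb : nbhs p (dom b) by apply: open_nbhs_nbhs; split => //; exact: chart_dom_open.
apply: filterS (param_near ap nb) => y h Hy; have [d1 d2 d3] := h Hy.
by split => //; rewrite /transition chart_coordK.
Qed.

Lemma transition_halfspace : \forall y \near x, H y -> H (transition a b y).
Proof.
apply: filterS transition_near => y h Hy; have [_ d2 _ _] := h Hy.
exact: chart_coord_halfspace.
Qed.

(** Compatibility of the atlas speaks of the overlap only, but near [x] the overlap contains every
    half-space point, as a germ requires. *)
Lemma smooth_transition k : smooth_germ x (fun y => transition a b y 0 k).
Proof.
have [V [F [oV Vx CF Ff]]] : exists V F, [/\ open V, V x, forall k, Ck k V F &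
    forall y, V y -> (phi a @` (dom a `&` dom b)) y -> F y = transition a b y 0 k].
  by apply: (@atlas_compatible R n M a b k); exists p.
have nV := open_nbhs_nbhs (conj oV Vx).
apply: (@smooth_germ_interior _ _ _ _ F _ (filterI nV transition_near)).
  by move=> j; apply: Ck_subset (CF j) => y /interior_subset [].
move=> y [Vy h] Hy; have [d1 d2 d3 _] := h Hy.
by apply: Ff => //; exists (par a y).
Qed.

Lemma germ_transfer u : smooth_germ (phi b p) (u \o par b) -> smooth_germ x (u \o par a).
Proof.
move=> su; rewrite -transitionE in su.
apply: smooth_germ_eq (smooth_germ_comp smooth_transition transition_halfspace su (chart_coord_halfspace ap)).
by apply: filterS transition_near => y h Hy; have [_ _ _ /= ->] := h Hy.
Qed.

Lemma hpartial_transfer u i : smooth_germ (phi b p) (u \o par b) ->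
  hpartial i (u \o par a) x =
  \sum_j hpartial i (fun y => transition a b y 0 j) x * hpartial j (u \o par b) (phi b p).
Proof.
move=> su; have Hx := chart_coord_halfspace ap.
rewrite (hpartial_germ_eq i (germ_transfer su) Hx (g := fun y => (u \o par b) (transition a b y))).
  rewrite -transitionE in su *.
  exact: (hpartial_chain smooth_transition transition_halfspace su Hx).
by apply: filterS transition_near => y h Hy; have [_ _ _ /= ->] := h Hy.
Qed.

End Transition.

Definition smooth_at u p : Prop := exists2 a, dom a p & smooth_germ (phi a p) (u \o par a).

(** For [u] smooth at [p] the choice of chart is immaterial, by [critical_chart]. At a boundary
    point the one-sided normal derivative has to vanish as well. *)
Definition critical u p : Prop :=
  exists2 a, dom a p & forall i, hpartial i (u \o par a) (phi a p) = 0.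

Lemma smooth_at_germ u p a : smooth_at u p -> dom a p -> smooth_germ (phi a p) (u \o par a).
Proof. by move=> [b bp su] ap; exact: (germ_transfer ap bp su). Qed.

Lemma smoothP u : smooth u <-> forall p, smooth_at u p.
Proof.
split=> [su p|su a].
  have [a ap] := atlas_cover p; exists a => //.
  have [W oW E] := chart_imageE a.
  by apply: (smooth_on_germ (u \o par a) oW E).1; [exact: su|exists p].
have [W oW E] := chart_imageE a.
apply/(smooth_on_germ _ oW E) => _ [p ap <-].
exact: smooth_at_germ.
Qed.

Lemma critical_chart u p a : smooth_at u p -> critical u p -> dom a p ->
  forall i, hpartial i (u \o par a) (phi a p) = 0.
Proof.
move=> su [b bp cu] ap i; rewrite (hpartial_transfer ap bp i (smooth_at_germ su bp)).
by rewrite big1// => j _; rewrite cu mulr0.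
Qed.

Lemma smooth_at_eq u w p : (\forall q \near p, u q = w q) -> smooth_at u p -> smooth_at w p.
Proof.
move=> uw [a ap su]; exists a => //; apply: smooth_germ_eq su.
by apply: filterS (param_near ap uw) => y h Hy; have [_ _] := h Hy.
Qed.

Lemma critical_eq u w p : smooth_at u p -> (\forall q \near p, u q = w q) -> critical w p -> critical u p.
Proof.
move=> su uw cw; have wu : \forall q \near p, w q = u q by apply: filterS uw.
have [a ap] := atlas_cover p; exists a => // i.
have sw := smooth_at_eq uw su.
rewrite (hpartial_germ_eq i (smooth_at_germ su ap) (chart_coord_halfspace ap) (g := w \o par a)).
  exact: (critical_chart sw cw ap i).
by apply: filterS (param_near ap uw) => y h Hy; have [_ _] := h Hy.
Qed.

Section Tensor.
Variable g : metric M.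

Lemma metric_positive_unit (A : 'M[R]_n) : (forall v : 'rV[R]_n, v != 0 -> 0 < (v *m A *m v^T) 0 0) -> A \in unitmx.
Proof.
move=> pA; rewrite unitmxE unitfE; apply/det0P => -[v v0 vA].
by have := pA v v0; rewrite vA mul0mx mxE ltxx.
Qed.

Lemma metric_chart_germ a p : dom a p -> metric_germ (phi a p) (metric_components g a).
Proof.
move=> ap; have [W oW E] := chart_imageE a; split.
  move=> i j; apply: (smooth_on_germ _ oW E).1; last by exists p.
  exact: metric_smooth.
apply: filterS (image_near ap) => y h /h iy; split; first exact: metric_symmetric.
by apply: metric_positive_unit => v v0; exact: (@metric_positive _ _ _ g a y iy v v0).
Qed.

Lemma conformal_chart_germ u a p : smooth_at u p -> dom a p -> metric_germ (phi a p) (conformal u g a).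
Proof. by move=> su ap; apply: metric_germ_conformal; [exact: metric_chart_germ|exact: smooth_at_germ]. Qed.

Lemma conformal_change_germ u a b p : smooth_at u p -> dom a p -> dom b p ->
  change_germ (transition a b) (conformal u g a) (conformal u g b) (phi a p).
Proof.
move=> su ap bp; split.
- exact: smooth_transition.
- exact: transition_halfspace.
- exact: conformal_chart_germ.
- by rewrite transitionE//; exact: conformal_chart_germ.
apply: filterS (transition_near ap bp) => y h Hy; have [d1 d2 d3 d4] := h Hy.
have := @metric_tensor _ _ _ g a b (par a y) d1 d2; rewrite d3 => E.
rewrite /conformal d4 E -/(transition a b y) -scalemxAr -scalemxAl.
by [].
Qed.

Lemma einstein_positive_transfer u a b p : smooth_at u p -> dom a p -> dom b p ->
  (forall v, v != 0 -> 0 < qform (einstein (conformal u g b) (phi b p)) v) ->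
  (forall v, v != 0 -> 0 < qform (einstein (conformal u g a) (phi a p)) v).
Proof.
move=> su ap bp pos v v0.
have cg := conformal_change_germ su ap bp; have Hx := chart_coord_halfspace ap.
have UJ := change_unit Hx cg.
rewrite (einstein_change Hx cg) transitionE//.
have : 0 < qform (einstein (conformal u g b) (phi b p)) (v *m hjacobian (transition a b) (phi a p)).
  by apply: pos; apply: contra_neq v0 => v0; rewrite -[v](mulmxK UJ) v0 mul0mx.
by rewrite /qform trmx_mul !mulmxA.
Qed.

End Tensor.

End Charts.

(** * From local positivity to all of M *)

Section Conclusion.
Variables (R : realType) (n : nat) (M : manifold R n) (g : metric M).
Hypotheses (hn : (3 <= n)%N) (cM : compact [set: M]).
Local Notation H := (halfspace R n).
Local Notation dom a := (chart_dom (atlas (m := M) a)).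
Local Notation phi a := (chart_coord (atlas (m := M) a)).
Local Notation par a := (chart_param (atlas (m := M) a)).

Lemma smooth_at_expR (l : R) (f : M -> R) p : smooth_at f p -> smooth_at (fun q => expR (l * f q)) p.
Proof.
move=> [a ap sf]; exists a => //; apply: smooth_germ_expR.
by apply: smooth_germ_mul => //; exact: smooth_germ_cst.
Qed.

Lemma einstein_positive_of_noncritical (f : M -> R) : smooth f -> (forall p, ~ critical f p) ->
  (forall p, 0 < f p) -> exists u : M -> R, smooth u /\ positive_definite2 (einstein_tensor (conformal u g)).
Proof.
move=> /smoothP sf ncf f0.
pose u (l : R) q := expR (l * f q).
(* Quantifying over all l >= l0 lets the larger of two bounds serve a union. All charts at [q] are
   reached from one of them by [einstein_positive_transfer]. *)
pose P U := exists l0 : R, forall q, U q -> forall l, l0 <= l -> forall a, dom a q ->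
  forall v, v != 0 -> 0 < qform (einstein (conformal (u l) g a) (phi a q)) v.
have [l0 lP] : P setT.
  apply: (compact_ideal cM).
  - by exists 0.
  - move=> A B [a aP] [b bP]; exists (Num.max a b) => q [Aq|Bq] l; rewrite ge_max => /andP[la lb].
      exact: aP.
    exact: bP.
  - by move=> A B AB [b bP]; exists b => q /AB; exact: bP.
  move=> p _; have [a ap] := atlas_cover p.
  have Hx := chart_coord_halfspace ap.
  have sfa := smooth_at_germ (sf p) ap.
  have df0 : gradient_row (f \o par a) (phi a p) != 0.
    apply/eqP => /rowP df0; apply: (ncf p); exists a => // i.
    by have := df0 i; rewrite !mxE.
  have pg v : v != 0 -> 0 < qform (metric_components g a (phi a p)) v.
    by apply: (@metric_positive _ _ _ g a (phi a p)); exists p.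
  have [l0 lP] := local_einstein_positive Hx (metric_chart_germ g ap) sfa hn (fun y => f0 (par a y)) pg df0.
  exists [set q | dom a q /\ (H (phi a q) -> forall l, l0 <= l -> forall v, v != 0 ->
     0 < qform (einstein (conformal (u l) g a) (phi a q)) v)].
    exact: (chart_near ap lP).
  exists l0 => q [aq qP] l ll b bq.
  apply: (einstein_positive_transfer (smooth_at_expR l (sf q)) bq aq).
  exact: qP (chart_coord_halfspace aq) l ll.
exists (u l0); split.
  by apply/smoothP => p; exact: smooth_at_expR.
move=> a x [q aq <-] v v0.
exact: (lP q I l0 (lexx _) a aq v v0).
Qed.

Lemma critical_expR (f : M -> R) p : smooth f -> critical (fun q => expR (f q)) p -> critical f p.
Proof.
move=> /smoothP sf [a ap ca]; exists a => // i.
have := ca i; rewrite (hpartial_expR i (smooth_at_germ (sf p) ap) (chart_coord_halfspace ap)).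
by move/eqP; rewrite mulf_eq0 gt_eqF ?expR_gt0//= => /eqP.
Qed.

End Conclusion.

(** * Removing critical points *)

(** The Lipschitz bound holds for all pairs of points, which is what makes x + b(x) d injective for
    short d. *)
Lemma lipschitz_bump_exists (R : realType) n (c : 'rV[R]_n) (r : R) : 0 < r ->
  exists (b : 'rV[R]_n -> R) (d L : R),
  [/\ 0 < d, 0 < L, forall k, Ck k setT b & forall x, 0 <= b x <= 1] /\
  [/\ forall x, `|x - c| <= d -> b x = 1, forall x, r <= `|x - c| -> b x = 0,
     forall x i, `|x - c| <= r -> `|'D_'e_i b x| <= L &
     forall x y, `|b x - b y| <= L * `|x - y|].
Proof.
move=> r0; have [b [d [d0 Cb b01 b1 b0]]] := bump_exists c r0.
have [L L0 LP] := @bounded_family R n _ _ (fun i => 'D_'e_i b) (@compact_cube R n c (2 * r))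
  (fun i x _ => Ck_continuous (Ck_derive i (Cb 1)) (I : setT x)).
(* n L comes from the mean value expansion between points at most r apart and the extra L bounds the
   partials themselves; 1/r serves points further apart, as b varies by at most 1. *)
pose L1 := Num.max (n%:R * L + L) r^-1.
have L10 : 0 < L1 by rewrite lt_max invr_gt0 r0 orbT.
have LL1 : L <= L1 by rewrite le_max lerDr mulr_ge0// ltW.
have near_case x y : `|x - c| <= r -> `|b x - b y| <= L1 * `|x - y|.
  move=> xr; have [xy|xy] := leP `|y - x| r; last first.
    apply: (@le_trans _ _ 1).
      have /andP[p1 p2] := b01 x; have /andP[p3 p4] := b01 y.
      by rewrite ler_norml lerBrDr lerBlDr; apply/andP; split; lra.
    apply: (@le_trans _ _ (r^-1 * r)); first by rewrite mulVf// gt_eqF.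
    by rewrite ler_pM ?invr_ge0 ?le_max ?lexx ?orbT ?ltW// distrC.
  have [|xi h1 h2] := @mean_value R n b x y.
    by move=> z j _; apply: Ck_derivable (Cb 1) _.
  rewrite distrC h2 (le_trans (ler_norm_sum _ _ _))//.
  apply: (@le_trans _ _ (\sum_(i < n) (`|x - y| * L))).
    apply: ler_sum => i _; rewrite normrM ler_pM//.
      by rewrite distrC; have := coord_le_norm (x - y) i; rewrite !mxE.
    apply: LP; rewrite /= -(subrK x (xi i)) -addrA (le_trans (ler_normD _ _))//.
    by rewrite mulr_natl mulr2n lerD// (le_trans (h1 i)).
  rewrite sumr_const card_ord -mulr_natl mulrCA mulrC ler_wpM2r// le_max.
  by rewrite lerDl (ltW L0).
exists b, d, L1; split; split => //.
- move=> x i xr; rewrite (le_trans _ LL1)//; apply: LP.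
  by rewrite /= (le_trans xr)// ler_peMl ?ler1n// ltW.
move=> x y; have [xr|xr] := leP `|x - c| r; first exact: near_case.
have [yr|yr] := leP `|y - c| r; first by rewrite distrC [`|x - y|]distrC; exact: near_case.
by rewrite (b0 x (ltW xr)) (b0 y (ltW yr)) subrr normr0 mulr_ge0 ?(ltW L10).
Qed.

Lemma closed_halfspace (R : realType) n : closed (halfspace R n).
Proof.
have -> : halfspace R n = \bigcap_(k in [set k : 'I_n | k = 0%N :> nat])
    (fun x : 'rV[R]_n => x 0 k) @^-1` [set t | 0 <= t].
  by apply/seteqP; split => x h k /h.
apply: closed_bigI => k _; apply: (@closed_comp _ _ (fun x : 'rV[R]_n => x 0 k)).
  by move=> x _; exact: coord_continuous.
exact: closed_ge.
Qed.

Lemma compact_cube_halfspace (R : realType) n (c : 'rV[R]_n) (r : R) :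
  compact ([set x | `|x - c| <= r] `&` halfspace R n).
Proof.
apply: (subclosed_compact _ (@compact_cube R n c r)); last by move=> x [].
by apply: closedI; [apply: compact_closed; [exact: norm_hausdorff|exact: compact_cube]|exact: closed_halfspace].
Qed.

Section Push.
Variables (R : realType) (n : nat) (M : manifold R n).
Local Notation H := (halfspace R n).
Local Notation dom a := (chart_dom (atlas (m := M) a)).
Local Notation phi a := (chart_coord (atlas (m := M) a)).
Local Notation par a := (chart_param (atlas (m := M) a)).
Variables (a : chart_index M) (c : 'rV[R]_n) (r : R).
Hypotheses (r0 : 0 < r) (image_r : forall x, `|x - c| <= 2 * r -> H x -> chart_image a x).

(** What composition with [psi] needs in order not to increase the number of critical points. *)
Definition pullback_map (psi : M -> M) : Prop :=
  [/\ injective psi, forall f, smooth f -> smooth (f \o psi) &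
    forall f z, smooth f -> critical (f \o psi) z -> critical f (psi z)].

(** The image of a compact set in a Hausdorff space. Functions vanishing and maps equal to the
    identity off this set can therefore be extended from the chart to M and stay smooth. *)
Lemma closed_core : closed [set p | dom a p /\ `|phi a p - c| <= r].
Proof.
have sub : [set x | `|x - c| <= r] `&` H `<=` chart_image a.
  move=> x [xr Hx]; apply: image_r => //; rewrite (le_trans xr)//.
  by rewrite ler_peMl ?ler1n// ltW.
have -> : [set p | dom a p /\ `|phi a p - c| <= r] = par a @` ([set x | `|x - c| <= r] `&` H).
  apply/seteqP; split=> [p [ap pr]|_ [x xH <-]].
    by exists (phi a p); [split => //; exact: chart_coord_halfspace|exact: chart_coordK].
  by have [d1 d2] := chart_image_param (sub _ xH); split => //; rewrite d2; case: xH.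
apply: compact_closed; first exact: points_hausdorff.
apply: continuous_compact.
  by apply: continuous_subspaceW sub _; exact: chart_param_continuous.
exact: compact_cube_halfspace.
Qed.

Lemma push_exists : exists (rho delta : R), [/\ 0 < rho, 0 < delta &
  forall d : 'rV[R]_n, `|d| <= delta ->
    (forall x t, `|x - c| <= r -> H x -> 0 <= t <= 1 -> H (x + t *: d)) ->
  exists psi : M -> M, [/\ pullback_map psi, forall q, ~ dom a q -> psi q = q &
    forall q, dom a q -> dom a (psi q) /\ exists t, [/\ phi a (psi q) = phi a q + t *: d, 0 <= t <= 1 &
      `|phi a q - c| <= rho -> t = 1]]].
Proof.
have [b [rho [L [[rho0 L0 Cb b01] [b1 b0 bD bL]]]]] := lipschitz_bump_exists c r0.
(* The bound r keeps [T] inside the cube of radius 2r. The other makes L |d| and (n + 1) L |d| at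
   most 1/2, for injectivity and for the bound on theta. *)
pose delta := Num.min r (2 * (n.+1%:R * L))^-1.
have nL0 : 0 < 2 * (n.+1%:R * L) by rewrite !mulr_gt0.
exists rho, delta; split => //; first by rewrite lt_min r0 invr_gt0.
move=> d; rewrite le_min => /andP[dr dL] Hd.
have dL2 : n.+1%:R * L * `|d| <= 2^-1.
  rewrite -ler_pdivlMl ?mulr_gt0// (le_trans dL)// invfM mulrC.
  by rewrite lexx.
have dL1 : L * `|d| <= 2^-1.
  apply: le_trans dL2; rewrite -mulrA ler_peMl ?ler1n// mulr_ge0// ltW//.
(* If the gradient of f \o T vanishes, then that of f at T x is minus the
   gradient of b times the derivative s of f along d; pairing this with d gives
   s = - theta * s with |theta| <= 1/2, whence s = 0. *)
pose T x := x + b x *: d.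
have Tin x : chart_image a x -> chart_image a (T x).
  move=> ix; have [xr|xr] := leP `|x - c| r; last by rewrite /T (b0 x (ltW xr)) scale0r addr0.
  have Hx : H x by move: ix => [q aq <-]; exact: chart_coord_halfspace.
  apply: image_r; last exact: Hd.
  rewrite /T addrAC (le_trans (ler_normD _ _))// mulr_natl mulr2n lerD// normrZ.
  rewrite (le_trans _ dr)// ler_piMl//; have /andP[p1 p2] := b01 x.
  by rewrite ger0_norm.
have Tinj x y : T x = T y -> x = y.
  move=> E; have xy : x - y = (b y - b x) *: d.
    rewrite scalerBl; apply/eqP; rewrite subr_eq addrAC -subr_eq opprK eq_sym.
    by rewrite addrC -/(T y) -E /T addrC.
  have h : `|x - y| <= 2^-1 * `|x - y|.
    rewrite {1}xy normrZ (le_trans (ler_wpM2r _ (bL y x)))// distrC mulrAC.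
    by rewrite ler_wpM2r.
  apply/eqP; rewrite -subr_eq0 -normr_le0; move: h; move: (`|x - y|) => t h; lra.
(* Since [T] is the identity beyond distance r, [psi] is the identity off the closed core, also
   across the edge of the chart domain. *)
pose psi p := if pselect (dom a p) then par a (T (phi a p)) else p.
have psiE p : dom a p -> psi p = par a (T (phi a p)) by rewrite /psi; case: pselect.
have psiN p : ~ dom a p -> psi p = p by rewrite /psi; case: pselect.
have inP p : dom a p -> chart_image a (phi a p) by move=> ap; exists p.
have psi_dom p : dom a p -> dom a (psi p) /\ phi a (psi p) = T (phi a p).
  by move=> ap; rewrite psiE//; apply: chart_image_param; apply: Tin; exact: inP.
have psi_id p : ~ (dom a p /\ `|phi a p - c| <= r) -> psi p = p.
  move=> np; have [ap|/psiN//] := pselect (dom a p).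
  rewrite psiE// /T b0 ?scale0r ?addr0 ?chart_coordK//.
  by rewrite leNgt; apply/negP => h; apply: np; split => //; exact: ltW.
have psi_near p : ~ (dom a p /\ `|phi a p - c| <= r) -> \forall q \near p, psi q = q.
  move=> np; have : open (~` [set p | dom a p /\ `|phi a p - c| <= r]).
    by apply: closed_openC; exact: closed_core.
  move=> op; apply: filterS (open_nbhs_nbhs (conj op (np : (~` _) p))) => q.
  exact: psi_id.
have sT x k : smooth_germ x (fun y => T y 0 k).
  have -> : (fun y => T y 0 k) = (fun y => y 0 k + b y * d 0 k) by apply/funext => y; rewrite !mxE.
  apply: smooth_germ_add; first exact: smooth_germ_coord.
  by apply: smooth_germ_mul; [exact: smooth_germ_Ck|exact: smooth_germ_cst].
have HT (x : 'rV[R]_n) : \forall y \near x, H y -> H (T y).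
  apply: (@nearW _ (nbhs x) _ (nbhs_filter x)) => y Hy; have [yr|yr] := leP `|y - c| r; first exact: Hd.
  by rewrite /T (b0 y (ltW yr)) scale0r addr0.
have rep (f : M -> R) p : dom a p -> \forall y \near phi a p, H y ->
    ((f \o par a) \o T) y = ((f \o psi) \o par a) y.
  move=> ap; apply: filterS (image_near ap) => y h Hy.
  have [d1 d2] := chart_image_param (h Hy).
  by rewrite /= psiE// d2.
have sf_T (f : M -> R) p : smooth f -> dom a p -> smooth_germ (T (phi a p)) (f \o par a).
  move=> /smoothP sf ap; have [d1 d2] := psi_dom p ap.
  by rewrite -d2; exact: smooth_at_germ.
have jac x i j : H x -> hpartial i (fun y => T y 0 j) x = (i == j)%:R + 'D_'e_i b x * d 0 j.
  move=> Hx.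
  have -> : (fun y => T y 0 j) = (fun y => y 0 j + b y * d 0 j) by apply/funext => y; rewrite !mxE.
  have sb : smooth_germ x b by exact: smooth_germ_Ck.
  have sd : smooth_germ x (fun=> d 0 j) by exact: smooth_germ_cst.
  rewrite hpartial_add ?hpartial_coord//; [|exact: smooth_germ_coord|exact: smooth_germ_mul].
  rewrite hpartial_mul// hpartial_cst// mulr0 addr0.
  rewrite (@hpartial_extension R n i b b setT x)//; first exact: openT.
  exact: Ck_derivable (Cb 1) _.
have smooth_psi (f : M -> R) : smooth f -> smooth (f \o psi).
  move=> sf; apply/smoothP => p.
  have [[ap pr]|np] := pselect (dom a p /\ `|phi a p - c| <= r); last first.
    apply: (@smooth_at_eq _ _ _ f); last by move/smoothP : sf; apply.
    by apply: filterS (psi_near p np) => q /= ->.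
  exists a => //; apply: smooth_germ_eq (rep f p ap) _.
  by apply: smooth_germ_comp => //; [exact: sf_T|exact: chart_coord_halfspace].
exists psi; split => //; last first.
  move=> q aq; have [d1 d2] := psi_dom q aq; split => //.
  exists (b (phi a q)); split => //; exact: b1.
split.
- move=> p q E.
  have [ap|np] := pselect (dom a p); have [aq|nq] := pselect (dom a q).
  + have [_ e1] := psi_dom p ap; have [_ e2] := psi_dom q aq.
    rewrite -(chart_coordK ap) -(chart_coordK aq); congr (par a _).
    by apply: Tinj; rewrite -e1 -e2 E.
  + by case: (nq); rewrite -(psiN q nq) -E; case: (psi_dom p ap).
  + by case: (np); rewrite -(psiN p np) E; case: (psi_dom q aq).
  + by rewrite -(psiN p np) -(psiN q nq).
- exact: smooth_psi.
move=> f z sf cz.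
have [[az zr]|nz] := pselect (dom a z /\ `|phi a z - c| <= r); last first.
  rewrite psi_id//; apply: critical_eq cz; first by move/smoothP : sf; apply.
  by apply: filterS (psi_near z nz) => q /= ->.
have [d1 d2] := psi_dom z az; exists a => // i0; rewrite d2.
have Hz := chart_coord_halfspace az.
pose gr j := hpartial j (f \o par a) (T (phi a z)).
have sgT : smooth_germ (phi a z) ((f \o par a) \o T).
  by apply: smooth_germ_comp => //; exact: sf_T.
pose s := \sum_j d 0 j * gr j.
have grE i : gr i = - 'D_'e_i b (phi a z) * s.
  have := critical_chart ((smoothP _).1 (smooth_psi f sf) z) cz az i.
  rewrite -(hpartial_germ_eq i sgT Hz (rep f z az)) (hpartial_chain (sT _) (HT _) (sf_T f z sf az) Hz).
  under eq_bigr do rewrite jac// mulrDl.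
  rewrite big_split /=.
  have -> : \sum_j (i == j)%:R * hpartial j (f \o par a) (T (phi a z)) = gr i.
    rewrite (bigD1 i)//= eqxx mul1r big1 ?addr0// => j /negPf h.
    by rewrite eq_sym h mul0r.
  have -> : \sum_j 'D_'e_i b (phi a z) * d 0 j * hpartial j (f \o par a) (T (phi a z)) =
      'D_'e_i b (phi a z) * s by rewrite mulr_sumr; apply: eq_bigr => j _; rewrite mulrA.
  by move/eqP; rewrite addr_eq0 => /eqP ->; rewrite mulNr.
pose th := \sum_j d 0 j * 'D_'e_j b (phi a z).
have sE : s = - th * s.
  rewrite {1}/s /th mulNr mulr_suml -sumrN; apply: eq_bigr => j _.
  by rewrite grE mulNr mulrN mulrA.
have thl : `|th| <= 2^-1.
  apply: le_trans dL2; rewrite (le_trans (ler_norm_sum _ _ _))//.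
  apply: (@le_trans _ _ (\sum_(j < n) (`|d| * L))).
    by apply: ler_sum => j _; rewrite normrM ler_pM// ?coord_le_norm// bD.
  rewrite sumr_const card_ord -[leLHS]mulr_natl -[leRHS]mulrA [`|d| * L]mulrC ler_wpM2r ?ler_nat//.
  by rewrite mulr_ge0// ltW.
have s0 : s = 0.
  have : s * (1 + th) = 0 by rewrite mulrDr mulr1 [s * th]mulrC {1}sE mulNr addNr.
  move/eqP; rewrite mulf_eq0 => /orP[/eqP//|/eqP th1].
  by move: thl; rewrite ler_norml => /andP[h1 h2]; exfalso; move: th1 h1; clear; move: th => t th1 h1; lra.
by have := grE i0; rewrite s0 mulr0.
Qed.

End Push.

Section Removal.
Variables (R : realType) (n : nat) (M : manifold R n).
Local Notation H := (halfspace R n).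
Local Notation dom a := (chart_dom (atlas (m := M) a)).
Local Notation phi a := (chart_coord (atlas (m := M) a)).
Local Notation par a := (chart_param (atlas (m := M) a)).

Lemma chart_radius a p : dom a p -> exists2 r : R, 0 < r &
  forall x, `|x - phi a p| <= 2 * r -> H x -> chart_image a x.
Proof.
move=> ap; have /nbhs_ballP [r /= r0 rP] := image_near ap.
exists (r / 4); first by rewrite divr_gt0.
move=> x xr Hx; apply: rP => //; rewrite -ball_normE /ball_ /= distrC (le_lt_trans xr)//.
by lra.
Qed.

(** Where the bump is 1 the push raises the normal coordinate by [e]. A point whose image is within
    e / 2 of the boundary point [c] would lie there and so have negative normal coordinate. *)
Lemma push_off_boundary a p0 (k0 : 'I_n) : dom a p0 -> k0 = 0%N :> nat -> phi a p0 0 k0 = 0 ->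
  exists2 U, nbhs p0 U & forall p, U p -> exists2 psi : M -> M, pullback_map psi & forall z, psi z <> p.
Proof.
move=> ap k00 c0; have [r r0 rP] := chart_radius ap; set c := phi a p0 in rP c0.
have [rho [delta [rho0 delta0 hd]]] := push_exists r0 rP.
(* By e <= rho / 4 a preimage of [p] lies within e / 2 + e <= rho of [c], where the bump is 1. *)
pose e := Num.min delta (rho / 4).
have e0 : 0 < e by rewrite lt_min delta0 divr_gt0.
have ed : `|e *: 'e_k0 : 'rV[R]_n| <= e.
  by rewrite normrZ gtr0_norm// ler_piMr ?norm_delta_le// ltW.
have [|x t xr Hx /andP[t0 t1]|psi [psiP psiN psiD]] := hd (e *: 'e_k0).
- by rewrite (le_trans ed)// ge_min lexx.
- move=> k k1; rewrite !mxE addr_ge0 ?Hx// !mulr_ge0 ?ler0n// ltW//.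
exists [set p | dom a p /\ ball c (e / 2) (phi a p)].
  by apply: chart_near => //; apply: nbhsx_ballx; rewrite divr_gt0.
move=> p [dp]; rewrite -ball_normE /ball_ /= distrC => pe; exists psi => // z zp.
have [az|nz] := pselect (dom a z); last by apply: (nz); rewrite -(psiN z nz) zp.
have [_ [t [tE /andP[t0 t1] trho]]] := psiD z az; rewrite zp in tE.
have zc : `|phi a z - c| <= rho.
  have -> : phi a z - c = (phi a p - c) - t *: (e *: 'e_k0) by rewrite tE addrAC addrK.
  rewrite (le_trans (ler_normB _ _))// [`|t *: _|]normrZ (ger0_norm t0).
  have h1 : t * `|e *: 'e_k0 : 'rV[R]_n| <= e.
    by rewrite (le_trans _ ed)// ler_piMl.
  have h2 : e <= rho / 4 by rewrite ge_min lexx orbT.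
  move: (ltW pe) h1 h2 rho0; clear; move: (e) (`|phi a p - c|) (t * _) => e' x y; lra.
have := chart_coord_halfspace az k00; rewrite leNgt => /negP; apply.
have -> : phi a z 0 k0 = phi a p 0 k0 - e.
  by rewrite tE trho// !mxE !eqxx !mulr1 mul1r addrK.
have := le_lt_trans (coord_le_norm (phi a p - c) k0) pe.
rewrite !mxE c0 subr0 => /ltr_normlW; move: e0; clear; move: (phi a p 0 k0) (e) => y e' e0' h; lra.
Qed.

(** Where the bump is 1, the push along the difference of the coordinates of [p] and [q] takes [q]
    to [p]. *)
Lemma push_interior a p0 (k0 : 'I_n) : dom a p0 -> k0 = 0%N :> nat -> 0 < phi a p0 0 k0 ->
  exists2 U, nbhs p0 U & forall p q, U p -> U q -> exists2 psi : M -> M, pullback_map psi & psi q = p.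
Proof.
move=> ap k00 c0; have [r' r'0 rP'] := chart_radius ap; set c := phi a p0 in rP' c0.
(* With a quarter of the normal coordinate of [c], points of the cube displaced by at most r stay in
   the half-space. *)
pose r := Num.min r' (c 0 k0 / 4).
have r0 : 0 < r by rewrite lt_min r'0 divr_gt0.
have rP x : `|x - c| <= 2 * r -> H x -> chart_image a x.
  by move=> xr; apply: rP'; rewrite (le_trans xr)// ler_pM2l// ge_min lexx.
have [rho [delta [rho0 delta0 hd]]] := push_exists r0 rP.
(* rho puts [p] and [q] where the bump is 1; delta / 2 and r / 2 bound their difference by delta, to
   be admissible, and by r, to respect the half-space. *)
pose e := Num.min rho (Num.min (delta / 2) (r / 2)).
have e0 : 0 < e by rewrite !lt_min rho0 !divr_gt0.
exists [set p | dom a p /\ ball c e (phi a p)].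
  by apply: chart_near => //; apply: nbhsx_ballx.
move=> p q [dp] + [dq]; rewrite -!ball_normE /ball_ /= ![`|c - _|]distrC => /ltW pe /ltW qe.
have de : `|phi a p - phi a q| <= e + e.
  have -> : phi a p - phi a q = (phi a p - c) - (phi a q - c) by rewrite opprB addrA subrK.
  by rewrite (le_trans (ler_normB _ _))// lerD.
have e1 : e <= rho by rewrite ge_min lexx.
have e2 : e <= delta / 2 by rewrite !ge_min lexx orbT.
have e3 : e <= r / 2 by rewrite !ge_min lexx !orbT.
have [|x t xr Hx /andP[t0 t1]|psi [psiP psiN psiD]] := hd (phi a p - phi a q).
- by rewrite (le_trans de)// [leRHS]splitr lerD.
- move=> k k1; have -> : k = k0 by apply: val_inj; rewrite /= k1.
  have h1 := le_trans (coord_le_norm (x - c) k0) xr.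
  have h2 : `|t *: (phi a p - phi a q)| <= r.
    rewrite normrZ (ger0_norm t0) (le_trans (_ : _ <= 1 * (e + e)))//.
      by rewrite ler_pM.
    by rewrite mul1r [leRHS]splitr lerD.
  have := le_trans (coord_le_norm (t *: (phi a p - phi a q)) k0) h2.
  rewrite [(x + _) 0 k0]mxE; move: h1; rewrite [(x - c) 0 k0]mxE [(- c) 0 k0]mxE.
  have : r <= c 0 k0 / 4 by rewrite ge_min lexx orbT.
  move: c0; clear; move: (x 0 k0) (c 0 k0) ((t *: (phi a p - phi a q)) 0 k0) r => x0 y0 w r1 c0 h3.
  rewrite !ler_norml => /andP[u1 u2] /andP[w1 w2]; lra.
exists psi => //; have [dpsi [t [tE t01 trho]]] := psiD q dq.
rewrite -(chart_coordK dpsi) -(chart_coordK dp); congr (par a _).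
by rewrite tE trho ?scale1r ?(le_trans qe)// addrC subrK.
Qed.

(** A point of [s] without preimage contributes the default [x0], so that the size is kept
    exactly. *)
Lemma preimage_seq (psi : M -> M) (s : seq M) (x0 : M) : injective psi ->
  exists2 s' : seq M, size s' = size s & forall z, psi z \in s -> z \in s'.
Proof.
move=> inj.
have /choice [pre preP] : forall y : M, exists x, forall z, psi z = y -> x = z.
  move=> y; have [[x xy]|nx] := pselect (exists x, psi x = y).
    by exists x => z zy; apply: inj; rewrite xy zy.
  by exists x0 => z zy; case: nx; exists z.
exists (map pre s); first by rewrite size_map.
by move=> z zs; apply/mapP; exists (psi z) => //; symmetry; exact: preP.
Qed.

Lemma noncritical_exists : (0 < n)%N -> connected [set: M] -> boundary_points M !=set0 ->
  (exists (f : M -> R) (s : seq M), smooth f /\ forall p, critical f p -> p \in s) ->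
  exists2 f : M -> R, smooth f & forall p, ~ critical f p.
Proof.
move=> n0 conM [b0 [a0 [ab0 [k0 [k00 b0k]]]]] [f0 [s0 [sf0 fs0]]].
(* Lists that contain the critical points, possibly among others: their least size replaces the
   least number of critical points. *)
pose P k := `[< exists (f : M -> R) (s : seq M), [/\ smooth f, size s = k & forall p, critical f p -> p \in s] >].
have exP : exists k, P k by exists (size s0); apply/asboolP; exists f0, s0.
case: (ex_minnP exP) => -[|m] /asboolP [f [s [sf ss fs]]] mmin.
  exists f => // p /fs; by rewrite (size0nil ss).
have [p1 [s1 [sE s1m]]] : exists p1 s1, s = p1 :: s1 /\ size s1 = m.
  by case: (s) ss => // p1 s1 [E]; exists p1, s1.
(* D q: one critical point can be brought to q, keeping the other m of them
   in a list. *)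
pose D q := exists (f : M -> R) (s : seq M), [/\ smooth f, size s = m & forall p, critical f p -> p \in q :: s].
have D1 : D p1 by exists f, s1; rewrite -sE.
(* Composition with [psi] moves the distinguished point backwards, from [p] = psi q to [q], and
   replaces the others by their preimages. *)
have Dpush p q psi : D p -> pullback_map psi -> psi q = p -> D q.
  move=> [g [s' [sg ss' gs']]] [inj ps pc] qp.
  have [s'' ss'' s''P] := preimage_seq s' q inj.
  exists (g \o psi), s''; split; [exact: ps|by rewrite ss''|].
  move=> z cz; have := gs' _ (pc g z sg cz); rewrite !inE => /orP[/eqP|/s''P ->]; last by rewrite orbT.
  by rewrite -qp => /inj ->; rewrite eqxx.
(* A distinguished point without preimage drops out and leaves a list of size m, against
   minimality. *)
have Dmiss p psi : D p -> pullback_map psi -> (forall z, psi z <> p) -> False.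
  move=> [g [s' [sg ss' gs']]] [inj ps pc] miss.
  have [s'' ss'' s''P] := preimage_seq s' p inj.
  suff /mmin : P m by rewrite ltnn.
  apply/asboolP; exists (g \o psi), s''; split; [exact: ps|by rewrite ss''|].
  move=> z cz; have := gs' _ (pc g z sg cz); rewrite inE => /orP[/eqP /miss //|].
  exact: s''P.
(* Near a boundary point [D] fails throughout, and near an interior point it holds everywhere or
   nowhere. Hence the set of its points is open and closed, and it contains [p1]. *)
have local (c : M) : exists2 U, nbhs c U & (forall p, U p -> ~ D p) \/ (forall p q, U p -> U q -> D p -> D q).
  have [a ac] := atlas_cover c.
  have := chart_coord_halfspace ac (erefl : Ordinal n0 = 0%N :> nat).
  rewrite le_eqVlt => /orP[/eqP/esym c0|c0].
    have [U nU UP] := push_off_boundary ac (erefl : Ordinal n0 = 0%N :> nat) c0.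
    by exists U => //; left => p /UP [psi psiP miss] Dp; exact: Dmiss Dp psiP miss.
  have [U nU UP] := push_interior ac (erefl : Ordinal n0 = 0%N :> nat) c0.
  by exists U => //; right => p q Up Uq Dp; have [psi psiP E] := UP p q Up Uq; exact: Dpush Dp psiP E.
have DT : [set q | D q] = [set: M].
  apply: conM.
  - by exists p1.
  - exists [set q | D q]; last by rewrite setTI.
    rewrite openE => c /= Dc; have [U nU hU] := local c; have Uc := nbhs_singleton nU.
    case: hU => h; first by case: (h c).
    by apply: filterS nU => q Uq /=; exact: (h c q).
  - exists [set q | D q]; last by rewrite setTI.
    rewrite -openC openE => c /= Dc; have [U nU hU] := local c; have Uc := nbhs_singleton nU.
    case: hU => h; first by apply: filterS nU => q Uq /=; exact: h.
    by apply: filterS nU => q Uq /= Dq; apply: Dc; exact: (h q c).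
have Db : D b0 by have : [set q | D q] b0 by rewrite DT.
have [U nU UP] := push_off_boundary ab0 k00 b0k.
have [psi psiP miss] := UP b0 (nbhs_singleton nU).
by exfalso; exact: Dmiss Db psiP miss.
Qed.

End Removal.

(** * Functions with finitely many critical points *)

Lemma det_neq0_open (R : realType) n (A : 'M[R]_n) : \det A != 0 ->
  exists2 e : R, 0 < e & forall B : 'M[R]_n, (forall i j, `|A i j - B i j| < e) -> \det B != 0.
Proof.
move=> A0.
have h : (fun B : 'M[R]_n => \det B) @ nbhs A --> \det A.
  by apply: cvg_det => i j; exact: coord_continuous.
have nn : nbhs (\det A) [set t | t != 0] by apply: open_nbhs_nbhs; split => //; exact: open_neq.
have {h} : nbhs A [set B | \det B != 0] by exact: (h _ nn).
case/nbhs_ballP => e /= e0 eP; exists e => // B AB; apply: eP.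
by split => // i j; rewrite -ball_normE; exact: AB.
Qed.

(** [G y - G x] is [y - x] times a matrix of partials, each entry taken at its own intermediate
    point; near [x] this matrix is invertible because the Jacobian at [x] is. *)
Lemma isolated_zero (R : realType) n (V : set 'rV[R]_n) (G : 'I_n -> 'rV[R]_n -> R) x :
  open V -> V x -> (forall j, Ck 1 V (G j)) -> \det (\matrix_(i, j) 'D_'e_i (G j) x) != 0 ->
  \forall y \near x, (forall j, G j y = G j x) -> y = x.
Proof.
move=> oV Vx CG /det_neq0_open [e e0 eP].
have near1 : \forall y \near x, V y /\ forall i j, `|'D_'e_i (G j) x - 'D_'e_i (G j) y| < e.
  apply: (@filterI _ _ (nbhs_filter x)); first exact: open_nbhs_nbhs.
  apply: (@filter_forall _ _ _ (nbhs x) (nbhs_filter x)) => i.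
  apply: (@filter_forall _ _ _ (nbhs x) (nbhs_filter x)) => j.
  have /cvgrPdist_lt := Ck_continuous (Ck_derive i (CG j)) Vx; exact.
case/nbhs_ballP : near1 => d /= d0 dP.
apply/nbhs_ballP; exists d => // y; rewrite -ball_normE /ball_ /= distrC => yx Gxy.
have dP' (z : 'rV[R]_n) : `|z - x| <= `|y - x| ->
    V z /\ forall i j, `|'D_'e_i (G j) x - 'D_'e_i (G j) z| < e.
  by move=> zx; apply: dP; rewrite -ball_normE /ball_ /= distrC (le_lt_trans zx).
have /choice [xi xiP] j : exists xi : 'I_n -> 'rV[R]_n, (forall i, `|xi i - x| <= `|y - x|) /\
    G j y - G j x = \sum_i (y 0 i - x 0 i) * 'D_'e_i (G j) (xi i).
  have [|xi h1 h2] := @mean_value R n (G j) x y; last by exists xi.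
  by move=> z i zx; apply: Ck_derivable (CG j) _; case: (dP' z zx).
have d1 : \det (\matrix_(i, j) 'D_'e_i (G j) (xi j i)) != 0.
  apply: eP => i j; rewrite [X in X - _]mxE [X in _ - X]mxE.
  by have [h _] := xiP j; have [_] := dP' _ (h i); exact.
apply/eqP; rewrite -subr_eq0; apply: contraNT d1 => yx0.
apply/det0P; exists (y - x) => //; apply/rowP => j; rewrite mxE [RHS]mxE.
have [_] := xiP j; rewrite Gxy subrr => /esym E.
by apply: etrans E; apply: eq_bigr => i _; rewrite [in LHS]mxE [in LHS]mxE [in LHS]mxE.
Qed.

Section Robust.
Variables (R : realType) (m n : nat) (V : set 'rV[R]_n) (F : 'I_m -> 'rV[R]_n -> R).
Hypotheses (oV : open V) (CF : forall l, Ck 2 V (F l)).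

Definition grad (w : 'rV[R]_m) j x := \sum_l w 0 l * 'D_'e_j (F l) x.

Definition hess (w : 'rV[R]_m) x : 'M[R]_n :=
  \matrix_(i, j) \sum_l w 0 l * 'D_'e_i ('D_'e_j (F l)) x.

(** The Morse condition at [x] for the combination with weights [w]. *)
Definition nondegenerate w x := (exists j, grad w j x != 0) \/ \det (hess w x) != 0.

(** The condition is open in the pair (x, w), so compactness of [K] gives a margin in [w] valid on
    all of [K]. *)
Lemma nondegenerate_open K w : compact K -> K `<=` V -> (forall x, K x -> nondegenerate w x) ->
  exists2 d : R, 0 < d & forall w', `|w' - w| <= d -> forall x, K x -> nondegenerate w' x.
Proof.
move=> cK KV nd.
pose P A := exists2 d : R, 0 < d & forall w', `|w' - w| <= d -> forall x, A x -> nondegenerate w' x.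
apply: (compact_ideal (P := P) cK).
- by exists 1.
- move=> A B [a a0 aP] [b b0 bP]; exists (Num.min a b); first by rewrite lt_min a0.
  by move=> w'; rewrite le_min => /andP[wa wb] x [Ax|Bx]; [exact: aP|exact: bP].
- by move=> A B AB [b b0 bP]; exists b => // w' ww' x /AB; exact: bP.
move=> x Kx; have Vx := KV x Kx.
have lin (g : 'I_m -> 'rV[R]_n -> R) : (forall l, {for x, continuous (g l)}) ->
    (fun z : 'rV[R]_n * 'rV[R]_m => \sum_l z.2 0 l * g l z.1) @ nbhs (x, w) --> \sum_l w 0 l * g l x.
  move=> cg; apply: cvg_sum_fun => l _; apply: cvgM.
    apply: (@cvg_comp _ _ _ snd (fun v : 'rV[R]_m => v 0 l) _ (nbhs w)); first exact: cvg_snd.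
    exact: coord_continuous.
  by apply: (@cvg_comp _ _ _ fst (g l) _ (nbhs x)); [exact: cvg_fst|exact: cg].
suff [[A B] /= [nA nB] AB] : \forall z \near (x, w), nondegenerate z.2 z.1.
  exists A => //; have [d /= d0 dP] := (nbhs_ballP _ _).1 nB.
  exists (d / 2); first by rewrite divr_gt0.
  move=> w' ww' y Ay; apply: (AB (y, w')); split => //; apply: dP.
  rewrite -ball_normE /ball_ /= distrC (le_lt_trans ww')//.
  by rewrite ltr_pdivrMr// ltr_pMr// ltr1n.
have [[j gj]|dh] := nd x Kx.
  have : (fun z : 'rV[R]_n * 'rV[R]_m => grad z.2 j z.1) @ nbhs (x, w) --> grad w j x.
    exact: (lin (fun l => 'D_'e_j (F l)) (fun l => Ck_continuous (Ck_derive j (CF l)) Vx)).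
  have nn : nbhs (grad w j x) [set t | t != 0].
    by apply: open_nbhs_nbhs; split => //; exact: open_neq.
  move=> /(_ _ nn) h; have {}h : nbhs (x, w) [set z | grad z.2 j z.1 != 0] by exact: h.
  by apply: filterS h => z h; left; exists j.
have : (fun z : 'rV[R]_n * 'rV[R]_m => \det (hess z.2 z.1)) @ nbhs (x, w) --> \det (hess w x).
  apply: cvg_det => i j; rewrite [in X in _ --> X]mxE.
  have -> : (fun z : 'rV[R]_n * 'rV[R]_m => hess z.2 z.1 i j) =
    (fun z => \sum_l z.2 0 l * 'D_'e_i ('D_'e_j (F l)) z.1) by apply/funext => z; exact: mxE.
  exact: (lin (fun l => 'D_'e_i ('D_'e_j (F l)))
    (fun l => Ck_continuous (Ck_derive i (Ck_derive j (CF l))) Vx)).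
have nn : nbhs (\det (hess w x)) [set t | t != 0].
  by apply: open_nbhs_nbhs; split => //; exact: open_neq.
move=> /(_ _ nn) h; have {}h : nbhs (x, w) [set z | \det (hess z.2 z.1) != 0] by exact: h.
by apply: filterS h => z h; right.
Qed.

Lemma is_derive_lin (g : 'I_m -> 'rV[R]_n -> R) (w : 'rV[R]_m) i x :
  (forall l, derivable (g l) x 'e_i) ->
  is_derive x ('e_i : 'rV[R]_n) (fun y => \sum_l w 0 l * g l y) (\sum_l w 0 l * 'D_'e_i (g l) x).
Proof.
move=> dg.
have -> : (fun y => \sum_l w 0 l * g l y) = \sum_l (w 0 l *: g l).
  by apply/funext => y; rewrite fct_sumE.
by apply: is_derive_sum => l; apply: is_deriveZ; exact: derivableP.
Qed.

Lemma Ck_grad w j : Ck 1 V (grad w j).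
Proof.
by apply: Ck_sum => // l _; apply: Ck_mul => //; [exact: Ck_cst|exact: Ck_derive j (CF l)].
Qed.

Lemma hessE w x : V x -> hess w x = \matrix_(i, j) 'D_'e_i (grad w j) x.
Proof.
move=> Vx; apply/matrixP => i j; rewrite [LHS]mxE [RHS]mxE.
have [_ E] := @is_derive_lin (fun l => 'D_'e_j (F l)) w i x
  (fun l => Ck_derivable (Ck_derive j (CF l)) Vx).
exact: (esym E).
Qed.

End Robust.

(** Lowering the weights at [kappa] by [v] subtracts a linear function wherever these members of the
    family are the coordinates. [D] stands for a derivative of the family at a point. *)
Lemma sum_shift (R : realType) m n (w : 'rV[R]_m) (v : 'rV[R]_n) (kappa : 'I_n -> 'I_m) (D : 'I_m -> R) :
  \sum_l (w - \sum_k v 0 k *: 'e_(kappa k)) 0 l * D l = \sum_l w 0 l * D l - \sum_k v 0 k * D (kappa k).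
Proof.
under eq_bigr do rewrite mxE mulrDl.
rewrite big_split /=; congr (_ + _).
under eq_bigr do rewrite mxE mulNr summxE mulr_suml.
rewrite sumrN exchange_big /=; congr (- _); apply: eq_bigr => k _.
rewrite (bigD1 (kappa k))//= !mxE !eqxx mulr1 big1 ?addr0// => l /negPf h.
by rewrite !mxE h andbF mulr0 mul0r.
Qed.

Section Family.
Variables (R : realType) (n : nat) (M : manifold R n) (m : nat) (b : 'I_m -> M -> R).
Hypothesis sb : forall l, smooth (b l).
Local Notation H := (halfspace R n).
Local Notation dom a := (chart_dom (atlas (m := M) a)).
Local Notation phi a := (chart_coord (atlas (m := M) a)).
Local Notation par a := (chart_param (atlas (m := M) a)).

Definition combination (w : 'rV[R]_m) p := \sum_l w 0 l * b l p.

Lemma combination_germ w a p : dom a p -> smooth_germ (phi a p) (combination w \o par a).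
Proof.
move=> ap; apply: smooth_germ_sum => l _; apply: smooth_germ_mul; first exact: smooth_germ_cst.
by apply: smooth_at_germ ap; exact: (smoothP _).1 (sb l) p.
Qed.

Lemma smooth_combination w : smooth (combination w).
Proof.
apply/smoothP => p; have [a ap] := atlas_cover p; exists a => //; exact: combination_germ.
Qed.

Section Extension.
Variables (a : chart_index M) (V : set 'rV[R]_n) (F : 'I_m -> 'rV[R]_n -> R).
Hypotheses (oV : open V) (CF : forall l, Ck 2 V (F l)).
Hypothesis Fb : forall l y, V y -> H y -> F l y = b l (par a y).

Lemma critical_grad w q : dom a q -> V (phi a q) -> critical (combination w) q ->
  forall j, grad F w j (phi a q) = 0.
Proof.
move=> aq Vq cq j; have sq : smooth_at (combination w) q by exact: (smoothP _).1 (smooth_combination w) q.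
have := critical_chart sq cq aq j.
have [d E] := @is_derive_lin R m n F w j _ (fun l => Ck_derivable (CF l) Vq).
rewrite (hpartial_extension oV Vq (chart_coord_halfspace aq) d) ?E//.
by move=> y Vy Hy; apply: eq_bigr => l _; rewrite Fb.
Qed.

(** Either the gradient is nonzero at [p], hence nearby, or its zero at [p] is nondegenerate and
    [isolated_zero] applies. *)
Lemma critical_isolated w p : dom a p -> V (phi a p) -> nondegenerate F w (phi a p) ->
  \forall q \near p, critical (combination w) q -> q = p.
Proof.
move=> ap Vp nd.
have nV : nbhs (phi a p) V by exact: open_nbhs_nbhs.
have [[j gj]|g0] := pselect (exists j, grad F w j (phi a p) != 0).
  have nn : nbhs (grad F w j (phi a p)) [set t | t != 0].
    by apply: open_nbhs_nbhs; split => //; exact: open_neq.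
  have h : nbhs (phi a p) [set y | grad F w j y != 0].
    exact: (Ck_continuous (Ck_grad oV CF w j) Vp nn).
  apply: filterS (chart_near ap (@filterI _ _ (nbhs_filter (phi a p)) _ _ nV h)) => q [aq [Vq gq]] cq.
  by move: gq; rewrite /= (critical_grad aq Vq cq j) eqxx.
case: nd => // dh.
have z0 j : grad F w j (phi a p) = 0.
  by apply/eqP; apply: contraT => gj; case: g0; exists j.
rewrite (hessE CF w Vp) in dh.
have h := isolated_zero oV Vp (Ck_grad oV CF w) dh.
apply: filterS (chart_near ap (@filterI _ _ (nbhs_filter (phi a p)) _ _ nV h)) => q [aq [Vq gq]] cq.
rewrite -(chart_coordK aq) -(chart_coordK ap) gq// => j.
by rewrite z0; exact: critical_grad.
Qed.

End Extension.

Definition isolated_critical (f : M -> R) p := \forall q \near p, critical f q -> q = p.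

(* The margin d lets finitely many sets be treated one after the other. *)
Definition generic (A : set M) := forall w (e : R), 0 < e ->
  exists2 w', `|w' - w| <= e & exists2 d : R, 0 < d &
    forall w'', `|w'' - w'| <= d -> forall p, A p -> isolated_critical (combination w'') p.

Lemma generic_setU A B : generic A -> generic B -> generic (A `|` B).
Proof.
move=> gA gB w e e0; have e20 : 0 < e / 2 by rewrite divr_gt0.
have [w1 w1e [d1 d10 h1]] := gA w _ e20.
(* The second perturbation uses at most half of the margin left by the first; the new margin stays
   within the other half. *)
have [|w2 w2e [d2 d20 h2]] := gB w1 (Num.min (e / 2) (d1 / 2)).
  by rewrite lt_min e20 divr_gt0.
move: w2e; rewrite le_min => /andP[w2e w2d]; exists w2.
  have -> : w2 - w = (w2 - w1) + (w1 - w) by rewrite addrA subrK.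
  by rewrite (le_trans (ler_normD _ _))// [leRHS]splitr lerD.
exists (Num.min d2 (d1 / 2)); first by rewrite lt_min d20 divr_gt0.
move=> w3; rewrite le_min => /andP[w3a w3b] p [Ap|Bp]; last exact: h2 Bp.
apply: h1 Ap; have -> : w3 - w1 = (w3 - w2) + (w2 - w1) by rewrite addrA subrK.
by rewrite (le_trans (ler_normD _ _))// [leRHS]splitr lerD.
Qed.

End Family.

Section Local.
Variables (R : realType) (n : nat) (M : manifold R n.+1) (m : nat) (b : 'I_m -> M -> R).
Hypothesis sb : forall l, smooth (b l).
Local Notation H := (halfspace R n.+1).
Local Notation dom a := (chart_dom (atlas (m := M) a)).
Local Notation phi a := (chart_coord (atlas (m := M) a)).
Local Notation par a := (chart_param (atlas (m := M) a)).

(** Near [p] the coordinates belong to the family, so subtracting [v] from their weights shifts the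
    gradient by [v] and keeps the Hessian. With [v] a small regular value of the gradient, from
    [sard], all critical points become nondegenerate. *)
Lemma generic_local p a (kappa : 'I_n.+1 -> 'I_m) : dom a p ->
  (\forall q \near p, dom a q -> forall k, b (kappa k) q = phi a q 0 k) ->
  exists2 U, nbhs p U & generic b U.
Proof.
move=> ap nk; set c := phi a p.
have /choice [VF VFP] l : exists VF : set 'rV[R]_n.+1 * ('rV[R]_n.+1 -> R),
    [/\ open VF.1, VF.1 c, forall k, Ck k VF.1 VF.2 & forall y, VF.1 y -> H y -> VF.2 y = b l (par a y)].
  have [V [F [h1 h2 h3 h4]]] := smooth_at_germ ((smoothP _).1 (sb l) p) ap.
  by exists (V, F).
pose F l := (VF l).2.
pose P := [set y : 'rV[R]_n.+1 | (forall l, (VF l).1 y) /\ (H y -> forall k, b (kappa k) (par a y) = y 0 k)].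
have nP : nbhs c P.
  apply: (@filterI _ _ (nbhs_filter c)).
    apply: (@filter_forall _ _ _ (nbhs c) (nbhs_filter c)) => l.
    by have [h1 h2 _ _] := VFP l; exact: open_nbhs_nbhs.
  apply: filterS (param_near ap nk) => y h Hy k.
  by have [h1 h2 h3] := h Hy; rewrite h3// h2.
pose V := P^°.
have oV : open V by exact: open_interior.
have CF l k : Ck k V (F l).
  by have [_ _ h _] := VFP l; apply: Ck_subset (h k) => y /interior_subset [].
have Fb l y : V y -> H y -> F l y = b l (par a y).
  by have [_ _ _ h] := VFP l; move=> /interior_subset [/(_ l) Vy _]; exact: h.
have Fk k y : V y -> H y -> F (kappa k) y = y 0 k.
  by move=> Vy Hy; rewrite Fb//; have [_] := interior_subset Vy; exact.
(* Across the boundary [F (kappa k)] is an arbitrary extension. Its derivatives are those of the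
   coordinate on the half-space only, whence the intersection in [K] below. *)
have dF j k y : V y -> H y -> 'D_'e_j (F (kappa k)) y = (j == k)%:R.
  move=> Vy Hy; rewrite -(hpartial_coord j k Hy).
  by rewrite (hpartial_extension oV Vy Hy (Ck_derivable (CF _ 1%N) Vy) (Fk k)).
have ddF i j k y : V y -> H y -> 'D_'e_i ('D_'e_j (F (kappa k))) y = 0.
  move=> Vy Hy; rewrite -(hpartial_cst i (j == k)%:R Hy).
  exact: (esym (@hpartial_extension _ _ _ (fun=> _) _ V y oV Vy Hy
    (Ck_derivable (Ck_derive j (CF (kappa k) 2%N)) Vy) (dF j k))).
have [r r0 rV] : exists2 r : R, 0 < r & forall x, `|x - c| <= 2 * r -> V x.
  have /nbhs_ballP [r /= r0 rP] : nbhs c V by exact: nbhs_interior.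
  exists (r / 4); first by rewrite divr_gt0.
  move=> x xr; apply: rP; rewrite -ball_normE /ball_ /= distrC (le_lt_trans xr)//; lra.
pose K := [set x | `|x - c| <= r] `&` H.
have KV : K `<=` V.
  by move=> x [xr _]; apply: rV; rewrite (le_trans xr)// ler_peMl ?ler1n// ltW.
have cK : compact K by exact: compact_cube_halfspace.
exists [set q | dom a q /\ ball c r (phi a q)].
  by apply: chart_near => //; exact: nbhsx_ballx.
move=> w e e0; have e'0 : 0 < e / n.+1%:R by rewrite divr_gt0// ltr0n.
have [v ve vP] := sard r0 rV (Ck_grad oV (CF^~ 2%N) w) e'0.
pose w' := w - \sum_k v 0 k *: 'e_(kappa k).
exists w'.
  rewrite /w' addrAC subrr sub0r normrN (le_trans (ler_norm_sum _ _ _))//.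
  apply: (@le_trans _ _ (\sum_(k < n.+1) e / n.+1%:R)).
    apply: ler_sum => k _; rewrite normrZ (le_trans _ ve)//.
    by rewrite (le_trans _ (coord_le_norm v k))// ler_piMr ?norm_delta_le.
  by rewrite sumr_const card_ord -[leLHS]mulr_natr divfK// pnatr_eq0.
have ndK x : K x -> nondegenerate F w' x.
  move=> Kx; have Vx := KV x Kx; have [xr Hx] := Kx.
  have gE j : grad F w' j x = grad F w j x - v 0 j.
    rewrite /grad sum_shift; congr (_ - _).
    rewrite (bigD1 j)//= dF// eqxx mulr1 big1 ?addr0// => k /negPf kj.
    by rewrite dF// eq_sym kj mulr0.
  have hE : hess F w' x = hess F w x.
    apply/matrixP => i j; rewrite [LHS]mxE [RHS]mxE sum_shift.
    by rewrite [X in _ - X]big1 ?subr0// => k _; rewrite ddF// mulr0.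
  have [g1|g0] := pselect (exists j, grad F w' j x != 0); [by left|right].
  rewrite hE (hessE (CF^~ 2%N) w Vx); apply: vP => // j.
  apply/eqP; rewrite -subr_eq0 -gE; apply: contraT => gj; case: g0; by exists j.
have [d d0 dP] := nondegenerate_open (CF^~ 2%N) cK KV ndK.
exists d => // w'' ww q [aq]; rewrite -ball_normE /ball_ /= distrC => qr.
have Kq : K (phi a q) by split; [exact: ltW|exact: chart_coord_halfspace].
by apply: (critical_isolated sb oV (CF^~ 2%N) Fb aq (KV _ Kq)); exact: dP.
Qed.

End Local.

Section Finite.
Variables (R : realType) (n : nat) (M : manifold R n).
Local Notation dom a := (chart_dom (atlas (m := M) a)).
Local Notation phi a := (chart_coord (atlas (m := M) a)).

(** The coordinates times a bump, extended by 0; where the bump is 1 they are the coordinates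
    themselves. *)
Lemma local_coordinates_exist (p : M) : exists a (U : set M) (b : 'I_n -> M -> R), [/\ nbhs p U, forall k, smooth (b k) &
  forall q : M, U q -> dom a q /\ \forall z \near q, dom a z -> forall k, b k z = phi a z 0 k].
Proof.
have [a ap] := atlas_cover p; have [r r0 rP] := chart_radius ap; set c := phi a p in rP.
have [beta [d [d0 Cb _ b1 b0]]] := bump_exists c r0.
pose b k q := if pselect (dom a q) then beta (phi a q) * phi a q 0 k else 0.
have bE k q : dom a q -> b k q = beta (phi a q) * phi a q 0 k.
  by rewrite /b; case: pselect.
exists a, [set q | dom a q /\ ball c d (phi a q)], b; split.
- by apply: chart_near => //; exact: nbhsx_ballx.
- move=> k; apply/smoothP => q.
  have [[aq qr]|nq] := pselect (dom a q /\ `|phi a q - c| <= r).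
    exists a => //; apply: (@smooth_germ_eq _ _ _ (fun y => beta y * y 0 k)).
      apply: filterS (image_near aq) => y h Hy.
      by have [d1 d2] := chart_image_param (h Hy); rewrite /= bE// d2.
    by apply: smooth_germ_mul; [exact: smooth_germ_Ck|exact: smooth_germ_coord].
  apply: (@smooth_at_eq _ _ _ (fun=> 0)); last first.
    by have [a' aq] := atlas_cover q; exists a' => //; exact: smooth_germ_cst.
  have op : open (~` [set q | dom a q /\ `|phi a q - c| <= r]).
    by apply: closed_openC; exact: closed_core.
  apply: filterS (open_nbhs_nbhs (conj op (nq : (~` _) q))) => z nz.
  rewrite /b; case: pselect => // az; rewrite b0 ?mul0r//.
  by rewrite leNgt; apply/negP => h; apply: nz; split => //; exact: ltW.
move=> q [aq qd]; split => //.
have nb : nbhs (phi a q) (ball c d) by apply: open_nbhs_nbhs; split => //; exact: ball_open.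
apply: filterS (chart_near aq nb) => z [_]; rewrite -ball_normE /ball_ /= distrC => zd az k.
by rewrite bE// b1 ?mul1r// ltW.
Qed.

(** Over a union of two sets the families are concatenated, so compactness gives one finite
    family. *)
Lemma coordinate_family_exists : compact [set: M] -> exists (m : nat) (b : 'I_m -> M -> R),
  (forall l, smooth (b l)) /\ forall p : M, exists a (kappa : 'I_n -> 'I_m),
    dom a p /\ \forall q \near p, dom a q -> forall k, b (kappa k) q = phi a q 0 k.
Proof.
move=> cM.
pose P A := exists (m : nat) (b : 'I_m -> M -> R),
  (forall l, smooth (b l)) /\ forall p : M, A p -> exists a (kappa : 'I_n -> 'I_m),
    dom a p /\ \forall q \near p, dom a q -> forall k, b (kappa k) q = phi a q 0 k.
suff [m [b [sb h]]] : P [set: M] by exists m, b; split => // p; exact: h.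
apply: (compact_ideal cM).
- by exists 0%N, (fun _ _ => 0); split => // -[].
- move=> A B [m [b [sb h]]] [m' [b' [sb' h']]].
  pose bb (l : 'I_(m + m')) := match fintype.split l with inl i => b i | inr i => b' i end.
  exists (m + m')%N, bb; split.
    by rewrite /bb => l; case: fintype.split.
  move=> p [Ap|Bp].
    have [a [kappa [ap nk]]] := h p Ap; exists a, (fun k => lshift m' (kappa k)); split => //.
    apply: filterS nk => q h1 aq k; rewrite -h1//.
    by rewrite /bb -[lshift _ _]/(unsplit (inl _)) unsplitK.
  have [a [kappa [ap nk]]] := h' p Bp; exists a, (fun k => rshift m (kappa k)); split => //.
  apply: filterS nk => q h1 aq k; rewrite -h1//.
  by rewrite /bb -[rshift _ _]/(unsplit (inr _)) unsplitK.
- by move=> A B AB [m [b [sb h]]]; exists m, b; split => // p /AB; exact: h.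
move=> p _; have [a [U [b [nU sb h]]]] := local_coordinates_exist p.
exists U => //; exists n, b; split => // q /h [aq nq]; by exists a, id.
Qed.

End Finite.

(** Genericity of M gives weights for which each point, critical or not, has a neighbourhood without
    any other critical point; finitely many of these cover M. *)
Lemma finite_critical_exists (R : realType) n (M : manifold R n) : (0 < n)%N -> compact [set: M] ->
  exists (f : M -> R) (s : seq M), smooth f /\ forall p, critical f p -> p \in s.
Proof.
case: n M => // n M _ cM.
have [m [b [sb h]]] := coordinate_family_exists cM.
have gT : generic b [set: M].
  apply: (compact_ideal cM).
  - move=> w e e0; exists w; first by rewrite subrr normr0 ltW.
    by exists 1.
  - by move=> A B; exact: generic_setU.
  - move=> A B AB gB w e e0; have [w' we [d d0 dP]] := gB w e e0.
    by exists w' => //; exists d => // w'' ww p /AB; exact: dP.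
  - by move=> p _; have [a [kappa [ap nk]]] := h p; exact: (generic_local sb ap nk).
(* The initial weights 0 and the tolerance 1 are arbitrary. *)
have [w _ [d d0 dP]] := gT 0 1 ltr01.
have iso p : isolated_critical (combination b w) p.
  by apply: dP => //; rewrite subrr normr0 ltW.
exists (combination b w).
pose P A := exists s : seq M, forall p, A p -> critical (combination b w) p -> p \in s.
suff [s sP] : P [set: M] by exists s; split => [|p]; [exact: smooth_combination|exact: sP].
apply: (compact_ideal cM).
- by exists [::].
- move=> A B [s1 h1] [s2 h2]; exists (s1 ++ s2) => p; rewrite mem_cat.
  by case=> [Ap|Bp] cp; [rewrite (h1 p Ap cp)|rewrite (h2 p Bp cp) orbT].
- by move=> A B AB [s sP]; exists s => p /AB; exact: sP.
move=> p _; exists [set q | critical (combination b w) q -> q = p]; first exact: iso.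
by exists [:: p] => q hq /hq ->; rewrite inE eqxx.
Qed.

Theorem theorem1p2 (R : realType) (n : nat) (hn : (3 <= n)%N)
    (M : manifold R n) (g : metric M)
    (M_compact : compact [set: M]) (M_connected : connected [set: M])
    (M_boundary : boundary_points M !=set0) :
  exists u : M -> R,
    smooth u /\ positive_definite2 (einstein_tensor (conformal u g)).
Proof.
have n0 : (0 < n)%N by apply: leq_trans hn.
have [f sf ncf] := noncritical_exists n0 M_connected M_boundary (finite_critical_exists n0 M_compact).
apply: (einstein_positive_of_noncritical g hn M_compact (f := fun q => expR (f q))).
- apply/smoothP => p; have [a ap sfa] := (smoothP f).1 sf p.
  by exists a => //; exact: smooth_germ_expR.
- by move=> p /(critical_expR sf); exact: ncf.
- by move=> p; exact: expR_gt0.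
Qed.
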